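(* Let $N\ge 2$, let $V\subset\mathbb{R}^{N-1}$ be the Sierpiński gasket with intrinsic boundary $V_0$ and measure $\mu$, and let $a,g:V\to\mathbb{R}$ satisfy: $a\in L^1(V,\mu)$ and $a\le 0$ almost everywhere in $V$; $g\in C(V)$, $g\le 0$, and the restriction of $g$ to every non-empty open subset of $V$ is not identically zero. Let $f:\mathbb{R}\to\mathbb{R}$ be a non-negative continuous function such that $$\lim_{\xi\to 0^+}\frac{\int_0^\xi f(t)\,dt}{\xi^2}=+\infty .$$ Put $$\lambda^{*}:=-\frac{1}{2(2N+3)^2\left(\int_V g(x)\,d\mu\right)}\ \sup_{\gamma>0}\frac{\gamma^2}{\int_0^\gamma f(t)\,dt}\in\,]0,+\infty].$$ Then for every $\lambda\in\,]0,\lambda^{*}[$ the Dirichlet problem $$\Delta u(x)+a(x)u(x)=\lambda g(x)f(u(x)),\quad x\in V\setminus V_0,\qquad u|_{V_0}=0,$$ admits at least one non-trivial (i.e. not identically zero) weak solution $u_\lambda\in H^1_0(V)$. Furthermore, these solutions $(u_\lambda)_{\lambda\in]0,\lambda^*[}$ can be taken so that $\lim_{\lambda\to 0^+}\|u_\lambda\|=0$.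
   Context: Sierpiński gasket. Let $N\ge 2$ be a natural number and $p_1,\dots,p_N\in\mathbb{R}^{N-1}$ with $|p_i-p_j|=1$ for $i\ne j$. For $i\in\{1,\dots,N\}$ let $S_i:\mathbb{R}^{N-1}\to\mathbb{R}^{N-1}$, $S_i(x)=\frac12x+\frac12p_i$, and for $A\subseteq\mathbb{R}^{N-1}$ let $\mathcal{F}(A)=\bigcup_{i=1}^N S_i(A)$. The Sierpiński gasket $V$ is the unique non-empty compact subset of $\mathbb{R}^{N-1}$ with $\mathcal{F}(V)=V$. Its intrinsic boundary is $V_0=\{p_1,\dots,p_N\}$, and $V_m:=\mathcal{F}(V_{m-1})$ for $m\ge 1$. The measure $\mu$ is the restriction to $V$ of the $d$-dimensional Hausdorff measure on $\mathbb{R}^{N-1}$, $d=\ln N/\ln 2$ being the Hausdorff dimension of $V$, normalized so that $\mu(V)=1$. Function space. $C(V)$ is the space of real-valued continuous functions on $V$ and $C_0(V)=\{u\in C(V): u|_{V_0}=0\}$. For $u,v:V\to\mathbb{R}$ and $m\in\mathbb{N}$ let $$\mathcal{W}_m(u,v)=\left(\frac{N+2}{N}\right)^m\sum_{x,y\in V_m,\ |x-y|=2^{-m}}(u(x)-u(y))(v(x)-v(y)),\qquad W_m(u)=\mathcal{W}_m(u,u).$$ One has $W_m(u)\le W_{m+1}(u)$; put $W(u)=\lim_{m\to\infty}W_m(u)\in[0,+\infty]$. Let $H_0^1(V)=\{u\in C_0(V): W(u)<\infty\}$, which is a real Hilbert space with inner product $\mathcal{W}(u,v)=\lim_{m\to\infty}\mathcal{W}_m(u,v)$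 and norm $\|u\|=\sqrt{W(u)}$. Weak solution. $\Delta$ denotes the weak Laplacian on $V$, determined by $-\mathcal{W}(u,v)=\langle\Delta u,v\rangle$ for all $v\in H_0^1(V)$. A function $u\in H_0^1(V)$ is a weak solution of the Dirichlet problem if $$\mathcal{W}(u,v)-\int_V a(x)u(x)v(x)\,d\mu+\lambda\int_V g(x)f(u(x))v(x)\,d\mu=0\quad\text{for every }v\in H_0^1(V).$$ *)

(* Defs.v *)
From HB Require Import structures.
From mathcomp Require Import all_boot all_order all_algebra.
From mathcomp Require Import all_classical all_reals all_analysis.

Set Implicit Arguments.
Unset Strict Implicit.
Unset Printing Implicit Defensive.

Import Order.TTheory GRing.Theory Num.Theory.
Import numFieldNormedType.Exports.

Local Open Scope classical_set_scope.
Local Open Scope ring_scope.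

(* Functions on the gasket V are represented by functions on the whole space,
   of which only the values on V matter. *)

(* The library's norm on row vectors is the sup norm (same topology). *)
Definition euclid_dist (R : realType) (n : nat) (x y : 'rV[R]_n) : R :=
  Num.sqrt (\sum_(i < n) (x ord0 i - y ord0 i) ^+ 2).

(* Equal to -oo on set0. *)
Definition euclid_diam (R : realType) (n : nat) (A : set 'rV[R]_n) : \bar R :=
  ereal_sup [set (euclid_dist z.1 z.2)%:E | z in A `*` A].

(* The empty set has gauge 0 also when s = 0. *)
Definition hausdorff_gauge (R : realType) (n : nat) (s : R)
    (A : set 'rV[R]_n) : \bar R :=
  if A == set0 then 0%E else (euclid_diam A `^ s)%E.

Definition hausdorff_pre (R : realType) (n : nat) (s delta : R)
    (A : set 'rV[R]_n) : \bar R :=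
  ereal_inf [set (\sum_(k <oo) hausdorff_gauge s (U k))%E | U in
    [set U : nat -> set 'rV[R]_n |
      (forall k, (euclid_diam (U k) <= delta%:E)%E) /\ A `<=` \bigcup_k U k]].

Definition hausdorff (R : realType) (n : nat) (s : R)
    (A : set 'rV[R]_n) : \bar R :=
  ereal_sup [set hausdorff_pre s delta A |
             delta in [set delta : R | 0 < delta]].

Lemma euclid_diam0 (R : realType) (n : nat) :
  euclid_diam (set0 : set 'rV[R]_n) = -oo%E.
Proof.
rewrite /euclid_diam.
have -> : [set (euclid_dist z.1 z.2)%:E |
            z in (set0 : set 'rV[R]_n) `*` set0] = set0.
  by rewrite -subset0 => _ [z [[]]].
exact: ereal_sup0.
Qed.

Lemma hausdorff_gauge_ge0 (R : realType) (n : nat) (s : R)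
  (A : set 'rV[R]_n) : (0 <= hausdorff_gauge s A)%E.
Proof. by rewrite /hausdorff_gauge; case: ifP => // _; exact: poweR_ge0. Qed.

Section hausdorff_outer.
Local Open Scope ereal_scope.
Variables (R : realType) (n : nat) (s : R).

Lemma hausdorff_pre_ge0 (delta : R) (A : set 'rV[R]_n) :
  0 <= hausdorff_pre s delta A.
Proof.
apply: le_ereal_inf_tmp => _ [U _ <-].
by apply: nneseries_ge0 => k _ _; exact: hausdorff_gauge_ge0.
Qed.

Lemma le_hausdorff_pre (delta : R) :
  {homo @hausdorff_pre R n s delta : A B / A `<=` B >-> A <= B}.
Proof.
move=> A B AB; apply/ereal_inf_le_tmp => _ [U [dU BU] <-].
by exists U => //; split => //; apply: subset_trans AB BU.
Qed.

Lemma hausdorff_pre0 (delta : R) :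
  hausdorff_pre s delta (set0 : set 'rV[R]_n) = 0.
Proof.
apply/eqP; rewrite eq_le hausdorff_pre_ge0 andbT.
apply: ereal_inf_lbound; exists (fun=> set0).
  by split => // k; rewrite euclid_diam0 leNye.
by rewrite /hausdorff_gauge eqxx eseries0.
Qed.

Lemma hausdorff_pre_sigma_subadditive (delta : R) :
  sigma_subadditive (@hausdorff_pre R n s delta).
Proof.
move=> A; set h := hausdorff_pre s delta.
have [[i ioo]|] := pselect (exists i, h (A i) = +oo).
  rewrite (eseries_pinfty _ _ ioo) ?leey// => k _.
  by rewrite -ltNye (lt_le_trans _ (hausdorff_pre_ge0 _ _)).
rewrite -forallNE => Aoo.
suff add2e (e : {posnum R}) :
    h (\bigcup_n A n) <= \sum_(i <oo) h (A i) + e%:num%:E.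
  by apply/lee_addgt0Pr => _/posnumP[].
rewrite (le_trans _ (epsilon_trick _ _ _))//; last first.
  by move=> k; exact: hausdorff_pre_ge0.
pose P k (B : (set 'rV[R]_n)^nat) :=
  ((forall j, euclid_diam (B j) <= delta%:E) /\ A k `<=` \bigcup_j B j) /\
  \sum_(j <oo) hausdorff_gauge s (B j) <= h (A k) + (e%:num / (2 ^ k.+1)%:R)%:E.
have [G PG] : {G : ((set 'rV[R]_n)^nat)^nat & forall k, P k (G k)}.
  apply: (@choice _ _ P) => k; rewrite /P /h /hausdorff_pre.
  set S := (X in ereal_inf X); move infS : (ereal_inf S) => iS.
  case: iS infS => [r Sr|Soo|Soo].
  - have en1 : (0 < e%:num / (2 ^ k.+1)%:R)%R by [].
    have /(lb_ereal_inf_adherent en1) : ereal_inf S \is a fin_num by rewrite Sr.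
    move=> [x [B [mB AnB] <-] xS].
    by exists B; split => //; rewrite -Sr; exact/ltW.
  - by have := Aoo k; rewrite /h /hausdorff_pre Soo.
  - have := hausdorff_pre_ge0 delta (A k).
    by rewrite /hausdorff_pre -/S Soo.
pose w (i : nat * nat) := hausdorff_gauge s (G i.1 i.2).
have w_ge0 i : 0 <= w i by exact: hausdorff_gauge_ge0.
apply: (@le_trans _ _ (\esum_(i in setT) w i)).
  rewrite /h /hausdorff_pre; apply: ereal_inf_lbound => /=.
  have /card_esym/ppcard_eqP[f] := card_nat2.
  exists (uncurry G \o f).
    split => [i|t [i _ Ait]].
      by have := (PG (f i).1).1.1 (f i).2; rewrite /= /uncurry; case: (f i).
    have [j _ Bijt] := (PG i).1.2 _ Ait.
    by exists (f^-1%FUN (i, j)) => //=; rewrite invK ?inE.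
  transitivity (\sum_(i <oo) w (f i)).
    by apply: eq_eseriesr => i _; rewrite /w /= /uncurry; case: (f i).
  rewrite -(esum_pred_image w _ xpredT) ?[fun=> _]set_true//.
  by rewrite image_eq.
rewrite (_ : esum _ _ = \sum_(i <oo) \sum_(j <oo) w (i, j)); last first.
  pose J : nat -> set (nat * nat) := fun i => [set (i, j) | j in setT].
  rewrite (_ : setT = \bigcup_k J k); last first.
    by rewrite predeqE => -[a b]; split => // _; exists a => //; exists b.
  rewrite esum_bigcupT /=; last 2 first.
    - apply/trivIsetP => i j _ _ ij.
      rewrite predeqE => -[k m] /=; split => //= -[] [_] _ [<-{k} _].
      by move=> [m' _] [] /esym/eqP; rewrite (negbTE ij).
    - by move=> i; exact: w_ge0.
  rewrite -(image_id [set: nat]) -fun_true esum_pred_image//; last first.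
    by move=> k _; exact: esum_ge0.
  apply: eq_eseriesr => /= j _.
  rewrite -(esum_pred_image w (pair j) predT)//=; last first.
    by move=> ? ? _ _; exact: (@can_inj _ _ _ snd).
  by congr esum; rewrite predeqE => -[a b]; split; move=> [i _ <-]; exists i.
apply: lee_nneseries => [i _ _|i _].
- by apply: nneseries_ge0 => m _ _; exact: w_ge0.
- exact: (PG i).2.
Qed.

Lemma hausdorff_ge0 (A : set 'rV[R]_n) : 0 <= hausdorff s A.
Proof.
apply: le_ereal_sup_tmp; exists (hausdorff_pre s 1 A).
  by exists 1%R => /=.
exact: hausdorff_pre_ge0.
Qed.

Lemma le_hausdorff : {homo @hausdorff R n s : A B / A `<=` B >-> A <= B}.
Proof.
move=> A B AB; apply: ge_ereal_sup => _ [d d0 <-].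
apply: le_ereal_sup_tmp; exists (hausdorff_pre s d B); first by exists d.
exact: le_hausdorff_pre.
Qed.

Lemma hausdorff0 : hausdorff s (set0 : set 'rV[R]_n) = 0.
Proof.
apply/eqP; rewrite eq_le hausdorff_ge0 andbT.
by apply: ge_ereal_sup => _ [d d0 <-]; rewrite hausdorff_pre0.
Qed.

Lemma hausdorff_sigma_subadditive : sigma_subadditive (@hausdorff R n s).
Proof.
move=> A; apply: ge_ereal_sup => _ [d d0 <-].
apply: (le_trans (hausdorff_pre_sigma_subadditive d A)).
apply: lee_nneseries => [i _ _|i _]; first exact: hausdorff_pre_ge0.
by apply: le_ereal_sup_tmp; exists (hausdorff_pre s d (A i)) => //; exists d.
Qed.

End hausdorff_outer.

Section gasket.
Variables (R : realType) (N : nat) (p : 'I_N -> 'rV[R]_N.-1).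

Definition gasket_map (i : 'I_N) (x : 'rV[R]_N.-1) : 'rV[R]_N.-1 :=
  2^-1 *: x + 2^-1 *: p i.

Definition gasket_step (A : set 'rV[R]_N.-1) : set 'rV[R]_N.-1 :=
  \bigcup_(i : 'I_N) (gasket_map i @` A).

Definition is_gasket (V : set 'rV[R]_N.-1) : Prop :=
  [/\ V !=set0, compact V & gasket_step V = V].

Fixpoint gasket_vertices (m : nat) : set 'rV[R]_N.-1 :=
  if m is m'.+1 then gasket_step (gasket_vertices m') else range p.

(* The sum is over ordered pairs (x, y), so each unordered pair counts twice.
   For N >= 3 the distance condition also holds for some pairs that do not lie
   in a common cell, so energy_pre m u u need not be monotone in m; its limit in
   [0, +oo] still exists for every u. *)
Definition energy_pre (m : nat) (u v : 'rV[R]_N.-1 -> R) : R :=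
  ((N%:R + 2) / N%:R) ^+ m *
  \sum_(z \in [set z : 'rV[R]_N.-1 * 'rV[R]_N.-1 |
      [/\ gasket_vertices m z.1, gasket_vertices m z.2 &
          euclid_dist z.1 z.2 = 2 ^- m]])
    ((u z.1 - u z.2) * (v z.1 - v z.2)).

Definition energy (u : 'rV[R]_N.-1 -> R) : \bar R :=
  limn (fun m => (energy_pre m u u)%:E).

Definition energy_form (u v : 'rV[R]_N.-1 -> R) : R :=
  limn (fun m => energy_pre m u v).

Definition H01 (V : set 'rV[R]_N.-1) (u : 'rV[R]_N.-1 -> R) : Prop :=
  [/\ {within V, continuous u}, (forall i, u (p i) = 0) &
      (energy u < +oo)%E].

Definition H01_norm (u : 'rV[R]_N.-1 -> R) : R :=
  Num.sqrt (fine (energy u)).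

End gasket.

Definition caratheodory_measure (R : realType) (T : pointedType)
    (mu : {outer_measure set T -> \bar R}) :
    {measure set (caratheodory_type mu) -> \bar R} :=
  (mu : set (caratheodory_type mu) -> \bar R).

Section gasket_measure.
Variables (R : realType) (N : nat) (V : set 'rV[R]_N.-1).

Definition gasket_dim : R := ln N%:R / ln 2.

(* H^d restricted to V and normalized. *)
Definition gasket_outer (A : set 'rV[R]_N.-1) : \bar R :=
  ((fine (hausdorff gasket_dim V))^-1%:E * hausdorff gasket_dim (A `&` V))%E.

Local Open Scope ereal_scope.

Lemma gasket_const_ge0 : 0 <= (fine (hausdorff gasket_dim V))^-1%:E.
Proof. by rewrite lee_fin invr_ge0 fine_ge0// hausdorff_ge0. Qed.

Lemma gasket_outer0 : gasket_outer set0 = 0.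
Proof. by rewrite /gasket_outer set0I hausdorff0 mule0. Qed.

Lemma gasket_outer_ge0 A : 0 <= gasket_outer A.
Proof. by rewrite mule_ge0 ?gasket_const_ge0 ?hausdorff_ge0. Qed.

Lemma le_gasket_outer : {homo gasket_outer : A B / A `<=` B >-> A <= B}.
Proof.
move=> A B AB; rewrite lee_wpmul2l ?gasket_const_ge0// le_hausdorff//.
exact: setSI.
Qed.

Lemma gasket_outer_sigma_subadditive : sigma_subadditive gasket_outer.
Proof.
move=> A; rewrite /gasket_outer nneseriesZl ?gasket_const_ge0//; last first.
  by move=> i _; exact: hausdorff_ge0.
rewrite lee_wpmul2l ?gasket_const_ge0// setI_bigcupl.
exact: hausdorff_sigma_subadditive.
Qed.

HB.instance Definition _ := isOuterMeasure.Build R 'rV[R]_N.-1 gasket_outer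
  gasket_outer0 gasket_outer_ge0 le_gasket_outer gasket_outer_sigma_subadditive.

(* The sigma-algebra consists of all Caratheodory-measurable sets; the measure
   is therefore complete. *)
Definition gasket_measure :
    {measure set (caratheodory_type gasket_outer) -> \bar R} :=
  caratheodory_measure gasket_outer.

End gasket_measure.

Section dirichlet_problem.
Variables (R : realType) (N : nat) (p : 'I_N -> 'rV[R]_N.-1).
Variables (V : set 'rV[R]_N.-1) (a g : 'rV[R]_N.-1 -> R) (f : R -> R).
Let mu := gasket_measure V.

Definition is_weak_solution (lambda : R) (u : 'rV[R]_N.-1 -> R) : Prop :=
  H01 p V u /\
  forall v, H01 p V v ->
    energy_form p u v - \int[mu]_(x in V) (a x * u x * v x)
      + lambda * \int[mu]_(x in V) (g x * f (u x) * v x) = 0.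

Definition primitive (xi : R) : R :=
  \int[lebesgue_measure]_(t in `[0, xi]) f t.

Definition lambda_star : \bar R :=
  ((- (1 / (2 * (2 * N%:R + 3) ^+ 2 * \int[mu]_(x in V) g x)))%:E *
   ereal_sup [set (gamma ^+ 2 / primitive gamma)%:E |
              gamma in [set gamma : R | (0 < gamma)%R]])%E.

End dirichlet_problem.

(* Main.v *)
(* Direct variational method: on the ball W(u) <= gamma^2 / (2N+3)^2 of H_0^1,
   minimise I(u) = W(u)/2 - (1/2) int a u^2 dmu + lambda int g F(u) dmu, with F
   the primitive of f.  The embedding |u| <= (2N+3) ||u|| keeps |u| <= gamma on
   the ball; since I(u) <= I(0) = 0, a <= 0 and F is monotone,
   W(u) <= 2 lambda F(gamma) |int g dmu| at a minimiser u.  For lambda < lambda*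
   some gamma makes this smaller than gamma^2 / (2N+3)^2, so the minimiser is
   interior, hence a weak solution.  It is non-trivial because I(t w) < 0 for
   small t > 0 and a fixed bump w >= 0, as F(xi) / xi^2 -> +oo.  With gamma = 1
   fixed, W(u_lambda) = O(lambda), so the norms tend to 0.

   The minimum exists by compactness of the ball for uniform convergence and
   lower semicontinuity of W.  Both come from the energy that counts only the
   edges inside cells: it is self-similar and nondecreasing in m.  For N >= 3 the
   energy of the statement also counts the edges that join neighbours of a
   junction point in two different cells; it is compared with the cell energy
   first on harmonic functions and then by self-similarity, which shows that it
   converges to a constant multiple of the cell energy.

   On the measure side, the Hausdorff outer measure is a metric one, so closed
   sets are measurable, and a set of diameter <= 2^-n meets boundedly many cells
   of level n, so every cell has positive measure; this makes int g dmu < 0 and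
   the term int g F(t w) dmu quantitatively negative. *)

From HB Require Import structures.
Require Import Defs.
From mathcomp Require Import all_boot all_order all_algebra.
From mathcomp Require Import all_classical all_reals all_analysis.
From mathcomp Require Import measurable_realfun.
From mathcomp Require Import ring lra zify.

Import Order.TTheory GRing.Theory Num.Theory.
Import numFieldNormedType.Exports.

Set Implicit Arguments.
Unset Strict Implicit.
Unset Printing Implicit Defensive.

Local Open Scope classical_set_scope.
Local Open Scope ring_scope.

(** * Barycentric coordinates and edges *)

(** The edges of the energy are defined by a distance, whereas self-similarity is combinatorial. The
    bridge is integrality: on level [m] the barycentric coordinates times [2 ^ m] are integers, and
    distance is, up to the factor sqrt 2, the Euclidean distance of coordinate vectors, so an edge
    becomes an integer vector with sum 0 and square sum 2. The extra edges found in this way cannot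
    simply be discarded. At one fixed junction their energy tends to 0, but every level creates new
    junctions, and these leave a trace in the limit: the factor [kappa]. Its value comes from
    harmonic functions, on which the two energies of level [m] have one common ratio [x m]; [kappa]
    is the limit of [x]. A general function is replaced by its harmonic interpolation on the cells
    of a fixed level [k]. The error is the cell energy gained above level [k], small for large [k],
    and the extra edges at the finitely many junctions of level at most [k] disappear as [m] grows.
    Since [kappa >= 1], bounds on the cell energy pass to the energy of the statement. *)

Section barycentric.
Variables (R : realType) (N : nat) (p : 'I_N -> 'rV[R]_N.-1).
Hypothesis N_ge2 : (2 <= N)%N.
Hypothesis p_dist : forall i j : 'I_N, i != j -> euclid_dist (p i) (p j) = 1.

Local Notation F := (gasket_map p).

Definition sqdist (x y : 'rV[R]_N.-1) : R :=
  \sum_(i < N.-1) (x ord0 i - y ord0 i) ^+ 2.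

(** The barycentric coordinates of the regular simplex, written with squared distances so that no
    linear system has to be solved. The quadratic parts cancel in the differences, so the function
    is affine, and side length 1 gives the values 0 and 1 at the vertices. *)
Definition bary (k : 'I_N) (x : 'rV[R]_N.-1) : R :=
  N%:R^-1 * (1 + \sum_j (sqdist x (p j) - sqdist x (p k))).

Lemma sqdist_ge0 x y : 0 <= sqdist x y.
Proof. by apply: sumr_ge0 => i _; exact: sqr_ge0. Qed.

Lemma euclid_distE x y : euclid_dist x y = Num.sqrt (sqdist x y).
Proof. by []. Qed.

Lemma natN_gt0 : 0 < N%:R :> R.
Proof. by rewrite ltr0n (leq_trans _ N_ge2). Qed.

Lemma natN_neq0 : N%:R != 0 :> R.
Proof. by rewrite gt_eqF// natN_gt0. Qed.

Lemma sqdist_vertices i j : sqdist (p i) (p j) = (i != j)%:R.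
Proof.
have [->|ij] := eqVneq i j.
  by rewrite /sqdist big1// => k _; rewrite subrr expr0n.
rewrite -[LHS]sqr_sqrtr ?sqdist_ge0// -euclid_distE p_dist// expr1n//.
Qed.

Lemma bary_sum x : \sum_k bary k x = 1.
Proof.
rewrite -mulr_sumr big_split/= sumr_const card_ord.
rewrite [X in _ + X](_ : _ = 0) ?addr0 ?mulVf ?natN_neq0//.
under eq_bigr do rewrite sumrB sumr_const card_ord.
by rewrite sumrB sumr_const card_ord sumrMnl subrr.
Qed.

Lemma baryE k x :
  sqdist x (p k) = N%:R^-1 * (1 + \sum_j sqdist x (p j)) - bary k x.
Proof.
rewrite /bary sumrB sumr_const card_ord -mulr_natr.
by field; exact: natN_neq0.
Qed.

Lemma bary_vertex k i : bary k (p i) = (k == i)%:R.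
Proof.
have := baryE k (p i); rewrite sqdist_vertices.
rewrite (bigD1 i)//= sqdist_vertices eqxx/= add0r.
rewrite (eq_bigr (fun=> 1)); last first.
  by move=> j ji; rewrite sqdist_vertices eq_sym ji.
rewrite sumr_const cardC1 card_ord nat1r prednK ?(leq_trans _ N_ge2)//.
rewrite mulVf ?natN_neq0// => /eqP; rewrite eq_sym subr_eq addrC -subr_eq.
by move=> /eqP <-; rewrite eq_sym; case: eqP => _/=; rewrite ?subr0 ?subrr.
Qed.

(** Apollonius' theorem: [F i x] is the midpoint of [x] and [p i]. The last term is independent of
    [j], which is why it drops out of [bary]. *)
Lemma sqdist_map i j x : sqdist (F i x) (p j) =
  2^-1 * sqdist x (p j) + 2^-1 * sqdist (p i) (p j) - 4^-1 * sqdist x (p i).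
Proof.
rewrite /sqdist !mulr_sumr -big_split/= -sumrB; apply: eq_bigr => k _.
by rewrite !mxE; field.
Qed.

Lemma bary_map k i x : bary k (F i x) = 2^-1 * bary k x + 2^-1 * (k == i)%:R.
Proof.
rewrite -(bary_vertex k i) /bary mulrCA [_ * (N%:R^-1 * _)]mulrCA -mulrDr.
congr (_ * _); rewrite !mulrDr !mulr_sumr addrACA -big_split/=.
congr (_ + _); first by field.
by apply: eq_bigr => j _; rewrite !sqdist_map; field.
Qed.

(** No sign condition: [x] is only required to be recovered from its coordinates. The property is
    carried from the vertices through the maps and then to V by density. *)
Definition hull (x : 'rV[R]_N.-1) := x = \sum_k bary k x *: p k.

Lemma hull_vertex i : hull (p i).
Proof.
rewrite /hull (bigD1 i)//= bary_vertex eqxx scale1r big1 ?addr0// => k ki.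
by rewrite bary_vertex (negPf ki) scale0r.
Qed.

Lemma hull_map i x : hull x -> hull (F i x).
Proof.
move=> hx; rewrite /hull; under eq_bigr do rewrite bary_map scalerDl -!(scalerA 2^-1).
rewrite big_split/= -!scaler_sumr -hx /gasket_map; congr (_ + _ *: _).
rewrite (bigD1 i)//= eqxx scale1r big1 ?addr0// => k ki.
by rewrite (negPf ki) scale0r.
Qed.

Lemma hull_inj x y : hull x -> hull y -> (forall k, bary k x = bary k y) ->
  x = y.
Proof.
by move=> hx hy xy; rewrite hx hy; apply: eq_bigr => k _; rewrite xy.
Qed.

(* The parallel axis identity: the cross terms cancel as [y] is the barycenter
   of the vertices with weights [bary k y]. *)
Lemma sqdist_barycenter x y : hull y ->
  \sum_k bary k y * sqdist x (p k) =
  sqdist x y + \sum_k bary k y * sqdist y (p k).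
Proof.
move=> hy; apply/eqP; rewrite -subr_eq -sumrB; apply/eqP.
under eq_bigr do rewrite -mulrBr /sqdist -sumrB mulr_sumr.
rewrite exchange_big/= /sqdist; apply: eq_bigr => i _.
have hyi : \sum_k bary k y * p k ord0 i = y ord0 i.
  by rewrite [in RHS]hy summxE; apply: eq_bigr => k _; rewrite !mxE.
transitivity (\sum_k (bary k y * (x ord0 i ^+ 2 - y ord0 i ^+ 2)
   - bary k y * p k ord0 i * (2 * (x ord0 i - y ord0 i)))).
  by apply: eq_bigr => k _; ring.
by rewrite sumrB -!mulr_suml bary_sum hyi; ring.
Qed.

(** Add the parallel axis identities for [(x, y)] and [(y, x)]. By [baryE] the distances to the
    vertices become [cx] or [cy] minus coordinates, and [cx], [cy] cancel because the weights sum to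
    1. *)
Lemma sqdist_bary x y : hull x -> hull y ->
  sqdist x y = 2^-1 * \sum_k (bary k x - bary k y) ^+ 2.
Proof.
move=> hx hy.
have sqC : sqdist x y = sqdist y x.
  by apply: eq_bigr => i _; rewrite -sqrrN opprB.
have := sqdist_barycenter x hy; have := sqdist_barycenter y hx.
rewrite -sqC; set cx := N%:R^-1 * (1 + \sum_j sqdist x (p j)).
set cy := N%:R^-1 * (1 + \sum_j sqdist y (p j)).
have e (z w : 'rV_N.-1) : \sum_k bary k z * sqdist w (p k) =
    N%:R^-1 * (1 + \sum_j sqdist w (p j)) - \sum_k bary k z * bary k w.
  under eq_bigr do rewrite baryE mulrBr.
  by rewrite sumrB -mulr_suml bary_sum mul1r.
rewrite !e -/cx -/cy => e1 e2.
rewrite (eq_bigr (fun k => bary k x * bary k x - bary k x * bary k y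
  + (bary k y * bary k y - bary k y * bary k x))); last by move=> k _; ring.
rewrite big_split/= !sumrB; move: e1 e2; lra.
Qed.

Lemma gasket_map_inj i : injective (F i).
Proof.
move=> x y /addIr /(congr1 (fun z => 2 *: z)).
by rewrite !scalerA divff ?pnatr_eq0// !scale1r.
Qed.

Lemma gasket_map_swap i j : F i (p j) = F j (p i).
Proof. by rewrite /gasket_map addrC. Qed.

Lemma gasket_map_fix i : F i (p i) = p i.
Proof.
by rewrite /gasket_map -scalerDl -[X in X *: _](_ : 1 = _) ?scale1r//; field.
Qed.

Lemma sqdist_gasket_map i x y : sqdist (F i x) (F i y) = 4^-1 * sqdist x y.
Proof.
rewrite /sqdist mulr_sumr; apply: eq_bigr => k _.
by rewrite /gasket_map !mxE; field.
Qed.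

Lemma bary_iter k j m x : bary k (iter m (F j) x) =
  2 ^- m * bary k x + (1 - 2 ^- m) * (k == j)%:R.
Proof.
elim: m => [|m IH]; first by rewrite expr0 invr1 mul1r subrr mul0r addr0.
by rewrite iterS bary_map IH exprS invfM; field; rewrite expf_neq0.
Qed.

Lemma hull_iter j m x : hull x -> hull (iter m (F j) x).
Proof. by move=> hx; elim: m => // m IH; rewrite iterS; exact: hull_map. Qed.

End barycentric.

(** Sum 0 and a non-zero square sum force one positive and one negative entry. Their squares already
    exhaust the total 2, so these entries are 1 and -1 and all others vanish. *)
Lemma int_root_of_type_A (I : finType) (d : I -> int) :
  \sum_k d k = 0 -> \sum_k d k ^+ 2 = 2 ->
  exists i j, i != j /\ forall k, d k = (k == i)%:R - (k == j)%:R.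
Proof.
move=> d0 d2.
have pos (e : I -> int) : \sum_k e k = 0 -> \sum_k e k ^+ 2 = 2 ->
    exists i, 0 < e i.
  move=> e0 e2; apply/not_existsP => he.
  have : \sum_k - e k = 0 by rewrite sumrN e0 oppr0.
  have ge0 k : true -> 0 <= - e k by rewrite oppr_ge0 leNgt => _; apply/negP/he.
  move=> /(psumr_eq0P ge0) e00; move: e2; rewrite big1// => k _.
  by have /eqP := e00 k isT; rewrite oppr_eq0 => /eqP ->; rewrite expr0n.
have [i di] := pos d d0 d2.
have [j] : exists j, 0 < - d j.
  apply: pos; first by rewrite sumrN d0 oppr0.
  by under eq_bigr do rewrite sqrrN.
rewrite oppr_gt0 => dj.
have ij : i != j by apply/eqP => eij; move: di dj; rewrite eij; lia.
move: d2; rewrite (bigD1 i)//= (bigD1 j)/=; last by rewrite eq_sym.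
set r := \sum_(_ | _) _ => d2.
have ge0 k : (k != i) && (k != j) -> 0 <= d k ^+ 2 by rewrite sqr_ge0.
have r0 : 0 <= r by exact: sumr_ge0.
have [di1 dj1 rE] : [/\ d i = 1, d j = -1 & r = 0] by split; nia.
have dE := psumr_eq0P ge0 rE.
exists i, j; split => // k; have [->|ki] := eqVneq k i.
  by rewrite di1 (negPf ij) subr0.
have [->|kj] := eqVneq k j; first by rewrite dj1 sub0r.
by rewrite subr0; apply/eqP; rewrite -sqrf_eq0; apply/eqP/dE; rewrite ki kj.
Qed.

Lemma sum_nat_eq_term (I : finType) (z : I -> nat) (a : I) :
  (\sum_k z k = z a)%N -> forall k, k != a -> z k = 0%N.
Proof.
rewrite (bigD1 a)//= => /eqP; rewrite -[X in _ == X]addn0 eqn_add2l sum_nat_eq0.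
by move=> /forallP h k ka; have /implyP/(_ ka)/eqP := h k.
Qed.

Lemma sum_nat_eq_succ_term (I : finType) (z : I -> nat) (a : I) :
  (\sum_k z k = (z a).+1)%N ->
  exists2 c, c != a & forall k, z k = (z a * (k == a) + (k == c))%N.
Proof.
move=> h.
have [c ca zc] : exists2 c, c != a & z c != 0%N.
  apply: contrapT => hc; move: h; rewrite (bigD1 a)//= big1; first by lia.
  move=> k ka; apply: contrapT => /eqP kc; apply: hc; by exists k.
exists c => //; move: h; rewrite (bigD1 a)//= (bigD1 c)//=.
set r := (\sum_(_ | _) _)%N => h.
have [zc1 r0] : z c = 1%N /\ r = 0%N by split; lia.
move: r0 => /eqP; rewrite sum_nat_eq0 => /forallP h0 k.
have [->|ka] := eqVneq k a; first by rewrite eq_sym (negPf ca) muln1 addn0.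
have [->|kc] := eqVneq k c; first by rewrite zc1 muln0.
by have := h0 k; rewrite ka kc => /implyP/(_ isT)/eqP ->; rewrite muln0.
Qed.

Lemma pow4V (R : fieldType) (m : nat) : (4 ^- m : R) = (2 ^- m) ^+ 2.
Proof. by rewrite exprVn -exprM mulnC exprM -(natrX _ 2 2). Qed.

Section edges.
Variables (R : realType) (N : nat) (p : 'I_N -> 'rV[R]_N.-1).
Hypothesis N_ge2 : (2 <= N)%N.
Hypothesis p_dist : forall i j : 'I_N, i != j -> euclid_dist (p i) (p j) = 1.

Local Notation F := (gasket_map p).
Local Notation Vm := (gasket_vertices p).
Local Notation bary := (bary p).
Local Notation hull := (hull p).

Lemma vertices_map i m x : Vm m x -> Vm m.+1 (F i x).
Proof. by move=> mx; exists i => //; exists x. Qed.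

Lemma vertices_mapP m x : Vm m.+1 x -> exists i y, Vm m y /\ x = F i y.
Proof. by move=> [i _ [y my <-]]; exists i, y. Qed.

Lemma vertices_p i m : Vm m (p i).
Proof.
elim: m => [|m IH]; first by exists i.
by rewrite -(gasket_map_fix p i); exact: vertices_map.
Qed.

Lemma vertices_hull m x : Vm m x -> hull x.
Proof.
elim: m x => [x [i _ <-]|m IH x /vertices_mapP[i [y [my ->]]]].
  exact: hull_vertex.
by apply: hull_map => //; exact: IH.
Qed.

Lemma vertices_iter i m n x : Vm m x -> Vm (n + m) (iter n (F i) x).
Proof. by move=> mx; elim: n => // n IH; rewrite iterS addSn; exact: vertices_map. Qed.

Lemma vertices_nat m x : Vm m x -> exists z : 'I_N -> nat,
  (forall k, 2 ^+ m * bary k x = (z k)%:R) /\ (\sum_k z k = 2 ^ m)%N.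
Proof.
elim: m x => [x [i _ <-]|m IH x /vertices_mapP[i [y [my ->]]]].
  exists (fun k => k == i); split; first by move=> k; rewrite mul1r bary_vertex.
  rewrite (bigD1 i)//= eqxx big1// => k ki; by rewrite (negPf ki).
have [z [zE zs]] := IH _ my.
exists (fun k => z k + 2 ^ m * (k == i))%N; split.
  move=> k; rewrite bary_map// natrD natrM natrX -zE exprS.
  by field.
rewrite big_split/= zs -big_distrr/= (bigD1 i)//= eqxx big1 ?addn0 ?muln1.
  by rewrite expnS mul2n addnn.
by move=> k ki; rewrite (negPf ki).
Qed.

Lemma vertices_bary_ge0 m x k : Vm m x -> 0 <= bary k x.
Proof.
move=> /vertices_nat[z [zE _]].
by rewrite -(@pmulr_rge0 _ (2 ^+ m)) ?exprn_gt0// zE.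
Qed.

Lemma hull_eq_vertex x a : hull x -> (forall k, bary k x = (k == a)%:R) ->
  x = p a.
Proof.
move=> hx xE; apply: (hull_inj hx) => [|k]; first exact: hull_vertex.
by rewrite bary_vertex// xE.
Qed.

Lemma euclid_dist_pow2 (m : nat) (x y : 'rV[R]_N.-1) :
  euclid_dist x y = 2 ^- m <-> sqdist x y = 4 ^- m.
Proof.
rewrite euclid_distE pow4V; split => [<-|->]; first by rewrite sqr_sqrtr ?sqdist_ge0.
by rewrite sqrtr_sqr ger0_norm// invr_ge0 exprn_ge0.
Qed.

(* In the scaled barycentric coordinates the vertices of level [m.+1] are
   integral, and points at distance [2 ^- m.+1] differ by a root of type A. *)
Lemma edge_between_cells m a b x y : a != b -> Vm m x -> Vm m y ->
  sqdist (F a x) (F b y) = 4 ^- m.+1 ->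
  [\/ y = p a, x = p b |
    exists c, [/\ c != a, c != b,
      x = iter m (F b) (p c) & y = iter m (F a) (p c)]].
Proof.
move=> ab mx my dxy.
have hx := vertices_hull mx; have hy := vertices_hull my.
have [z [zE zs]] := vertices_nat mx; have [w [wE ws]] := vertices_nat my.
have zle k : (z k <= 2 ^ m)%N by rewrite -zs (bigD1 k)//= leq_addr.
have wle k : (w k <= 2 ^ m)%N by rewrite -ws (bigD1 k)//= leq_addr.
pose X k := (z k + 2 ^ m * (k == a))%N; pose Y k := (w k + 2 ^ m * (k == b))%N.
have m0 : (2 : R) ^+ m != 0 by rewrite expf_neq0.
have XY k : bary k (F a x) - bary k (F b y) =
    2 ^- m.+1 * ((X k)%:R - (Y k)%:R).
  rewrite !bary_map// /X /Y !natrD !natrM natrX -zE -wE exprS.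
  by field.
have m0' : (2 : R) ^+ m.+1 != 0 by rewrite expf_neq0.
have yP : w a = (2 ^ m)%N -> y = p a.
  move=> wa; apply: hull_eq_vertex => // k; apply: (mulfI m0); rewrite wE.
  have [->|ka] := eqVneq k a; first by rewrite wa natrX mulr1.
  by rewrite mulr0 (@sum_nat_eq_term _ w a)// ws wa.
have xP : z b = (2 ^ m)%N -> x = p b.
  move=> zb; apply: hull_eq_vertex => // k; apply: (mulfI m0); rewrite zE.
  have [->|ka] := eqVneq k b; first by rewrite zb natrX mulr1.
  by rewrite mulr0 (@sum_nat_eq_term _ z b)// zs zb.
have [i [j [ij dE]]] : exists i j, i != j /\
    forall k, (X k)%:Z - (Y k)%:Z = (k == i)%:R - (k == j)%:R.
  apply: int_root_of_type_A.
    rewrite sumrB -!(big_morph Posz PoszD (erefl _)) /X /Y !big_split/= -!big_distrr/= zs ws.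
    rewrite (bigD1 a)//= eqxx big1; last by move=> k /negPf ->.
    rewrite [in X in _ - X](bigD1 b)//= eqxx big1; last by move=> k /negPf ->.
    by rewrite subrr.
  apply: (@intr_inj R); rewrite rmorph_sum/=.
  move: dxy; rewrite (@sqdist_bary _ _ p)//; [|exact: hull_map..]. move=> dxy.
  have h : 2^-1 * \sum_k ((X k)%:R - (Y k)%:R) ^+ 2 = 1 :> R.
    apply: (mulfI (expf_neq0 2 (invr_neq0 m0'))); rewrite mulr1 -[RHS]pow4V -[RHS]dxy mulrCA.
    by congr (_ * _); rewrite mulr_sumr; apply: eq_bigr => k _; rewrite XY exprMn.
  transitivity (\sum_k ((X k)%:R - (Y k)%:R) ^+ 2 : R).
    by apply: eq_bigr => k _; rewrite rmorphXn rmorphB/= !pmulrn.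
  by move: h; lra.
have Xa : (X a = z a + 2 ^ m)%N by rewrite /X eqxx muln1.
have Ya : Y a = w a by rewrite /Y (negPf ab) muln0 addn0.
have Yb : (Y b = w b + 2 ^ m)%N by rewrite /Y eqxx muln1.
have Xb : X b = z b by rewrite /X eq_sym (negPf ab) muln0 addn0.
(* In the first two alternatives one endpoint is the junction point of the cells [a] and [b]. *)
have [wa|wa] := eqVneq (w a) (2 ^ m)%N; first by apply: Or31; exact: yP.
have [zb|zb] := eqVneq (z b) (2 ^ m)%N; first by apply: Or32; exact: xP.
have ? := wle a; have ? := zle b.
(* Otherwise the difference is positive at [a] and negative at [b], which identifies the two indices
   of the root. *)
have {i j ij dE} dE k : (X k)%:Z - (Y k)%:Z = (k == a)%:R - (k == b)%:R.
  have := dE a; have := dE b; rewrite Xa Ya Xb Yb.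
  have [ia|ia] := eqVneq i a; have [jb|jb] := eqVneq j b.
  - by rewrite dE ia jb.
  - by rewrite ia (eq_sym b a) (negPf ab)/=; lia.
  - by rewrite jb (negPf ab)/=; lia.
  - by move=> /=; lia.
have := dE a; have := dE b; rewrite Xa Ya Xb Yb !eqxx (negPf ab) eq_sym (negPf ab)/=.
move=> db da.
have za : z a = 0%N by lia.
have wb : w b = 0%N by lia.
have zw k : k != a -> k != b -> z k = w k.
  move=> /negPf ka /negPf kb; have := dE k; rewrite /X /Y ka kb !muln0 !addn0/=; lia.
(* [w] has total [2 ^ m] and entry [2 ^ m - 1] at [a]; the one remaining unit selects the direction
   [c]. *)
have [c ca cE] : exists2 c, c != a & forall k, w k = (w a * (k == a) + (k == c))%N.
  by apply: sum_nat_eq_succ_term; rewrite ws; lia.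
have cb : c != b.
  by apply/eqP => cb; have := cE b; rewrite wb -cb eqxx; lia.
have wa' : (w a)%:R = 2 ^+ m - 1 :> R.
  by rewrite -natrX (_ : 2 ^ m = w a + 1)%N ?natrD ?addrK//; lia.
apply: Or33; exists c; split => //.
- apply: (hull_inj hx) => [|k]; first exact/hull_iter/hull_vertex.
  apply: (mulfI m0); rewrite zE bary_iter// bary_vertex//.
  have -> : (z k)%:R = (2 ^+ m - 1) * (k == b)%:R + (k == c)%:R :> R.
    have [->|ka] := eqVneq k a.
      by rewrite za (negPf ab) eq_sym (negPf ca) mulr0 addr0.
    have [->|kb] := eqVneq k b.
      by rewrite mulr1 eq_sym (negPf cb) addr0 -wa'; congr (_%:R); lia.
    by rewrite zw// cE (negPf ka) muln0 mulr0 add0r.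
  by field.
- apply: (hull_inj hy) => [|k]; first exact/hull_iter/hull_vertex.
  apply: (mulfI m0); rewrite wE bary_iter// bary_vertex// cE natrD natrM wa'.
  by field.
Qed.

End edges.

(** * Recursive enumeration of the edges *)

Section edge_lists.
Variables (R : realType) (N : nat) (p : 'I_N -> 'rV[R]_N.-1).
Hypothesis N_ge2 : (2 <= N)%N.
Hypothesis p_dist : forall i j : 'I_N, i != j -> euclid_dist (p i) (p j) = 1.

Local Notation F := (gasket_map p).
Local Notation Vm := (gasket_vertices p).
Local Notation bary := (bary p).
Local Notation point := 'rV[R]_N.-1.

Definition map_edge (i : 'I_N) (z : point * point) := (F i z.1, F i z.2).

Definition distinct3 (t : 'I_N * 'I_N * 'I_N) :=
  [&& t.1.1 != t.1.2, t.2 != t.1.1 & t.2 != t.1.2].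

(* For [t = (a, b, c)], the neighbours in direction [c] of the junction point
   of the cells [a] and [b], one in each cell. *)
Definition extra_edge m (t : 'I_N * 'I_N * 'I_N) : point * point :=
  (F t.1.1 (iter m (F t.1.2) (p t.2)), F t.1.2 (iter m (F t.1.1) (p t.2))).

(** Level 1 receives no extra edges: by [gasket_map_swap], [F a (p c)] and [F b (p c)] are
    [F c (p a)] and [F c (p b)], an edge already listed in the cell [c]. *)
Fixpoint edges m : seq (point * point) :=
  if m is m'.+1 then
    [seq map_edge i z | i <- enum 'I_N, z <- edges m'] ++
    if m' is 0 then [::] else [seq extra_edge m' t | t <- enum distinct3]
  else [seq (p t.1, p t.2) | t <- enum [pred t : 'I_N * 'I_N | t.1 != t.2]].

Definition edge_set m := [set z : point * point |
  [/\ Vm m z.1, Vm m z.2 & euclid_dist z.1 z.2 = 2 ^- m]].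

Lemma bary_extra_edge m t k :
  bary k (extra_edge m t).1 = 2 ^- m.+1 * (k == t.2)%:R
    + 2^-1 * ((1 - 2 ^- m) * (k == t.1.2)%:R + (k == t.1.1)%:R) /\
  bary k (extra_edge m t).2 = 2 ^- m.+1 * (k == t.2)%:R
    + 2^-1 * ((1 - 2 ^- m) * (k == t.1.1)%:R + (k == t.1.2)%:R).
Proof.
rewrite /extra_edge /= !bary_map// !bary_iter// !bary_vertex// exprS invfM.
by split; ring.
Qed.

Lemma vertices_extra_edge m t :
  Vm m.+1 (extra_edge m t).1 /\ Vm m.+1 (extra_edge m t).2.
Proof.
by split; apply: vertices_map; rewrite -[X in Vm X]addn0; apply: vertices_iter;
  exact: vertices_p.
Qed.

Lemma sqdist_extra_edge m t : distinct3 t ->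
  sqdist (extra_edge m t).1 (extra_edge m t).2 = 4 ^- m.+1.
Proof.
move=> /and3P[ab ca cb]; have [v1 v2] := vertices_extra_edge m t.
rewrite (@sqdist_bary _ _ p)//; [|exact: vertices_hull v1|exact: vertices_hull v2].
rewrite (eq_bigr (fun k => (2 ^- m.+1) ^+ 2 * ((k == t.1.1)%:R + (k == t.1.2)%:R))).
  rewrite -mulr_sumr big_split/= (bigD1 t.1.1)//= eqxx big1; last by move=> k /negPf ->.
  rewrite (bigD1 t.1.2)//= eqxx big1; last by move=> k /negPf ->.
  by rewrite !addr0 pow4V; field; rewrite expf_neq0.
move=> k _; have [-> ->] := bary_extra_edge m t k.
have [->|ka] := eqVneq k t.1.1.
  by rewrite (negPf ab) /= [2 ^+ m.+1]exprS invfM; ring.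
by case: (k == t.1.2); rewrite /= [2 ^+ m.+1]exprS invfM; ring.
Qed.

Lemma sqdistxx (x : point) : sqdist x x = 0.
Proof. by apply: big1 => k _; rewrite subrr expr0n. Qed.

Lemma bary_cell_ge i m x : Vm m x -> 2^-1 <= bary i (F i x).
Proof.
move=> mx; have := vertices_bary_ge0 N_ge2 p_dist i mx.
by rewrite bary_map// eqxx /= => ?; lra.
Qed.

Lemma bary_two_halves (x : point) i j : i != j -> (forall k, 0 <= bary k x) ->
  2^-1 <= bary i x -> 2^-1 <= bary j x ->
  forall k, bary k x = 2^-1 * (k == i)%:R + 2^-1 * (k == j)%:R.
Proof.
move=> ij x0 xi xj.
have := bary_sum p N_ge2 x; rewrite (bigD1 i)//= (bigD1 j) ?(eq_sym j)//=.
have ge0 k : (k != i) && (k != j) -> 0 <= bary k x by [].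
set r := \sum_(_ | _) _ => s1; have r0 : 0 <= r by exact: sumr_ge0.
have rE : r = 0 by lra.
have h0 := psumr_eq0P ge0 rE => k.
have [->|ki] := eqVneq k i; first by rewrite (negPf ij) => /=; lra.
have [->|kj] := eqVneq k j; first by move=> /=; lra.
by rewrite h0 ?ki ?kj// => /=; lra.
Qed.

(** Both endpoints in the cell [i] would have coordinate [i] at least 1/2. For [m > 0] the first
    endpoint reaches 1/2 only at [t.1.1] and the second only at [t.1.2]. *)
Lemma extra_edge_not_common m t i z : (0 < m)%N -> distinct3 t ->
  Vm m z.1 -> Vm m z.2 -> extra_edge m t <> map_edge i z.
Proof.
move=> m0 /and3P[ab ca cb] v1 v2 e.
have ac : t.1.1 == t.2 = false by rewrite eq_sym (negPf ca).
have bc : t.1.2 == t.2 = false by rewrite eq_sym (negPf cb).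
have ba : t.1.2 == t.1.1 = false by rewrite eq_sym (negPf ab).
have := bary_cell_ge i v1; have := bary_cell_ge i v2.
have -> : F i z.1 = (extra_edge m t).1 by rewrite e.
have -> : F i z.2 = (extra_edge m t).2 by rewrite e.
have [-> ->] := bary_extra_edge m t i.
have m2 : 2 ^- m <= 2^-1 :> R.
  by rewrite lef_pV2 ?posrE ?exprn_gt0// -[leLHS]expr1 ler_eXn2l// ltr1n.
have m1 : 0 < 2 ^- m :> R by rewrite invr_gt0 exprn_gt0.
rewrite exprS invfM.
have [->|ia] := eqVneq i t.1.1; first by rewrite (negPf ab) ac /=; lra.
have [->|ib] := eqVneq i t.1.2; first by rewrite bc ?ba /=; lra.
by case: (i == t.2) => /=; lra.
Qed.

Lemma extra_edge_inj m : (0 < m)%N -> {in distinct3 &, injective (extra_edge m)}.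
Proof.
move=> m0 t t' dt dt' e.
have m2 : 2 ^- m <= 2^-1 :> R.
  by rewrite lef_pV2 ?posrE ?exprn_gt0// -[leLHS]expr1 ler_eXn2l// ltr1n.
have m1 : 0 < 2 ^- m :> R by rewrite invr_gt0 exprn_gt0.
have b1 k := etrans (congr1 (fun z => bary k z.1) e) (bary_extra_edge m t' k).1.
have b2 k := etrans (congr1 (fun z => bary k z.2) e) (bary_extra_edge m t' k).2.
have {}b1 k := etrans (esym (bary_extra_edge m t k).1) (b1 k).
have {}b2 k := etrans (esym (bary_extra_edge m t k).2) (b2 k).
move: t t' dt dt' b1 b2 {e} => [[a b] c] [[a' b'] c'].
rewrite !unfold_in /= => /and3P[ab ca cb] /and3P[ab' ca' cb'] b1 b2.
have ac : a == c = false by rewrite eq_sym (negPf ca).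
have bc : b == c = false by rewrite eq_sym (negPf cb).
have ba : b == a = false by rewrite eq_sym (negPf ab).
have bc' : b' == c' = false by rewrite eq_sym (negPf cb').
have aa : a = a'.
  apply/eqP; apply: contraT => aa.
  have := b1 a; rewrite eqxx (negPf ab) ac (negPf aa) exprS invfM.
  have [ab''|_] := eqVneq a b'; first by rewrite ab'' bc' /=; lra.
  by case: (_ == c') => /=; lra.
have bb : b = b'.
  apply/eqP; apply: contraT => bb.
  have := b2 b; rewrite eqxx ba bc (negPf bb) -aa ba exprS invfM.
  by case: (_ == c') => /=; lra.
congr (_, _, _) => //; apply/eqP; apply: contraT => cc.
have := b1 c; rewrite eqxx (negPf cc) -aa (negPf ca) -bb (negPf cb) exprS invfM /=.
lra.
Qed.

(** A common vertex of the cells [i] and [j] has both these coordinates equal to 1/2, so it is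
    unique; two different cells cannot share both ends of an edge. *)
Lemma map_edge_inj i j (z w : point * point) m : edge_set m z -> edge_set m w ->
  map_edge i z = map_edge j w -> i = j /\ z = w.
Proof.
move=> [z1 z2 dz] [w1 w2 _] e.
have ij : i = j; last first.
  split => //; move: e; rewrite ij => -[/gasket_map_inj e1 /gasket_map_inj e2].
  by rewrite [z]surjective_pairing [w]surjective_pairing e1 e2.
apply/eqP; apply: contraT => ij; case: e => e1 e2.
have b (x y : point) : Vm m x -> Vm m y -> F i x = F j y ->
    forall k, bary k (F i x) = 2^-1 * (k == i)%:R + 2^-1 * (k == j)%:R.
  move=> mx my xy; apply: bary_two_halves => //.
  - by move=> k; apply: (@vertices_bary_ge0 _ _ p _ _ m.+1) => //; exact: vertices_map.
  - exact: bary_cell_ge mx.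
  - by rewrite xy; exact: bary_cell_ge my.
have : F i z.1 = F i z.2.
  apply: (@hull_inj _ _ p).
  - exact: vertices_hull (vertices_map _ z1).
  - exact: vertices_hull (vertices_map _ z2).
  - by move=> k; rewrite (b _ _ z1 w1 e1) (b _ _ z2 w2 e2).
move=> /gasket_map_inj z12; move: dz.
rewrite euclid_distE z12 sqdistxx sqrtr0 => /esym/eqP.
by rewrite invr_eq0 expf_eq0 pnatr_eq0 andbF.
Qed.

Lemma edge_setS m z : edge_set m.+1 z <->
  (exists i w, edge_set m w /\ z = map_edge i w) \/
  ((0 < m)%N /\ exists2 t, distinct3 t & z = extra_edge m t).
Proof.
split.
  move=> [/vertices_mapP[a [x [mx zx]]] /vertices_mapP[b [y [my zy]]]].
  rewrite euclid_dist_pow2 => dz.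
  have zE i (x' y' : point) : Vm m x' -> Vm m y' -> z.1 = F i x' -> z.2 = F i y' ->
      exists i w, edge_set m w /\ z = map_edge i w.
    move=> mx' my' z1 z2; exists i, (x', y'); split; last first.
      by rewrite [z]surjective_pairing z1 z2.
    split => //=; apply/euclid_dist_pow2; move: dz.
    by rewrite z1 z2 sqdist_gasket_map exprS invfM => /mulfI; apply; rewrite invr_neq0.
  have [ab|ab] := eqVneq a b.
    by left; apply: zE mx my zx _; rewrite zy ab.
  move: (dz); rewrite zx zy => /(edge_between_cells N_ge2 p_dist ab mx my) [ya|xb|].
  - left; apply: (zE a x (p b)) => //; first exact: vertices_p.
    by rewrite zy ya gasket_map_swap.
  - left; apply: (zE b (p a) y) => //; first exact: vertices_p.
    by rewrite zx xb gasket_map_swap.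
  - move=> [c [ca cb xE yE]]; have [m0|m0] := posnP m.
      left; subst m; apply: (zE c (p a) (p b)); try exact: vertices_p.
        by rewrite zx xE gasket_map_swap.
      by rewrite zy yE gasket_map_swap.
    right; split => //; exists (a, b, c); first by rewrite /distinct3 /= ab ca cb.
    by rewrite /extra_edge /= -xE -yE [z]surjective_pairing zx zy.
move=> [[i [w [[w1 w2 dw] ->]]]|[m0 [t dt ->]]].
  split; try exact: vertices_map.
  move/euclid_dist_pow2: dw => dw; apply/euclid_dist_pow2.
  by rewrite sqdist_gasket_map dw exprS invfM.
have [v1 v2] := vertices_extra_edge m t.
by split => //; apply/euclid_dist_pow2; exact: sqdist_extra_edge.
Qed.

Lemma mem_edges m z : z \in edges m <-> edge_set m z.
Proof.
elim: m z => [z|m IH z].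
  split => [/mapP[t]|[[i _ iz] [j _ jz] d1]].
    rewrite mem_enum !inE => ij ->; split => /=; [by exists t.1|by exists t.2|].
    by rewrite expr0 invr1 p_dist.
  apply/mapP; exists (i, j); last by rewrite /= iz jz -surjective_pairing.
  rewrite mem_enum !inE/=; apply/eqP => ij; move: d1.
  rewrite -iz -jz ij euclid_distE sqdistxx sqrtr0 expr0 invr1 => /eqP.
  by rewrite eq_sym oner_eq0.
rewrite edge_setS /= mem_cat; split.
  move=> /orP[/allpairsP[[i w]/= [_ /IH ew ->]]|]; first by left; exists i, w.
  case: m {IH} => // m /mapP[t]; rewrite mem_enum => dt ->; right; split => //.
  by exists t.
move=> [[i [w [/IH ew ->]]]|[m0 [t dt ->]]].
  apply/orP; left; apply/allpairsP; exists (i, w); split => //.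
  by rewrite mem_enum.
apply/orP; right; case: m m0 {IH} => // m _; apply/mapP; exists t => //.
by rewrite mem_enum.
Qed.

Lemma uniq_edges m : uniq (edges m).
Proof.
elim: m => [|m IH].
  rewrite map_inj_in_uniq ?enum_uniq// => -[i j] [i' j'] _ _ /= [ii jj].
  have pinj : injective p.
    move=> k l kl; apply/eqP; apply: contraT => /p_dist.
    by rewrite kl euclid_distE sqdistxx sqrtr0 => /esym/eqP; rewrite oner_eq0.
  by rewrite (pinj _ _ ii) (pinj _ _ jj).
rewrite /= cat_uniq; apply/and3P; split.
- apply: allpairs_uniq => //; first exact: enum_uniq.
  move=> [i z] [j w] /allpairsP[[i' z']/= [_ zz [-> ->]]].
  move=> /allpairsP[[j' w']/= [_ ww [-> ->]]]/=.
  by move/mem_edges: zz => zz; move/mem_edges: ww => ww /(map_edge_inj zz ww)[-> ->].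
- case: m {IH} => // m; apply/hasPn => z /mapP[t]; rewrite mem_enum => dt ->.
  apply/negP => /allpairsP[[i w]/= [_ ew]].
  by have [w1 w2 _] := (mem_edges m.+1 w).1 ew; exact: extra_edge_not_common.
- case: m {IH} => // m; rewrite map_inj_in_uniq ?enum_uniq// => t t'.
  by rewrite !mem_enum; exact: extra_edge_inj.
Qed.

Definition edge_form (s : seq (point * point)) (u v : point -> R) : R :=
  \sum_(z <- s) (u z.1 - u z.2) * (v z.1 - v z.2).

Lemma energy_preE m u v : energy_pre p m u v =
  ((N%:R + 2) / N%:R) ^+ m * edge_form (edges m) u v.
Proof.
rewrite /energy_pre /edge_form (fsbig_seq _ _ (uniq_edges m)).
rewrite (_ : [set` edges m] = edge_set m)//.
by apply/seteqP; split => z /mem_edges.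
Qed.

End edge_lists.

(** * Cell energies and convergence of the energy *)

Section vertex_energy.
Variables (R : realType) (N : nat).
Hypothesis N_ge2 : (2 <= N)%N.
Implicit Types b c z : 'I_N -> R.

Let n0 : N%:R != 0 :> R := natN_neq0 R N_ge2.
Let n_gt0 : 0 < N%:R :> R := natN_gt0 R N_ge2.
Let n2 : N%:R + 2 != 0 :> R.
Proof. by rewrite gt_eqF// addr_gt0. Qed.

Definition renorm : R := (N%:R + 2) / N%:R.

Lemma renorm_gt0 : 0 < renorm.
Proof. by rewrite divr_gt0// addr_gt0. Qed.

Definition vertex_energy b c : R := \sum_i \sum_j (b i - b j) * (c i - c j).

(* Boundary values on the cell [i] of the harmonic extension of [b]; the junction
   point of two cells gets the weights 2/(N+2), 2/(N+2), 1/(N+2), ..., 1/(N+2). *)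
Definition harmonic_step (i : 'I_N) b : 'I_N -> R := fun j =>
  if j == i then b i else (b i + b j + \sum_k b k) / (N%:R + 2).

Lemma sum_harmonic_step i b : \sum_j harmonic_step i b j =
  (2 * N%:R * b i + N%:R * \sum_k b k) / (N%:R + 2).
Proof.
rewrite /harmonic_step; set beta := \sum_l b l.
rewrite (eq_bigr (fun l => (b i + b l + beta) / (N%:R + 2)
  + (l == i)%:R * (b i - (b i + b i + beta) / (N%:R + 2)))); last first.
  by move=> l _; case: eqP => [->|_] /=; ring.
rewrite big_split/= -!mulr_suml !big_split/= !sumr_const card_ord -/beta.
rewrite (bigD1 i)//= eqxx big1 ?addr0; last by move=> l /negPf ->.
by rewrite -(mulr_natl (b i)) -(mulr_natl beta) /=; field; exact: n2.
Qed.

Lemma vertex_energyE b c : vertex_energy b c =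
  2 * (N%:R * \sum_i b i * c i - (\sum_i b i) * (\sum_i c i)).
Proof.
rewrite /vertex_energy.
have -> : \sum_i \sum_j (b i - b j) * (c i - c j) =
    \sum_i (b i * c i * N%:R - b i * (\sum_j c j) - c i * (\sum_j b j)
      + \sum_j b j * c j).
  apply: eq_bigr => i _.
  under eq_bigr do rewrite mulrBl !mulrBr opprB addrA.
  rewrite !(big_split, sumrN)/= sumr_const card_ord -!mulr_sumr -!mulr_suml.
  by rewrite -mulr_natr; ring.
rewrite !(big_split, sumrN)/= -!mulr_suml sumr_const card_ord -mulr_natr.
by ring.
Qed.

Lemma vertex_energyC b c : vertex_energy b c = vertex_energy c b.
Proof. by apply: eq_bigr => i _; apply: eq_bigr => j _; rewrite mulrC. Qed.

Lemma vertex_energy_ge0 b : 0 <= vertex_energy b b.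
Proof. by apply: sumr_ge0 => i _; apply: sumr_ge0 => j _; rewrite -expr2 sqr_ge0. Qed.

Lemma vertex_energy_ge_edge b i j :
  2 * (b i - b j) ^+ 2 <= vertex_energy b b.
Proof.
have [->|ij] := eqVneq i j.
  by rewrite subrr expr0n mulr0 vertex_energy_ge0.
have ge0 k l : 0 <= (b k - b l) * (b k - b l) by rewrite -expr2 sqr_ge0.
have row k l : (b k - b l) * (b k - b l) <= \sum_l (b k - b l) * (b k - b l).
  by rewrite (bigD1 l)//= lerDl sumr_ge0.
have hS : \sum_l (b j - b l) * (b j - b l) <=
    \sum_(k | k != i) \sum_l (b k - b l) * (b k - b l).
  rewrite [leRHS](bigD1 j) ?(eq_sym j)//= lerDl.
  by apply: sumr_ge0 => k _; exact: sumr_ge0.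
rewrite /vertex_energy [leRHS](bigD1 i)//=.
have := row i j; have := row j i; have := hS.
set S := \sum_(_ | _) _; set T := \sum_l _; set U := \sum_l _.
by rewrite expr2; lra.
Qed.

Lemma vertex_energy_harmonic_step i b c : vertex_energy (harmonic_step i b) c =
  2 * N%:R / (N%:R + 2) *
  (\sum_j (b j - b i) * c j - (\sum_k b k - N%:R * b i) * c i).
Proof.
pose beta := \sum_k b k; pose D := beta - N%:R * b i.
have hE j : harmonic_step i b j =
    b i + (b j - b i + D) / (N%:R + 2) - (j == i)%:R * (D / (N%:R + 2)).
  rewrite /harmonic_step -/beta /D; case: eqP => [->|_] /=; field; exact: n2.
rewrite vertex_energyE.
rewrite sum_harmonic_step -/beta.
have -> : \sum_j harmonic_step i b j * c j =
    (b i + (D - b i) / (N%:R + 2)) * (\sum_j c j)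
    + (\sum_j b j * c j) / (N%:R + 2) - D / (N%:R + 2) * c i.
  rewrite (eq_bigr (fun j => (b i + (D - b i) / (N%:R + 2)) * c j
    + b j * c j / (N%:R + 2) - D / (N%:R + 2) * ((j == i)%:R * c j))); last first.
    by move=> j _; rewrite hE; field; exact: n2.
  rewrite !(big_split, sumrN)/= -!mulr_suml -!mulr_sumr; congr (_ - _ * _).
  by rewrite (bigD1 i)//= eqxx mul1r big1 ?addr0// => k /negPf ->; rewrite mul0r.
have -> : \sum_j (b j - b i) * c j = \sum_j b j * c j - b i * \sum_j c j.
  by rewrite mulr_sumr -sumrB; apply: eq_bigr => j _; rewrite mulrBl.
by rewrite -/beta /D; field; exact: n2.
Qed.

(* The harmonic extension is orthogonal to the functions that vanish on the
   vertices; here [y i j] is the value at the junction of the cells [i], [j]. *)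
Lemma harmonic_step_orthogonal b (y : 'I_N -> 'I_N -> R) :
  (forall i j, y i j = y j i) ->
  renorm * \sum_i vertex_energy (harmonic_step i b) (y i) =
  vertex_energy b (fun i => y i i).
Proof.
move=> ysym.
under eq_bigr do rewrite vertex_energy_harmonic_step.
rewrite -mulr_sumr sumrB.
have -> : \sum_i \sum_j (b j - b i) * y i j = 0.
  have h : \sum_i \sum_j (b j - b i) * y i j = - \sum_i \sum_j (b j - b i) * y i j.
    rewrite [LHS]exchange_big/= -sumrN; apply: eq_bigr => i _.
    by rewrite -sumrN; apply: eq_bigr => j _; rewrite ysym -mulNr opprB.
  by move: h; lra.
rewrite vertex_energyE.
have -> : \sum_i (\sum_k b k - N%:R * b i) * y i i =
    (\sum_k b k) * (\sum_i y i i) - N%:R * \sum_i b i * y i i.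
  by rewrite mulr_sumr mulr_sumr -sumrB; apply: eq_bigr => i _; ring.
by rewrite /renorm; field; rewrite n0 n2.
Qed.

(** With [d j = b j - b i] and [D] their sum, the claim reduces to
    [D ^+ 2 <= (N - 1) * \sum_j d j ^+ 2], which is Cauchy-Schwarz over the [N - 1] indices other
    than [i], as [d i = 0]. It says that renormalised harmonic energy decays geometrically along a
    corner. *)
Lemma harmonic_step_contraction i b :
  renorm * vertex_energy (harmonic_step i b) (harmonic_step i b) <=
  N%:R / (N%:R + 2) * vertex_energy b b.
Proof.
pose d j := b j - b i; pose D := \sum_j d j.
have DE : \sum_k b k - N%:R * b i = D.
  by rewrite /D sumrB sumr_const card_ord mulr_natl.
rewrite vertex_energy_harmonic_step DE.
have hE j : harmonic_step i b j =
    b i + (d j + D) / (N%:R + 2) - (j == i)%:R * (D / (N%:R + 2)).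
  rewrite /harmonic_step /d -DE; case: eqP => [->|_] /=; field; exact: n2.
have -> : \sum_j (b j - b i) * harmonic_step i b j =
    D * b i + (\sum_j d j ^+ 2 + D ^+ 2) / (N%:R + 2).
  rewrite (eq_bigr (fun j => d j * (b i + D / (N%:R + 2)) + d j ^+ 2 / (N%:R + 2))).
    by rewrite big_split/= -!mulr_suml -/D; field; exact: n2.
  move=> j _; rewrite hE /d; case: eqP => [->|_] /=; field; exact: n2.
have -> : harmonic_step i b i = b i by rewrite /harmonic_step eqxx.
have -> : vertex_energy b b = 2 * (N%:R * (\sum_j d j ^+ 2) - D ^+ 2).
  transitivity (vertex_energy d d).
    apply: eq_bigr => k _; apply: eq_bigr => l _; rewrite /d; ring.
  by rewrite vertex_energyE -/D expr2.
have cs : D ^+ 2 <= (N%:R - 1) * \sum_j d j ^+ 2.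
  have di : d i = 0 by rewrite /d subrr.
  have N1 : 1 <= N%:R - 1 :> R.
    by rewrite lerBrDr (_ : 1 + 1 = 2%:R) ?ler_nat//; ring.
  have DD : D = \sum_(j | j != i) d j by rewrite /D (bigD1 i)//= di add0r.
  have dd : \sum_j d j ^+ 2 = \sum_(j | j != i) d j ^+ 2.
    by rewrite (bigD1 i)//= di expr0n add0r.
  have : 0 <= \sum_(j | j != i) ((N%:R - 1) * d j - D) ^+ 2.
    by apply: sumr_ge0 => j _; exact: sqr_ge0.
  rewrite (eq_bigr (fun j => (N%:R - 1) ^+ 2 * d j ^+ 2
    - (2 * (N%:R - 1) * D) * d j + D ^+ 2)); last by move=> j _; ring.
  rewrite !(big_split, sumrN)/= -!mulr_sumr -DD -dd sumr_const cardC1 card_ord.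
  rewrite -(mulr_natl D) (_ : N.-1%:R = N%:R - 1); last first.
    by rewrite -[in RHS](@prednK N) ?(leq_trans _ N_ge2)// -natr1 addrK.
  move: N1; set M := N%:R - 1; set Q := \sum_j _ => N1 h.
  rewrite -subr_ge0 -(pmulr_rge0 _ (lt_le_trans ltr01 N1)).
  by move: h; congr (_ <= _); ring.
rewrite -subr_ge0.
set Q := \sum_j _ in cs *.
have -> : N%:R / (N%:R + 2) * (2 * (N%:R * Q - D ^+ 2)) - renorm *
    (2 * N%:R / (N%:R + 2) * (D * b i + (Q + D ^+ 2) / (N%:R + 2) - D * b i)) =
    2 * (N%:R + 1) / (N%:R + 2) * ((N%:R - 1) * Q - D ^+ 2).
  by rewrite /renorm; field; rewrite n0 n2.
rewrite mulr_ge0 ?subr_ge0// mulr_ge0 ?invr_ge0 ?mulr_ge0 ?addr_ge0 ?ltW//.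
Qed.

(** What matters is that [A] and [B] depend on [m] alone; by symmetry only [b i], [b c] and the
    total can enter. *)
Lemma harmonic_step_iter m : exists A B : R, forall (i : 'I_N) b (c : 'I_N), c != i ->
  iter m (harmonic_step i) b c =
  b i + A * (b c - b i) + B * (\sum_k b k - N%:R * b i).
Proof.
elim: m => [|m [A [B IH]]].
  by exists 1, 0 => i b c ci /=; ring.
exists (A / (N%:R + 2)), ((A + N%:R * B) / (N%:R + 2)) => i b c ci.
rewrite iterSr IH// sum_harmonic_step /harmonic_step eqxx (negPf ci).
by field; exact: n2.
Qed.

(** The jump of a harmonic function across an extra edge. The junction value, [b c] and the total
    enter both sides symmetrically and cancel, which leaves a multiple of [b i - b j]. *)
Lemma harmonic_step_extra m : exists K : R, forall (i j c : 'I_N) b,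
  i != j -> c != i -> c != j ->
  iter m (harmonic_step j) (harmonic_step i b) c -
  iter m (harmonic_step i) (harmonic_step j b) c = K * (b i - b j).
Proof.
have [A [B AB]] := harmonic_step_iter m.
exists ((A + 2 * N%:R * B) / (N%:R + 2)) => i j c b ij ci cj.
rewrite !AB//.
rewrite !sum_harmonic_step /harmonic_step (negPf ci) (negPf cj) (negPf ij) eq_sym (negPf ij).
by field; exact: n2.
Qed.

End vertex_energy.

Lemma cvg_finite_sum (R : realType) (I : finType) (z : I -> nat -> R) (l : I -> R) :
  (forall i, z i m @[m --> \oo] --> l i) ->
  (\sum_i z i m) @[m --> \oo] --> \sum_i l i.
Proof.
move=> zl; elim: (index_enum I) => [|i r IH].
  by rewrite big_nil; under eq_fun do rewrite big_nil; exact: cvg_cst.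
rewrite big_cons; under eq_fun do rewrite big_cons.
exact: cvgD.
Qed.

Lemma cvg_finite_sum0 (R : realType) (I : finType) (z : I -> nat -> R) :
  (forall i, z i m @[m --> \oo] --> 0) -> \sum_i z i m @[m --> \oo] --> 0.
Proof. by move=> z0; have := cvg_finite_sum (l := fun=> 0) z0; rewrite big1. Qed.

Section cell_energy.
Variables (R : realType) (N : nat) (p : 'I_N -> 'rV[R]_N.-1).
Hypothesis N_ge2 : (2 <= N)%N.
Hypothesis p_dist : forall i j : 'I_N, i != j -> euclid_dist (p i) (p j) = 1.

Local Notation F := (gasket_map p).
Local Notation Vm := (gasket_vertices p).
Local Notation point := 'rV[R]_N.-1.
Local Notation rho := (renorm R N).
Implicit Types u v w : point -> R.

Let n0 : N%:R != 0 :> R := natN_neq0 R N_ge2.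
Let n_gt0 : 0 < N%:R :> R := natN_gt0 R N_ge2.
Let rho_gt0 : 0 < rho := renorm_gt0 R N_ge2.
Let rho_ge0 : 0 <= rho := ltW rho_gt0.

Fixpoint cell_energy m u v : R :=
  if m is m'.+1 then rho * \sum_i cell_energy m' (u \o F i) (v \o F i)
  else vertex_energy (u \o p) (v \o p).

Definition extra_energy m u : R :=
  \sum_(t in @distinct3 N) (u (extra_edge p m t).1 - u (extra_edge p m t).2) ^+ 2.

Lemma edge_formC s u v : edge_form s u v = edge_form s v u.
Proof. by apply: eq_bigr => z _; rewrite mulrC. Qed.

Lemma edge_form_lin s u v w (c : R) :
  edge_form s (fun x => u x + c * v x) w = edge_form s u w + c * edge_form s v w.
Proof.
rewrite /edge_form mulr_sumr -big_split/=; apply: eq_bigr => z _.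
by ring.
Qed.

Lemma edge_form_ge0 s u : 0 <= edge_form s u u.
Proof. by apply: sumr_ge0 => z _; rewrite -expr2 sqr_ge0. Qed.

Lemma energy_preC m u v : energy_pre p m u v = energy_pre p m v u.
Proof. by rewrite !energy_preE// edge_formC. Qed.

Lemma energy_pre_lin m u v w (c : R) :
  energy_pre p m (fun x => u x + c * v x) w =
  energy_pre p m u w + c * energy_pre p m v w.
Proof. by rewrite !energy_preE// edge_form_lin mulrDr mulrCA. Qed.

Lemma energy_pre_ge0 m u : 0 <= energy_pre p m u u.
Proof.
by rewrite energy_preE// mulr_ge0 ?edge_form_ge0// exprn_ge0.
Qed.

Lemma energy_pre_ext m u v : (forall x, Vm m x -> u x = v x) ->
  energy_pre p m u u = energy_pre p m v v.
Proof.
move=> uv; rewrite !energy_preE//; congr (_ * _).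
rewrite /edge_form !big_seq; apply: eq_bigr => z.
by move=> /(mem_edges N_ge2 p_dist)[z1 z2 _]; rewrite !uv.
Qed.

Lemma energy_pre0 u v : energy_pre p 0 u v = vertex_energy (u \o p) (v \o p).
Proof.
rewrite energy_preE// expr0 mul1r /edge_form /= big_map
  /vertex_energy pair_bigA/=.
rewrite big_enum/= [RHS](bigID [pred t : 'I_N * 'I_N | t.1 == t.2])/=.
rewrite [X in X + _]big1 ?add0r// => -[i j] /= /eqP ->.
by rewrite subrr mul0r.
Qed.

Lemma energy_preS m u : energy_pre p m.+1 u u =
  rho * \sum_i energy_pre p m (u \o F i) (u \o F i)
  + rho ^+ m.+1 * (if m is 0 then 0 else extra_energy m u).
Proof.
rewrite energy_preE// /edge_form /= big_cat/= mulrDr; congr (_ + _).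
  rewrite big_allpairs_dep/= big_enum/= exprS -mulrA mulr_sumr; congr (_ * _).
  by apply: eq_bigr => i _; rewrite energy_preE.
congr (_ * _); case: m => [|m]; first by rewrite big_nil.
rewrite big_map big_enum/=; apply: eq_bigr => t _; exact: expr2.
Qed.

Lemma extra_energy_ge0 m u : 0 <= extra_energy m u.
Proof. by apply: sumr_ge0 => t _; exact: sqr_ge0. Qed.

Lemma cell_energyC m u v : cell_energy m u v = cell_energy m v u.
Proof.
elim: m u v => [u v|m IH u v] /=; first exact: vertex_energyC.
by congr (_ * _); apply: eq_bigr => i _.
Qed.

Lemma cell_energy_lin m u v w (c : R) :
  cell_energy m (fun x => u x + c * v x) w =
  cell_energy m u w + c * cell_energy m v w.
Proof.
elim: m u v w => [|m IH] u v w /=.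
  rewrite /vertex_energy mulr_sumr -big_split/=; apply: eq_bigr => i _.
  by rewrite mulr_sumr -big_split/=; apply: eq_bigr => j _; rewrite /=; ring.
rewrite (mulrCA c) -mulrDr; congr (_ * _); rewrite mulr_sumr -big_split/=.
by apply: eq_bigr => i _; rewrite -IH.
Qed.

Lemma cell_energy_ge0 m u : 0 <= cell_energy m u u.
Proof.
elim: m u => [|m IH] u /=; first exact: vertex_energy_ge0.
by rewrite mulr_ge0// sumr_ge0.
Qed.

Lemma cell_energy_ext m u u' v v' : (forall x, Vm m x -> u x = u' x) ->
  (forall x, Vm m x -> v x = v' x) -> cell_energy m u v = cell_energy m u' v'.
Proof.
elim: m u u' v v' => [|m IH] u u' v v' uu vv /=.
  by apply: eq_bigr => i _; apply: eq_bigr => j _; rewrite /= !uu ?vv//;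
    exact: vertices_p.
congr (_ * _); apply: eq_bigr => i _; apply: IH => x mx /=.
  by rewrite uu//; exact: vertices_map.
by rewrite vv//; exact: vertices_map.
Qed.

(** Shared by the cell energy and the energy of the statement, so that the expansion of squares and
    Young's inequality are available for both. *)
Definition bilinear_ge0 (B : (point -> R) -> (point -> R) -> R) :=
  [/\ forall u v, B u v = B v u,
      forall u v w (c : R), B (fun x => u x + c * v x) w = B u w + c * B v w &
      forall u, 0 <= B u u].

Lemma cell_energy_bilinear m : bilinear_ge0 (cell_energy m).
Proof.
split=> *; [exact: cell_energyC|exact: cell_energy_lin|exact: cell_energy_ge0].
Qed.

Lemma energy_pre_bilinear m : bilinear_ge0 (energy_pre p m).
Proof.
split=> *; [exact: energy_preC|exact: energy_pre_lin|exact: energy_pre_ge0].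
Qed.

Section bilinear.
Variable B : (point -> R) -> (point -> R) -> R.
Hypothesis HB : bilinear_ge0 B.

Lemma bilinear_sqrD u v (c : R) :
  B (fun x => u x + c * v x) (fun x => u x + c * v x) =
  B u u + 2 * c * B u v + c ^+ 2 * B v v.
Proof.
have [BC BL _] := HB.
by rewrite BL (BC u) (BC v) !BL (BC v u); ring.
Qed.

Lemma bilinear_young u v (e c : R) : 0 < e ->
  B (fun x => u x + c * v x) (fun x => u x + c * v x) <=
  (1 + e) * B u u + (1 + e^-1) * (c ^+ 2 * B v v).
Proof.
move=> e0; have [_ _ B0] := HB.
have := B0 (fun x => u x + (- (c / e)) * v x).
rewrite !bilinear_sqrD => /(mulr_ge0 (ltW e0)).
rewrite (_ : e * _ = e * B u u - 2 * c * B u v + e^-1 * (c ^+ 2 * B v v)); last first.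
  by field; rewrite gt_eqF.
by rewrite !mulrDl !mul1r; lra.
Qed.

End bilinear.

Lemma cell_energyS_ge0_comp m u i :
  rho * cell_energy m (u \o F i) (u \o F i) <= cell_energy m.+1 u u.
Proof.
rewrite /= ler_pM2l// (bigD1 i)//= lerDl sumr_ge0// => k _.
exact: cell_energy_ge0.
Qed.

Section harmonic.
(** The harmonic extension enters the algebra only through its vertex values and its refinement
    rule; it is constructed later, once the topology of V is known. *)
Variable hb : ('I_N -> R) -> point -> R.
Hypothesis hb_vertex : forall b j, hb b (p j) = b j.
Hypothesis hb_map : forall b i m x, Vm m x ->
  hb b (F i x) = hb (harmonic_step i b) x.

(** Induction with [harmonic_step_orthogonal]. The symmetry required there holds because [v] takes a
    single value at a junction point, whichever cell it is seen from. *)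
Lemma cell_energy_harmonic m b v :
  cell_energy m (hb b) v = vertex_energy b (v \o p).
Proof.
elim: m b v => [|m IH] b v /=.
  apply: eq_bigr => i _; apply: eq_bigr => j _; by rewrite /= !hb_vertex.
rewrite (eq_bigr (fun i => vertex_energy (harmonic_step i b)
    (fun j => v (F i (p j))))); last first.
  move=> i _; rewrite -[RHS](IH (harmonic_step i b) (v \o F i)).
  by apply: cell_energy_ext => // x; exact: hb_map.
rewrite (harmonic_step_orthogonal N_ge2 b (y := fun i j => v (F i (p j)))).
  by apply: eq_bigr => i _; apply: eq_bigr => j _; rewrite !gasket_map_fix.
by move=> i j; rewrite gasket_map_swap.
Qed.

(** Pythagoras: [u] minus its harmonic interpolation vanishes on the vertices and so is orthogonal
    to the interpolation. *)
Lemma cell_energy_sub_harmonic m u :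
  cell_energy m (fun x => u x + (-1) * hb (u \o p) x)
                (fun x => u x + (-1) * hb (u \o p) x) =
  cell_energy m u u - cell_energy 0 u u.
Proof.
rewrite bilinear_sqrD; last exact: cell_energy_bilinear.
rewrite (cell_energyC _ u) !cell_energy_harmonic /=.
have -> : vertex_energy (u \o p) (hb (u \o p) \o p) = vertex_energy (u \o p) (u \o p).
  by apply: eq_bigr => i _; apply: eq_bigr => j _; rewrite /= !hb_vertex.
by ring.
Qed.

Lemma cell_energy_ge_vertex m u : cell_energy 0 u u <= cell_energy m u u.
Proof. by rewrite -subr_ge0 -cell_energy_sub_harmonic cell_energy_ge0. Qed.

Lemma cell_energy_leS m u : cell_energy m u u <= cell_energy m.+1 u u.
Proof.
elim: m u => [|m IH] u; first exact: cell_energy_ge_vertex.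
by rewrite /= ler_pM2l//; apply: ler_sum => i _; exact: IH.
Qed.

Lemma cell_energy_le m n u : (m <= n)%N -> cell_energy m u u <= cell_energy n u u.
Proof.
move=> /subnKC <-; elim: (n - m)%N => [|k IH]; first by rewrite addn0.
by rewrite addnS (le_trans IH)// cell_energy_leS.
Qed.

(* One step costs [1 / sqrt 2] and the cells shrink the energy by [1 / rho], so
   any [K >= 1 / (sqrt 2 * (1 - rho ^ (-1/2)))] works. *)
Lemma vertex_oscillation m u x i : Vm m x ->
  (u x - u (p i)) ^+ 2 <= (N%:R + 2) ^+ 2 * cell_energy m u u.
Proof.
elim: m u x i => [|m IH] u x i.
  move=> [j _ <-].
  have h := vertex_energy_ge_edge (u \o p) j i; rewrite /= in h *.
  have E0 := vertex_energy_ge0 (u \o p).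
  have n1 : 2 <= N%:R :> R by rewrite ler_nat.
  have := sqr_ge0 (u (p j) - u (p i)); rewrite /=.
  set E := vertex_energy _ _ in h E0 *; set s := _ ^+ 2 in h *.
  set n : R := N%:R in n1 *; nra.
move=> /vertices_mapP[j [y [my ->]]].
have h1 := IH (u \o F j) y j my; rewrite /= gasket_map_fix in h1.
have h2 : 2 * (u (p j) - u (p i)) ^+ 2 <= cell_energy m.+1 u u.
  exact: le_trans (vertex_energy_ge_edge (u \o p) j i) (cell_energy_ge_vertex _ _).
have h3 := cell_energyS_ge0_comp m u j.
set E := cell_energy m.+1 u u in h2 h3 *.
set e := cell_energy m _ _ in h1 h3.
set s := u (F j y) - u (p j) in h1; set t := u (p j) - u (p i) in h2.
rewrite (_ : _ - u (p i) = s + t); last by rewrite /s /t; ring.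
have n1 : 2 <= N%:R :> R by rewrite ler_nat.
move: h1 h3; rewrite /renorm; set n : R := N%:R in n1 *.
have n0' : 0 < n by lra.
rewrite [_ / _ * e]mulrAC ler_pdivrMr// => h1 h3.
have h4 : s ^+ 2 <= (n + 2) * n * E.
  have n2 : 0 < n + 2 by lra.
  rewrite -(ler_pM2l n2); apply: (@le_trans _ _ ((n + 2) * ((n + 2) ^+ 2 * e))).
    by rewrite ler_pM2l.
  rewrite (_ : (n + 2) * _ = (n + 2) ^+ 2 * (e * (n + 2))); last by ring.
  rewrite (_ : (n + 2) * (_ * E) = (n + 2) ^+ 2 * (E * n)); last by ring.
  by rewrite ler_pM2l ?exprn_gt0//; move: h3; lra.
(* The Young weight [1 / n] makes the constants close: [(n + 1) * (n + 2)] from [s] and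
   [(n + 1) / 2] from [t] add up to at most [(n + 2) ^+ 2]. *)
have st : (s + t) ^+ 2 <= (1 + n^-1) * s ^+ 2 + (1 + n) * t ^+ 2.
  rewrite -subr_ge0 (_ : _ - _ = (s - n * t) ^+ 2 / n); last by field; rewrite gt_eqF.
  by rewrite divr_ge0 ?sqr_ge0 ?ltW.
apply: (le_trans st).
have h5 : (1 + n^-1) * s ^+ 2 <= (n + 1) * (n + 2) * E.
  apply: (@le_trans _ _ ((1 + n^-1) * ((n + 2) * n * E))).
    by rewrite ler_pM2l// ltr_wpDr// invr_ge0 ltW.
  by rewrite le_eqVlt; apply/orP; left; apply/eqP; field; rewrite gt_eqF.
have h6 : (1 + n) * t ^+ 2 <= (1 + n) * (E / 2) by rewrite ler_pM2l; lra.
have E0 : 0 <= E by exact: cell_energy_ge0.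
apply: (le_trans (lerD h5 h6)); rewrite -subr_ge0.
rewrite (_ : _ - _ = (n / 2 + 3 / 2) * E); last by field.
by rewrite mulr_ge0//; lra.
Qed.

Lemma hb_iter j m b c :
  hb b (iter m (F j) (p c)) = iter m (harmonic_step j) b c.
Proof.
elim: m b => [|m IH] b; first by rewrite /= hb_vertex.
rewrite iterS (@hb_map b j m) ?IH -?iterSr//.
by rewrite -[X in Vm X]addn0; apply: vertices_iter; exact: vertices_p.
Qed.

(** Each ordered pair of distinct cells has [N - 2] directions [c], all with the same jump by
    [harmonic_step_extra]; summing over pairs rebuilds the vertex energy. *)
Lemma extra_energy_harmonic m : exists2 y, 0 <= y &
  forall b, extra_energy m (hb b) = y * vertex_energy b b.
Proof.
have [K HK] := harmonic_step_extra R N m.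
exists (K ^+ 2 *+ (N - 2)); first by rewrite mulrn_wge0// sqr_ge0.
move=> b; rewrite /extra_energy.
rewrite (eq_bigr (fun t => K ^+ 2 * (b t.1.1 - b t.1.2) ^+ 2)); last first.
  move=> [[i j] c]; rewrite unfold_in /= => /and3P[/= ij ci cj].
  have vI k l : Vm m (iter m (F k) (p l)).
    by rewrite -[X in Vm X]addn0; apply: vertices_iter; exact: vertices_p.
  by rewrite !(@hb_map _ _ m)// !hb_iter HK// exprMn.
rewrite -(pair_big_dep xpredT (fun a c => distinct3 (a, c))
  (fun a c => K ^+ 2 * (b a.1 - b a.2) ^+ 2))/=.
transitivity (\sum_(q : 'I_N * 'I_N) K ^+ 2 *+ (N - 2) * (b q.1 - b q.2) ^+ 2);
  last first.
  rewrite -(pair_bigA _ (fun i j => K ^+ 2 *+ (N - 2) * (b i - b j) ^+ 2))/=.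
  rewrite /vertex_energy mulr_sumr.
  apply: eq_bigr => i _; rewrite mulr_sumr; apply: eq_bigr => j _.
  by rewrite expr2.
apply: eq_bigr => -[i j] _ /=; have [->|ij] := eqVneq i j.
  by rewrite subrr expr0n/= !mulr0 big1.
rewrite sumr_const mulrnAl; congr (_ *+ _).
rewrite (eq_card (B := ~: [set i; j])).
  by rewrite cardsCs finset.setCK card_ord cards2 ij.
by move=> c; rewrite !inE /distinct3 unfold_in /= ij negb_or.
Qed.

(** The edges inside cells reproduce the ratio of the previous level by orthogonality, and the extra
    edges add a non-negative multiple of the same vertex energy. Hence one ratio for all boundary
    data, growing with the level. *)
Lemma harmonic_energy_pre : exists x : nat -> R,
  [/\ x 0%N = 1, nondecreasing_seq x &
      forall m b, energy_pre p m (hb b) (hb b) = x m * vertex_energy b b].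
Proof.
have [y hy] : {y : nat -> R & forall m, 0 <= y m /\
    forall b, extra_energy m (hb b) = y m * vertex_energy b b}.
  apply: (@choice _ _ (fun m y => 0 <= y /\
    forall b, extra_energy m (hb b) = y * vertex_energy b b)) => m.
  by have [y y0 yE] := extra_energy_harmonic m; exists y.
pose x m := 1 + \sum_(k < m) rho ^+ k.+1 * (if val k is 0 then 0 else y k).
exists x; split.
- by rewrite /x big_ord0 addr0.
- apply/nondecreasing_seqP => m; rewrite /x big_ord_recr/= addrA lerDl.
  rewrite mulr_ge0 ?exprn_ge0//; case: m => // m; exact: (hy _).1.
- elim=> [b|m IH b].
    rewrite energy_pre0 /x big_ord0 addr0 mul1r.
    by apply: eq_bigr => i _; apply: eq_bigr => j _; rewrite /= !hb_vertex.
  rewrite energy_preS /x big_ord_recr/= addrA mulrDl -/(x m); congr (_ + _).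
    rewrite (eq_bigr (fun i => x m * vertex_energy (harmonic_step i b) (harmonic_step i b))).
      rewrite -mulr_sumr mulrCA; congr (_ * _).
      rewrite (harmonic_step_orthogonal N_ge2 b (y := fun i => harmonic_step i b)).
        apply: eq_bigr => i _; apply: eq_bigr => j _.
        by rewrite /harmonic_step !eqxx.
      move=> i j; rewrite /harmonic_step eq_sym; case: eqP => [->//|_].
      by rewrite (addrC (b i)).
    move=> i _; rewrite -IH; apply: energy_pre_ext => z; exact: hb_map.
  rewrite -mulrA; congr (_ * _); case: m {IH} => [|m]; first by rewrite mul0r.
  exact: (hy _).2.
Qed.

(** The cells [F_b^m] shrink to the vertices. Seen from a neighbouring cell they are the cells at a
    junction, where the extra edges have their endpoints. *)
Definition corner_energy m u : R :=
  rho ^+ m * \sum_b cell_energy 0 (u \o iter m (F b)) (u \o iter m (F b)).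

Lemma corner_energy_ge0 m u : 0 <= corner_energy m u.
Proof.
rewrite mulr_ge0 ?exprn_ge0// sumr_ge0// => b _; exact: cell_energy_ge0.
Qed.

Let W m u a b := cell_energy 0 ((u \o F a) \o iter m (F b)) ((u \o F a) \o iter m (F b)).

(** A corner cell of a subcell lies either at a vertex of the gasket ([a = b]) or at a junction
    ([a != b]); the latter part will pay for the extra edges. *)
Lemma corner_energyS m u :
  rho * \sum_i corner_energy m (u \o F i) =
  corner_energy m.+1 u + rho ^+ m.+1 * \sum_a \sum_(b | b != a) W m u a b.
Proof.
rewrite /corner_energy -mulr_sumr mulrA -exprS -mulrDr -big_split/=.
congr (_ * _); apply: eq_bigr => i _; by rewrite [LHS](bigD1 i).
Qed.

(** Pass through the junction value [q]: the squared jump is at most [2 (X - q)^2 + 2 (Y - q)^2],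
    and each summand is an edge of a corner cell. A pair of cells serves at most [N] directions, and
    its two orders give the factor 2. *)
Lemma extra_energy_le m u :
  extra_energy m u <= 2 * N%:R * \sum_a \sum_(b | b != a) W m u a b.
Proof.
have W0 a b : 0 <= W m u a b by exact: cell_energy_ge0.
pose W2 (t : 'I_N * 'I_N) := W m u t.1 t.2 + W m u t.2 t.1.
apply: (@le_trans _ _ (\sum_(t in @distinct3 N) W2 t.1)).
  apply: ler_sum => -[[a b] c]; rewrite unfold_in /= => /and3P[/= ab ca cb].
  have h1 := vertex_energy_ge_edge (((u \o F a) \o iter m (F b)) \o p) c b.
  have h2 := vertex_energy_ge_edge (((u \o F b) \o iter m (F a)) \o p) c a.
  have fix_ i : iter m (F i) (p i) = p i.
    by elim: m {h1 h2 W0 W2} => // m IH; rewrite iterS IH gasket_map_fix.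
  rewrite /W2 /= /W /=; apply: le_trans (lerD h1 h2); rewrite /= !fix_.
  rewrite (gasket_map_swap p a b).
  set X := u _; set Y := u _; set q := u _.
  by have := sqr_ge0 (X - q + (Y - q)); rewrite !expr2; lra.
rewrite -(pair_big_dep xpredT (fun a c => distinct3 (a, c)) (fun a c => W2 a))/=.
apply: (@le_trans _ _ (\sum_(t : 'I_N * 'I_N | t.1 != t.2) N%:R * W2 t)).
  rewrite [leRHS]big_mkcond; apply: ler_sum => -[a b] _ /=.
  case: ifPn => [ab|]; last first.
    by rewrite negbK => /eqP ->; rewrite big1// => c; rewrite /distinct3 /= eqxx.
  rewrite sumr_const -[leLHS]mulr_natl ler_wpM2r ?addr_ge0// ler_nat.
  by rewrite -[leqRHS]card_ord max_card.
rewrite -mulr_sumr big_split/= mulrAC [leLHS]mulrC -[2 * _]/(2%:R * _).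
rewrite ler_pM2r// /W2.
rewrite -(pair_big_dep xpredT (fun a b => a != b) (fun a b => W m u a b))/=.
rewrite -(pair_big_dep xpredT (fun a b => a != b) (fun a b => W m u b a))/=.
rewrite [X in _ + X <= _](exchange_big_dep xpredT)//=.
rewrite mulr_natl mulr2n; apply: lerD; apply: ler_sum => a _.
  by rewrite le_eqVlt; apply/orP; left; apply/eqP; apply: eq_bigl => b; rewrite eq_sym.
by rewrite lexx.
Qed.

(** Dictated by the base case below: at level 0 each of the [N] corner cells is the whole gasket, so
    the corner term is [2 * N * N] times the energy. *)
Definition energy_ratio_bound : R := 1 + 2 * N%:R * N%:R.

Lemma energy_ratio_bound_gt0 : 0 < energy_ratio_bound.
Proof. by rewrite addr_gt0// !mulr_gt0. Qed.

(* The induction only closes with the corner term: an extra edge sits in two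
   cells of the form F_a F_b^m, and every cell has at most one such form. *)
Lemma energy_pre_corner_le m u :
  energy_pre p m u u + 2 * N%:R * corner_energy m u <=
  energy_ratio_bound * cell_energy m u u.
Proof.
elim: m u => [|m IH] u.
  rewrite energy_pre0 /corner_energy expr0 mul1r.
  rewrite (eq_bigr (fun=> cell_energy 0 u u))// sumr_const card_ord.
  rewrite /energy_ratio_bound [leRHS]mulrDl mul1r lerD2l.
  by rewrite -(mulr_natl (cell_energy 0 u u)) mulrA.
rewrite energy_preS /= [leRHS]mulrCA [in leRHS]mulr_sumr.
apply: (@le_trans _ _ (rho * \sum_i (energy_pre p m (u \o F i) (u \o F i) +
    2 * N%:R * corner_energy m (u \o F i)))); last first.
  by rewrite ler_pM2l//; apply: ler_sum => i _; exact: IH.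
rewrite big_split/= mulrDr -addrA lerD2l -mulr_sumr (mulrCA rho) corner_energyS.
rewrite mulrDr addrC lerD2l mulrCA ler_pM2l ?exprn_gt0//.
apply: (le_trans _ (extra_energy_le m u)).
case: m {IH} => [|//]; exact: extra_energy_ge0.
Qed.

Lemma energy_pre_le m u :
  energy_pre p m u u <= energy_ratio_bound * cell_energy m u u.
Proof.
apply: (le_trans _ (energy_pre_corner_le m u)).
by rewrite lerDl mulr_ge0 ?corner_energy_ge0// mulr_ge0.
Qed.

Lemma energy_pre_ge m u : cell_energy m u u <= energy_pre p m u u.
Proof.
elim: m u => [|m IH] u; first by rewrite energy_pre0.
rewrite energy_preS /= -[leLHS]addr0 lerD//.
  by rewrite ler_pM2l//; apply: ler_sum => i _; exact: IH.
rewrite mulr_ge0 ?exprn_ge0//; case: m {IH} => // m; exact: extra_energy_ge0.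
Qed.

(** Split [u] into its harmonic interpolation and a remainder [w]. Young's inequality with weight
    [1 / N] spoils the contraction factor [N / (N + 2)] only to [(N + 1) / (N + 2)], still below 1,
    and the energy of [w] is the increment from level 0 to level 1. *)
Lemma cell_energy0_contraction u b :
  rho * cell_energy 0 (u \o F b) (u \o F b) <=
  (N%:R + 1) / (N%:R + 2) * cell_energy 0 u u
  + (N%:R + 1) * (cell_energy 1 u u - cell_energy 0 u u).
Proof.
rewrite -(cell_energy_sub_harmonic 1); set w := (fun x => u x + _).
have -> : cell_energy 0 (u \o F b) (u \o F b) = cell_energy 0
    (fun x => hb (u \o p) (F b x) + 1 * w (F b x))
    (fun x => hb (u \o p) (F b x) + 1 * w (F b x)).
  by apply: cell_energy_ext => x _ /=; rewrite /w; ring.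
have i0 : 0 < N%:R^-1 :> R by rewrite invr_gt0.
have yg := bilinear_young (cell_energy_bilinear 0)
  (hb (u \o p) \o F b) (w \o F b) 1 i0.
apply: (le_trans (ler_wpM2l rho_ge0 yg)); rewrite expr1n mul1r invrK mulrDr.
apply: lerD; last first.
  rewrite mulrCA [in leRHS]addrC ler_pM2l ?addr_gt0//.
  exact: cell_energyS_ge0_comp.
rewrite mulrCA.
have -> : cell_energy 0 (hb (u \o p) \o F b) (hb (u \o p) \o F b) =
    vertex_energy (harmonic_step b (u \o p)) (harmonic_step b (u \o p)).
  apply: eq_bigr => i _; apply: eq_bigr => j _.
  by rewrite /= !(@hb_map _ _ 0) ?hb_vertex//; exact: vertices_p.
have c := harmonic_step_contraction N_ge2 b (u \o p).
have N1 : 0 <= 1 + N%:R^-1 :> R by rewrite addr_ge0// invr_ge0 ltW.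
apply: (le_trans (ler_wpM2l N1 c)).
rewrite mulrA le_eqVlt; apply/orP; left; apply/eqP; congr (_ * _).
by field; rewrite n0 gt_eqF// addr_gt0.
Qed.

Lemma cell_energy_increment_iter n u b :
  rho ^+ n * (cell_energy 1 (u \o iter n (F b)) (u \o iter n (F b))
            - cell_energy 0 (u \o iter n (F b)) (u \o iter n (F b))) <=
  cell_energy n.+1 u u - cell_energy n u u.
Proof.
elim: n u => [|n IH] u; first by rewrite expr0 mul1r.
rewrite exprS -mulrA; apply: (le_trans (ler_wpM2l rho_ge0 (IH (u \o F b)))).
rewrite [leRHS]/= -mulrBr ler_pM2l// -sumrB (bigD1 b)//= lerDl sumr_ge0// => i _.
by rewrite subr_ge0; exact: (cell_energy_leS n).
Qed.

Definition finite_energy u := exists M, forall m, cell_energy m u u <= M.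

(** Along each corner, [z] contracts by [1 - d] up to a multiple of the energy increment. The
    increments telescope to a bounded total, so the series of the [z b m] converges and its terms
    tend to 0. *)
Lemma corner_energy_cvg0 u : finite_energy u ->
  corner_energy m u @[m --> \oo] --> 0.
Proof.
move=> [M uM].
pose z b m := rho ^+ m * cell_energy 0 (u \o iter m (F b)) (u \o iter m (F b)).
have z0 b m : 0 <= z b m by rewrite mulr_ge0 ?exprn_ge0// cell_energy_ge0.
have zS b m : z b m.+1 <= (N%:R + 1) / (N%:R + 2) * z b m
    + (N%:R + 1) * (cell_energy m.+1 u u - cell_energy m u u).
  have := ler_wpM2l (exprn_ge0 m rho_ge0) (cell_energy0_contraction (u \o iter m (F b)) b).
  rewrite mulrA -exprSr.
  have <- : cell_energy 0 (u \o iter m.+1 (F b)) (u \o iter m.+1 (F b)) =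
      cell_energy 0 ((u \o iter m (F b)) \o F b) ((u \o iter m (F b)) \o F b).
    by apply: cell_energy_ext => x _; rewrite /= -iterSr.
  move=> h; apply: (le_trans h); rewrite mulrDr mulrCA -/(z b m) lerD2l mulrCA.
  rewrite ler_pM2l ?addr_gt0//; exact: cell_energy_increment_iter.
pose d : R := (N%:R + 2)^-1.
have d0 : 0 < d by rewrite invr_gt0 addr_gt0.
have dE : (N%:R + 1) / (N%:R + 2) = 1 - d.
  by rewrite /d; field; rewrite gt_eqF// addr_gt0.
have zsum b m : z b m + d * \sum_(0 <= k < m) z b k <=
    z b 0 + (N%:R + 1) * (cell_energy m u u - cell_energy 0 u u).
  elim: m => [|m IH]; first by rewrite big_geq// subrr !mulr0.
  have := zS b m; rewrite dE big_nat_recr// [X in d * X]/=; move: IH.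
  set r := \sum_(0 <= k < m) z b k; set a := z b m.+1; set a' := z b m.
  set e := cell_energy m.+1 u u; set e' := cell_energy m u u.
  by set n1 := N%:R + 1; set e0 := cell_energy 0 u u; lra.
have zcvg b : z b m @[m --> \oo] --> 0.
  apply: cvg_series_cvg_0; apply: nondecreasing_is_cvgn.
    apply/nondecreasing_seqP => m; rewrite /series/= big_nat_recr//= lerDl.
    exact: z0.
  exists (d^-1 * (z b 0 + (N%:R + 1) * (M - cell_energy 0 u u))) => _ [m _ <-].
  rewrite ler_pdivlMl//; apply: le_trans (le_trans _ (zsum b m)) _.
    by rewrite lerDr.
  by rewrite lerD2l ler_pM2l ?addr_gt0// lerB.
rewrite (_ : (fun m => corner_energy m u) = (fun m => \sum_b z b m)); last first.
  by apply/funext => m; rewrite /corner_energy mulr_sumr.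
exact: cvg_finite_sum0.
Qed.

End harmonic.
End cell_energy.

(** * Limit of the energies for functions of finite energy *)

Section energy_limit.
Variables (R : realType) (N : nat) (p : 'I_N -> 'rV[R]_N.-1).
Hypothesis N_ge2 : (2 <= N)%N.
Hypothesis p_dist : forall i j : 'I_N, i != j -> euclid_dist (p i) (p j) = 1.
Variable hb : ('I_N -> R) -> 'rV[R]_N.-1 -> R.
Hypothesis hb_vertex : forall b j, hb b (p j) = b j.
Hypothesis hb_map : forall b i m x, gasket_vertices p m x ->
  hb b (gasket_map p i x) = hb (harmonic_step i b) x.

Local Notation F := (gasket_map p).
Local Notation rho := (renorm R N).
Local Notation C := (energy_ratio_bound R N).
Local Notation S := (cell_energy p).
Local Notation Q := (energy_pre p).
Implicit Types u v w : 'rV[R]_N.-1 -> R.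

Let n_gt0 : 0 < N%:R :> R := natN_gt0 R N_ge2.
Let rho_gt0 : 0 < rho := renorm_gt0 R N_ge2.
Let rho_ge0 : 0 <= rho := ltW rho_gt0.
Let C_gt0 : 0 < C := energy_ratio_bound_gt0 R N_ge2.
Let S_ge0 := cell_energy_ge0 p N_ge2.
Let S_le := cell_energy_le N_ge2 hb_vertex hb_map.

Definition cell_energy_lim u : R := limn (fun m => S m u u).

Lemma cell_energy_cvg u : finite_energy p u ->
  S m u u @[m --> \oo] --> cell_energy_lim u.
Proof.
move=> [M uM]; apply: nondecreasing_is_cvgn; first by move=> m n mn; exact: S_le.
by exists M => _ [m _ <-].
Qed.

Lemma cell_energy_le_lim u m : finite_energy p u -> S m u u <= cell_energy_lim u.
Proof.
move=> fu; apply: (@nondecreasing_cvgn_le _ (fun m => S m u u)).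
  by move=> k n kn; exact: S_le.
by apply/cvg_ex; exists (cell_energy_lim u); exact: cell_energy_cvg.
Qed.

Lemma finite_energy_comp u i : finite_energy p u -> finite_energy p (u \o F i).
Proof.
move=> [M uM]; exists (rho^-1 * M) => m; rewrite ler_pdivlMl//.
exact: le_trans (cell_energyS_ge0_comp p N_ge2 m u i) (uM m.+1).
Qed.

Fixpoint cell_average k (Phi : ('rV[R]_N.-1 -> R) -> R) u : R :=
  if k is k'.+1 then rho * \sum_i cell_average k' Phi (u \o F i) else Phi u.

(** The two sides differ by the extra edges that cross junctions of the first [k] levels. There are
    finitely many such junctions, and at each one the corner energies tend to 0. *)
Lemma energy_pre_average_cvg0 k u : finite_energy p u ->
  Q (k + m) u u - cell_average k (fun v => Q m v v) u @[m --> \oo] --> 0.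
Proof.
elim: k u => [|k IH] u fu.
  by under eq_fun do rewrite add0n subrr; exact: cvg_cst.
have ->: (fun m => Q (k.+1 + m) u u - cell_average k.+1 (fun v => Q m v v) u) =
    (fun m => rho * \sum_i (Q (k + m) (u \o F i) (u \o F i)
                          - cell_average k (fun v => Q m v v) (u \o F i))
      + rho ^+ (k + m).+1 * (if (k + m)%N is 0 then 0 else extra_energy p (k + m) u)).
  apply/funext => m; rewrite addSn energy_preS//= sumrB mulrBr.
  by rewrite [LHS]addrAC.
rewrite -[X in _ --> X]addr0; apply: cvgD.
  rewrite -[X in _ --> X](mulr0 rho); apply: cvgMl_tmp.
  by apply: cvg_finite_sum0 => i; apply: IH; exact: finite_energy_comp.
have corner : 2 * N%:R * rho * \sum_i corner_energy p m (u \o F i)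
    @[m --> \oo] --> 0.
  rewrite -[X in _ --> X](mulr0 (2 * N%:R * rho)); apply: cvgMl_tmp.
  apply: cvg_finite_sum0 => i.
  apply: (corner_energy_cvg0 N_ge2 hb_vertex hb_map).
  exact: finite_energy_comp.
have shift : (2 * N%:R * rho * \sum_i corner_energy p (m + k)%N (u \o F i))
    @[m --> \oo] --> 0 by exact: (cvg_comp _ _ (cvg_addnr k) corner).
apply: squeeze_cvgr (cvg_cst 0) shift; near=> m; apply/andP; split.
  rewrite mulr_ge0 ?exprn_ge0//; case: (k + m)%N => // j; exact: extra_energy_ge0.
rewrite addnC.
apply: (@le_trans _ _ (rho ^+ (m + k).+1 * extra_energy p (m + k) u)).
  rewrite ler_pM2l ?exprn_gt0//; case: (m + k)%N => //; exact: extra_energy_ge0.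
apply: (le_trans (ler_wpM2l _ (extra_energy_le p N_ge2 (m + k) u))).
  by rewrite exprn_ge0.
rewrite mulrCA -mulrA ler_pM2l ?mulr_gt0// corner_energyS lerDr.
exact: corner_energy_ge0.
Unshelve. all: by end_near. Qed.

Section comparison.
Variable x : nat -> R.
Hypothesis x0 : x 0%N = 1.
Hypothesis x_ndecr : nondecreasing_seq x.
Hypothesis xE : forall m b, Q m (hb b) (hb b) = x m * vertex_energy b b.

Lemma harmonic_ratio_ge1 m : 1 <= x m.
Proof. by rewrite -x0 x_ndecr. Qed.

Lemma harmonic_ratio_le m : x m <= C.
Proof.
pose i0 := Ordinal (leq_trans (isT : (0 < 2)%N) N_ge2); pose i1 := Ordinal N_ge2.
pose b (i : 'I_N) : R := (i == i0)%:R.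
have b0 : 0 < vertex_energy b b.
  apply: lt_le_trans (vertex_energy_ge_edge b i0 i1).
  by rewrite /b eqxx /= subr0 expr1n.
rewrite -(ler_pM2r b0) -xE (le_trans (energy_pre_le N_ge2 p_dist m _))//.
rewrite (cell_energy_harmonic N_ge2 hb_vertex hb_map) ler_pM2l//.
rewrite le_eqVlt; apply/orP; left; apply/eqP.
by apply: eq_bigr => i _; apply: eq_bigr => j _; rewrite /= !hb_vertex.
Qed.

Lemma harmonic_ratio_cvg : x m @[m --> \oo] --> limn x.
Proof.
apply: nondecreasing_is_cvgn => //; exists C => _ [m _ <-].
exact: harmonic_ratio_le.
Qed.

Lemma harmonic_ratio_le_lim m : x m <= limn x.
Proof.
by apply: nondecreasing_cvgn_le => //; apply/cvg_ex; exists (limn x);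
  exact: harmonic_ratio_cvg.
Qed.

(** [u] is compared with its harmonic interpolation, where the ratio is exactly [x m]. The
    difference has cell energy [S m u u - S 0 u u] by Pythagoras, and the crude constant [C]
    suffices for it. *)
Lemma energy_pre_upper m u (e : R) : 0 < e ->
  Q m u u <= (1 + e) * (x m * S 0 u u) + (1 + e^-1) * C * (S m u u - S 0 u u).
Proof.
move=> e0; pose w y := u y + (-1) * hb (u \o p) y.
have -> : Q m u u = Q m (fun y => hb (u \o p) y + 1 * w y)
                        (fun y => hb (u \o p) y + 1 * w y).
  by apply: energy_pre_ext => // y _; rewrite /w; ring.
apply: (le_trans (bilinear_young (energy_pre_bilinear N_ge2 p_dist m) _ _ _ e0)).
rewrite xE lerD2l expr1n mul1r -mulrA ler_pM2l ?addr_gt0 ?invr_gt0//.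
rewrite -(cell_energy_sub_harmonic N_ge2 hb_vertex hb_map).
exact: energy_pre_le.
Qed.

Lemma energy_pre_lower m u (e : R) : 0 < e ->
  x m * S 0 u u <= (1 + e) * Q m u u + (1 + e^-1) * C * (S m u u - S 0 u u).
Proof.
move=> e0; pose w y := u y + (-1) * hb (u \o p) y.
have -> : x m * S 0 u u = Q m (fun y => u y + (-1) * w y)
                              (fun y => u y + (-1) * w y).
  rewrite -[S 0 u u]/(vertex_energy (u \o p) (u \o p)) -xE.
  by apply: energy_pre_ext => // y _; rewrite /w; ring.
apply: (le_trans (bilinear_young (energy_pre_bilinear N_ge2 p_dist m) _ _ _ e0)).
rewrite lerD2l sqrrN expr1n mul1r -mulrA ler_pM2l ?addr_gt0 ?invr_gt0//.
rewrite -(cell_energy_sub_harmonic N_ge2 hb_vertex hb_map).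
exact: energy_pre_le.
Qed.

Lemma cell_average_upper k m u (e : R) : 0 < e ->
  cell_average k (fun v => Q m v v) u <=
  (1 + e) * (x m * S k u u) + (1 + e^-1) * C * (S (k + m) u u - S k u u).
Proof.
move=> e0; elim: k u => [|k IH] u; first exact: energy_pre_upper.
rewrite addSn /=.
rewrite [leRHS](_ : _ = rho * \sum_i ((1 + e) * (x m * S k (u \o F i) (u \o F i)) +
  (1 + e^-1) * C * (S (k + m) (u \o F i) (u \o F i) - S k (u \o F i) (u \o F i)))).
  by rewrite ler_pM2l//; apply: ler_sum => i _; exact: IH.
by rewrite big_split/= -!mulr_sumr sumrB; ring.
Qed.

Lemma cell_average_lower k m u (e : R) : 0 < e ->
  x m * S k u u <= (1 + e) * cell_average k (fun v => Q m v v) u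
  + (1 + e^-1) * C * (S (k + m) u u - S k u u).
Proof.
move=> e0; elim: k u => [|k IH] u; first exact: energy_pre_lower.
rewrite addSn /=.
rewrite [leRHS](_ : _ = rho * \sum_i ((1 + e) * cell_average k (fun v => Q m v v) (u \o F i) +
  (1 + e^-1) * C * (S (k + m) (u \o F i) (u \o F i) - S k (u \o F i) (u \o F i)))).
  by rewrite mulrCA ler_pM2l// mulr_sumr; apply: ler_sum => i _; exact: IH.
by rewrite big_split/= -!mulr_sumr sumrB; ring.
Qed.

(** The order of choices matters: [e] fixes the large Young factor [1 + e^-1], then [k] makes the
    energy gained above level [k] small against that factor, and only then does [m] tend to
    infinity. *)
Lemma energy_pre_cvg_ratio u : finite_energy p u ->
  Q m u u @[m --> \oo] --> limn x * cell_energy_lim u.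
Proof.
move=> fu; set L := limn x * _.
have k0 : 0 <= limn x.
  by apply: (le_trans _ (harmonic_ratio_le_lim 0)); rewrite x0.
have s0 : 0 <= cell_energy_lim u.
  exact: le_trans (S_ge0 0%N u) (cell_energy_le_lim 0 fu).
have L0 : 0 <= L by rewrite mulr_ge0.
have main (e : R) : 0 < e -> e <= 1 ->
    \forall n \near \oo, Q n u u <= (1 + e) * L + 2 * e /\
                         L <= (1 + e) * (Q n u u + e) + 3 * e.
  move=> e0 e1; pose D := (1 + e^-1) * C.
  have D0 : 0 < D by rewrite mulr_gt0// addr_gt0// invr_gt0.
  have [k kE] : exists k, D * (cell_energy_lim u - S k u u) <= e.
    have : \forall k \near \oo, `|cell_energy_lim u - S k u u| <= e / D.
      by move/cvgrPdist_le: (cell_energy_cvg fu); apply; rewrite divr_gt0.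
    move=> [k _ /(_ k (leqnn k)) h]; exists k.
    rewrite mulrC -ler_pdivlMr//; exact: le_trans (ler_norm _) h.
  (* So the choice of [k] also controls [x m] times the missing energy. *)
  have kC : limn x <= D.
    apply: le_trans (_ : C <= _).
      apply: limr_le; first by apply/cvg_ex; exists (limn x); exact: harmonic_ratio_cvg.
      by near=> m; exact: harmonic_ratio_le.
    by rewrite /D ler_peMl ?ltW// ltrDl invr_gt0.
  have h1 : \forall m \near \oo, `|0 - (Q (k + m) u u -
      cell_average k (fun v => Q m v v) u)| <= e.
    by move/cvgrPdist_le: (energy_pre_average_cvg0 k fu); apply.
  have h2 : \forall m \near \oo, `|L - x m * cell_energy_lim u| <= e.
    have : x m * cell_energy_lim u @[m --> \oo] --> L.
      by apply: cvgMr_tmp; exact: harmonic_ratio_cvg.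
    by move/cvgrPdist_le; apply.
  have [M _ hM] : \forall m \near \oo,
      `|0 - (Q (k + m) u u - cell_average k (fun v => Q m v v) u)| <= e /\
      `|L - x m * cell_energy_lim u| <= e by apply: filterI.
  exists (k + M)%N => // n /= kMn.
  have [m nE Mm] : exists2 m, n = (k + m)%N & (M <= m)%N.
    by exists (n - k)%N; lia.
  rewrite nE {nE kMn}; have [] := hM m Mm; rewrite !ler_norml.
  move=> /andP[a1 a2] /andP[b1 b2].
  have Sk := cell_energy_le_lim k fu; have Skm := cell_energy_le_lim (k + m) fu.
  have SkSkm := S_le u (leq_addr m k).
  have up := cell_average_upper k m u e0; have lo := cell_average_lower k m u e0.
  rewrite -/D in up lo.
  have hD : D * (S (k + m) u u - S k u u) <= e.
    by apply: le_trans kE; rewrite ler_pM2l// lerD2r.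
  have hx : x m * S k u u <= L.
    apply: ler_pM => //; last exact: harmonic_ratio_le_lim.
    exact: le_trans (harmonic_ratio_ge1 m).
  have hx' : x m * cell_energy_lim u - x m * S k u u <= e.
    apply: (le_trans _ kE); rewrite -mulrBr ler_wpM2r ?subr_ge0//.
    exact: le_trans (harmonic_ratio_le_lim m) kC.
  set q := Q (k + m) u u in a1 a2 *; set A := cell_average _ _ _ in a1 a2 up lo.
  have hx1 : (1 + e) * (x m * S k u u) <= (1 + e) * L by rewrite ler_pM2l// addr_gt0.
  have hA : (1 + e) * A <= (1 + e) * (q + e).
    by rewrite ler_pM2l ?addr_gt0//; move: a2; lra.
  by split; lra.
apply/cvgrPdist_le => eps eps0.
(* For [e <= 1] the two bounds of [main] confine the error to [e * (2 * L + 9)], after the upper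
   bound for [Q n u u] is inserted into the lower one. *)
pose e := Num.min 1 (eps / (2 * L + 9)).
have d0 : 0 < 2 * L + 9 by rewrite ltr_wpDl// mulr_ge0.
have e0 : 0 < e by rewrite lt_min ltr01 divr_gt0.
have e1 : e <= 1 by rewrite ge_min lexx.
have eE : e * (2 * L + 9) <= eps by rewrite -ler_pdivlMr// ge_min lexx orbT.
apply: filterS (main e e0 e1) => n [h1 h2].
have q0 := energy_pre_ge0 N_ge2 p_dist n u.
rewrite ler_norml; apply/andP; split; first by nra.
by nra.
Unshelve. all: by end_near. Qed.

End comparison.

Lemma energy_pre_cvg : exists2 kappa : R, 1 <= kappa & forall u,
  finite_energy p u -> Q m u u @[m --> \oo] --> kappa * cell_energy_lim u.
Proof.
have [x [x0 xi xE]] := harmonic_energy_pre N_ge2 p_dist hb_vertex hb_map.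
exists (limn x); last by move=> u; exact: energy_pre_cvg_ratio.
by rewrite -x0; exact: harmonic_ratio_le_lim.
Qed.

End energy_limit.

Lemma continuous_finite_sum (R : realType) (T : topologicalType) (I : finType)
    (f : I -> T -> R) :
  (forall i, continuous (f i)) -> continuous (fun x => \sum_i f i x).
Proof.
move=> fc x; rewrite /continuous_at /=; elim: (index_enum I) => [|i r IH].
  by under eq_fun do rewrite big_nil; rewrite big_nil; exact: cvg_cst.
under eq_fun do rewrite big_cons; rewrite big_cons.
by apply: cvgD => //; exact: fc.
Qed.

Lemma within_continuousP (R : realType) (n : nat) (V : set 'rV[R]_n)
    (u : 'rV[R]_n -> R) :
  {within V, continuous u} <-> forall x, V x -> forall e : R, 0 < e ->
    \forall y \near x, V y -> `|u x - u y| <= e.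
Proof.
split=> [/subspace_continuousP uc x Vx e e0|uc].
  by have /cvgrPdist_le/(_ e e0) := uc x Vx.
by apply/subspace_continuousP => x Vx; apply/cvgrPdist_le => e; exact: uc.
Qed.

(** * Topology of the gasket *)

Section gasket_topology.
Variables (R : realType) (N : nat) (p : 'I_N -> 'rV[R]_N.-1).
Hypothesis N_ge2 : (2 <= N)%N.
Hypothesis p_dist : forall i j : 'I_N, i != j -> euclid_dist (p i) (p j) = 1.
Variable V : set 'rV[R]_N.-1.
Hypothesis HV : is_gasket p V.

Local Notation F := (gasket_map p).
Local Notation Vm := (gasket_vertices p).
Local Notation bary := (bary p).
Local Notation point := 'rV[R]_N.-1.

Definition cell_map (w : seq 'I_N) (x : point) : point := foldr F x w.

Lemma cell_map_cons i w x : cell_map (i :: w) x = F i (cell_map w x).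
Proof. by []. Qed.

Lemma cell_map_cat w w' x : cell_map (w ++ w') x = cell_map w (cell_map w' x).
Proof. exact: foldr_cat. Qed.

Lemma gasket_mapB i x y : F i x - F i y = 2^-1 *: (x - y).
Proof. by rewrite /gasket_map opprD addrACA subrr addr0 scalerBr. Qed.

Lemma cell_mapB w x y : cell_map w x - cell_map w y = 2 ^- size w *: (x - y).
Proof.
elim: w => [|i w IH]; first by rewrite expr0 invr1 scale1r.
by rewrite !cell_map_cons gasket_mapB IH scalerA [size _]/= exprS invfM.
Qed.

Lemma V_map i x : V x -> V (F i x).
Proof.
by have [_ _ VE] := HV => Vx; rewrite -VE; exists i => //; exists x.
Qed.

Lemma V_mapP x : V x -> exists i y, V y /\ x = F i y.
Proof.
have [_ _ VE] := HV; rewrite -{1}VE => -[i _ [y Vy <-]]; by exists i, y.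
Qed.

Lemma V_cell_map w x : V x -> V (cell_map w x).
Proof. by move=> Vx; elim: w => // i w IH; exact: V_map. Qed.

Lemma V_cellP n x : V x -> exists w y, [/\ size w = n, V y & x = cell_map w y].
Proof.
elim: n x => [|n IH] x Vx; first by exists [::], x.
have [i [y [Vy ->]]] := V_mapP Vx; have [w [z [wn Vz ->]]] := IH _ Vy.
by exists (i :: w), z; rewrite /= wn.
Qed.

Lemma V_closed : closed V.
Proof. by have [_ Vc _] := HV; apply: compact_closed => //; exact: norm_hausdorff. Qed.

Lemma V_bounded : exists2 D, 0 < D & forall x y, V x -> V y -> `|x - y| <= D.
Proof.
have [_ Vc _] := HV; have [M [Mr hM]] := compact_bounded Vc.
exists (2 * (`|M| + 1)) => [|x y Vx Vy]; first by rewrite mulr_gt0.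
have h z : V z -> `|z| <= `|M| + 1.
  by apply: hM; rewrite (le_lt_trans (ler_norm M))// ltrDl.
by rewrite (le_trans (ler_normB _ _))// mulr_natl mulr2n lerD// h.
Qed.

Lemma cvg_pow2V : (2 ^- n : R) @[n --> \oo] --> 0.
Proof.
under eq_fun do rewrite -exprVn.
by apply: cvg_expr; rewrite ger0_norm// invf_lt1// ltr1n.
Qed.

Lemma pow2V_small (e : R) : 0 < e -> exists n : nat, 2 ^- n < e.
Proof.
move=> e0; have := cvg_pow2V => /cvgrPdist_lt/(_ e e0)[n _ /(_ n (leqnn n))].
rewrite sub0r normrN ger0_norm ?invr_ge0 ?exprn_ge0// => h; by exists n.
Qed.

Lemma cell_small (e : R) : 0 < e -> exists n, forall w x y, (n <= size w)%N ->
  V x -> V y -> `|cell_map w x - cell_map w y| < e.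
Proof.
move=> e0; have [D D0 hD] := V_bounded.
have [n nE] := pow2V_small (divr_gt0 e0 D0).
exists n => w x y nw Vx Vy; rewrite cell_mapB normrZ ger0_norm ?invr_ge0 ?exprn_ge0//.
have h := hD x y Vx Vy.
apply: (@le_lt_trans _ _ (2 ^- n * D)); last by rewrite -ltr_pdivlMr.
apply: ler_pM => //.
by rewrite lef_pV2 ?posrE ?exprn_gt0// ler_eXn2l// ltr1n.
Qed.

(** The iterates of [F i] move any point of V towards the fixed point [p i], and V is closed. *)
Lemma V_p i : V (p i).
Proof.
have [[x Vx] _ _] := HV; apply: contrapT => npi.
have [e e0 he] : exists2 e : R, 0 < e & forall y, `|p i - y| < e -> ~ V y.
  have /nbhs_ballP[e /= e0 he] : nbhs (p i) (~` V).
    by apply: open_nbhs_nbhs; split => //; apply: closed_openC; exact: V_closed.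
  by exists e => // y ye; apply: he; rewrite -ball_normE.
have e1 : 0 < e / (`|p i - x| + 1) by rewrite divr_gt0// ltr_wpDl.
have [n nE] := pow2V_small e1.
apply: (he (cell_map (nseq n i) x)); last exact: V_cell_map.
have -> : p i = cell_map (nseq n i) (p i).
  by elim: n {nE} => //= n IH; rewrite -IH gasket_map_fix.
rewrite cell_mapB size_nseq normrZ ger0_norm ?invr_ge0 ?exprn_ge0//.
apply: (@le_lt_trans _ _ (2 ^- n * (`|p i - x| + 1))).
  by rewrite ler_wpM2l ?invr_ge0 ?exprn_ge0// lerDl.
by rewrite -ltr_pdivlMr// ltr_wpDl.
Qed.

Lemma V_vertices m : Vm m `<=` V.
Proof.
elim: m => [x [i _ <-]|m IH x /vertices_mapP[i [y [my ->]]]]; first exact: V_p.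
by apply: V_map; exact: IH.
Qed.

Lemma vertices_cell_map w i : Vm (size w) (cell_map w (p i)).
Proof.
elim: w => [|j w IH]; first exact: vertices_p.
by rewrite cell_map_cons; exact: vertices_map.
Qed.

Let i0 : 'I_N := Ordinal (leq_trans (isT : (0 < 2)%N) N_ge2).

Lemma V_dense x (U : set point) : V x -> nbhs x U -> exists m y, Vm m y /\ U y.
Proof.
move=> Vx /nbhs_ballP[e /= e0 he]; have [n nE] := cell_small e0.
have [w [z [wn Vz xE]]] := V_cellP n Vx.
exists (size w), (cell_map w (p i0)); split; first exact: vertices_cell_map.
apply: he; rewrite -ball_normE /= xE; apply: nE => //; first by rewrite wn.
exact: V_p.
Qed.

Lemma V_closed_ind (A : set point) : closed A -> (forall m, Vm m `<=` A) ->
  V `<=` A.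
Proof.
move=> Ac VA x Vx; apply: Ac => U /(V_dense Vx)[m [y [my Uy]]].
by exists y; split => //; exact: VA my.
Qed.

Lemma gasket_map_continuous i : continuous (F i).
Proof. by move=> x; apply: continuousD; [exact: scaler_continuous|exact: cst_continuous]. Qed.

Lemma cell_map_continuous w : continuous (cell_map w).
Proof.
elim: w => [|i w IH] x; first exact: cvg_id.
exact: (cvg_comp _ _ (IH x) (@gasket_map_continuous i _)).
Qed.

Lemma sqdist_continuous (y : point) : continuous (fun x => sqdist x y).
Proof.
apply: continuous_finite_sum => i x.
apply: (@continuous_comp _ _ _ (fun x : point => x ord0 i - y ord0 i)
  (fun z => z ^+ 2)); last exact: exprn_continuous.
by apply: continuousB; [exact: coord_continuous|exact: cst_continuous].
Qed.

Lemma bary_continuous k : continuous (bary k).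
Proof.
have h : continuous (fun x => 1 + \sum_j (sqdist x (p j) - sqdist x (p k))).
  move=> x; apply: continuousD; first exact: cst_continuous.
  apply: (@continuous_finite_sum _ _ _ (fun j x => sqdist x (p j) - sqdist x (p k))).
  by move=> j y; exact: (continuousB (@sqdist_continuous _ y) (@sqdist_continuous _ y)).
by move=> x; exact: (continuousM (@cst_continuous _ _ _ _) (h x)).
Qed.

Lemma V_bary_ge0 k x : V x -> 0 <= bary k x.
Proof.
apply: (@V_closed_ind [set x | 0 <= bary k x]) => [|m y my].
  apply: (@preimage_closed _ _ (bary k) [set x | 0 <= x]); last exact: closed_ge.
  by move=> z _; exact: bary_continuous.
exact: vertices_bary_ge0 my.
Qed.

Lemma V_hull x : V x -> hull p x.
Proof.
apply: (@V_closed_ind [set x | hull p x]) => [|m y my]; last exact: vertices_hull my.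
rewrite (_ : [set x | hull p x] =
    \bigcap_(i : 'I_N.-1) [set x : point | x ord0 i - \sum_k bary k x * p k ord0 i = 0]).
  apply: closed_bigI => i _.
  apply: (@preimage_closed _ _ (fun x : point =>
    x ord0 i - \sum_k bary k x * p k ord0 i) [set z | z = 0]); last exact: closed_eq.
  move=> z _; apply: continuousB; first exact: coord_continuous.
  apply: (@continuous_finite_sum _ _ _ (fun k (x : point) => bary k x * p k ord0 i)).
  by move=> k y; exact: (continuousM (@bary_continuous k y) (@cst_continuous _ _ _ _)).
apply/seteqP; split => y.
  move=> hy i _ /=; apply/eqP; rewrite subr_eq0; apply/eqP.
  rewrite {1}[y](hy : y = _) summxE.
  by apply: eq_bigr => k _; rewrite !mxE.
move=> hy; apply/rowP => i; have /eqP := hy i I; rewrite subr_eq0 => /eqP ->.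
by rewrite summxE; apply: eq_bigr => k _; rewrite !mxE.
Qed.

(** The common point has coordinates [i] and [j] at least 1/2, hence equal to 1/2 with all others 0;
    undoing [F i] leaves the vertex [p j]. *)
Lemma V_junction i j x y : i != j -> V x -> V y -> F i x = F j y ->
  x = p j /\ y = p i.
Proof.
move=> ij Vx Vy xy.
have b := bary_two_halves N_ge2 ij (fun k => V_bary_ge0 k (V_map i Vx)).
have h z k : V z -> 2^-1 <= bary k (F k z).
  by move=> Vz; have := V_bary_ge0 k Vz; rewrite bary_map// eqxx /= => ?; lra.
have {}b := b (h _ i Vx); rewrite {1}xy in b; have {}b := b (h _ j Vy).
have bE k : bary k x = (k == j)%:R.
  by have := b k; rewrite bary_map//; lra.
have xj : x = p j.
  apply: (@hull_inj _ _ p); [exact: V_hull|exact: hull_vertex|].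
  by move=> k; rewrite bE bary_vertex.
split => //; apply/esym/(@gasket_map_inj _ _ p j).
by rewrite -xy xj gasket_map_swap.
Qed.

Lemma V_map_p i j y : V y -> p i = F j y -> i = j /\ y = p i.
Proof.
move=> Vy py; have ij : i = j.
  apply/eqP; apply: contraT => ij.
  have := V_bary_ge0 j Vy; have := congr1 (bary j) py.
  by rewrite bary_map// bary_vertex// eqxx eq_sym (negPf ij) /=; lra.
split => //; move: py; rewrite -{1}(gasket_map_fix p i) ij => /gasket_map_inj ->.
by [].
Qed.

(** Close to [x] only cells containing [x] are met, because the others are compact and miss [x].
    Inside such a cell the dilation [y |-> 2 y - p i] undoes [F i] and lowers the level. The word
    depends on [y], since [x] may be a junction point. *)
Lemma V_common_cell n x : V x -> \forall y \near x, V y ->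
  exists w x' y', [/\ size w = n, V x', V y', x = cell_map w x' & y = cell_map w y'].
Proof.
elim: n x => [|n IH] x Vx.
  by apply: (@nearW _ (nbhs x)) => y Vy; exists [::], x, y.
suff H i : \forall y \near x, forall y', V y' -> y = F i y' -> exists w x' y'',
    [/\ size w = n.+1, V x', V y'', x = cell_map w x' & y = cell_map w y''].
  apply: (@filterS _ (nbhs x)) (@filter_forall _ _ _ (nbhs x) _ H) => y h Vy.
  by have [i [y' [Vy' yE]]] := V_mapP Vy; exact: h yE.
have [[x' Vx' xE]|nx] := pselect (exists2 x', V x' & x = F i x').
  have inv : continuous (fun y : point => 2 *: y - p i).
    by move=> y; apply: continuousB; [exact: scaler_continuous|exact: cst_continuous].
  have invF z : 2 *: F i z - p i = z.
    rewrite /gasket_map scalerDr !scalerA divff ?pnatr_eq0// !scale1r addrK//.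
  have := inv x (fun y => V y -> exists w x'' y', [/\ size w = n, V x'', V y',
    x' = cell_map w x'' & y = cell_map w y']).
  rewrite {1}xE invF => /(_ (IH _ Vx')); apply: (@filterS _ (nbhs x)) => y /= h y' Vy' yE.
  move: h; rewrite yE invF => /(_ Vy')[w [x'' [y'' [wn Vx'' Vy'' x'E y'E]]]].
  by exists (i :: w), x'', y''; rewrite /= wn -!/(cell_map _ _) -x'E -y'E.
have : nbhs x (~` (F i @` V)).
  apply: open_nbhs_nbhs; split; last first.
    by move=> [x' Vx' xE]; apply: nx; exists x'.
  apply: closed_openC; apply: compact_closed; first exact: norm_hausdorff.
  apply: continuous_compact; last by case: HV.
  exact/continuous_subspaceT/gasket_map_continuous.
by apply: (@filterS _ (nbhs x)) => y h y' Vy' yE; exfalso; apply: h; exists y'.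
Qed.

Lemma continuous_of_oscillation (u : point -> R) :
  (forall e : R, 0 < e -> exists n, forall w x y, size w = n -> V x -> V y ->
     `|u (cell_map w x) - u (cell_map w y)| <= e) ->
  {within V, continuous u}.
Proof.
move=> osc; apply/within_continuousP => x Vx e e0.
have [n hn] := osc e e0.
apply: (@filterS _ (nbhs x)) (V_common_cell n Vx) => y h Vy.
by have [w [x' [y' [wn Vx' Vy' -> ->]]]] := h Vy; exact: hn.
Qed.

Lemma V_le_of_vertices (u : point -> R) (K : R) : {within V, continuous u} ->
  (forall m x, Vm m x -> u x <= K) -> forall x, V x -> u x <= K.
Proof.
move=> /within_continuousP uc uK x Vx; apply/ler_addgt0Pl => e e0.
have [m [y [my /(_ (V_vertices my))]]] := V_dense Vx (uc x Vx e e0).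
by rewrite ler_norml => /andP[_]; have := uK m y my; lra.
Qed.

End gasket_topology.

(** * Harmonic functions and the energy space *)

Section harmonic_extension.
Variables (R : realType) (N : nat) (p : 'I_N -> 'rV[R]_N.-1).
Hypothesis N_ge2 : (2 <= N)%N.
Hypothesis p_dist : forall i j : 'I_N, i != j -> euclid_dist (p i) (p j) = 1.
Variable V : set 'rV[R]_N.-1.
Hypothesis HV : is_gasket p V.

Local Notation F := (gasket_map p).
Local Notation point := 'rV[R]_N.-1.
Implicit Types b : 'I_N -> R.

Let i0 : 'I_N := Ordinal (leq_trans (isT : (0 < 2)%N) N_ge2).

(** A junction point has two admissible indices, of which [cid] picks one; [harmonic_approx_map]
    shows that the values obtained do not depend on the pick. Off V the index is [i0]. *)
Let address (x : point) : 'I_N :=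
  if pselect (exists i, exists2 y, V y & x = F i y) is left e then projT1 (cid e)
  else i0.

Let unmap (x : point) : point := 2 *: x - p (address x).

Lemma V_address x : V x -> V (unmap x) /\ F (address x) (unmap x) = x.
Proof.
move=> Vx; rewrite /unmap /address; case: pselect => [e|]; last first.
  by have [i [y [Vy yE]]] := V_mapP HV Vx; case; exists i, y.
case: cid => i /= [y Vy xE]; suff -> : 2 *: x - p i = y by [].
by rewrite xE /gasket_map scalerDr !scalerA divff ?pnatr_eq0// !scale1r addrK.
Qed.

(** After [n] refinements the value is exact at a vertex of the current cell; elsewhere [b i0]
    stands in for it, a value within the range of the boundary data, which shrinks with [n]. *)
Fixpoint harmonic_approx n b (x : point) : R :=
  if n is n'.+1 then harmonic_approx n' (harmonic_step (address x) b) (unmap x)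
  else b (odflt i0 [pick i | x == p i]).

Lemma harmonic_approx_vertex n b i : harmonic_approx n b (p i) = b i.
Proof.
elim: n b i => [|n IH] b i /=.
  case: pickP => [j /eqP ij|/(_ i)]; last by rewrite eqxx.
  congr b; apply/eqP; apply: contraT => ji.
  by have := congr1 (bary p i) ij; rewrite !bary_vertex// eqxx eq_sym (negPf ji)
    => /eqP; rewrite oner_eq0.
have [Vy yE] := V_address (V_p HV i).
have [ii yi] := V_map_p N_ge2 p_dist HV Vy (esym yE).
by rewrite yi IH -ii /harmonic_step eqxx.
Qed.

Lemma harmonic_step_sym (i j : 'I_N) b : harmonic_step i b j = harmonic_step j b i.
Proof.
by rewrite /harmonic_step eq_sym; case: eqP => [->//|_]; rewrite (addrC (b i)).
Qed.

(** If [address] returns another cell than [i], the point is a junction, both preimages are vertices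
    where the approximation is exact, and the two values agree by symmetry of [harmonic_step]. *)
Lemma harmonic_approx_map n b i x : V x ->
  harmonic_approx n.+1 b (F i x) = harmonic_approx n (harmonic_step i b) x.
Proof.
move=> Vx /=; have [Vy yE] := V_address (V_map HV i Vx).
have [ij|ij] := eqVneq i (address (F i x)).
  have uE : unmap (F i x) = x.
    by apply: (@gasket_map_inj _ _ p i); rewrite {1}ij yE.
  by rewrite uE -ij.
have [xE uE] := V_junction N_ge2 p_dist HV ij Vx Vy (esym yE).
move: uE xE; set j := address _ => uE xE.
by rewrite uE xE !harmonic_approx_vertex harmonic_step_sym.
Qed.

Let theta : R := N%:R / (N%:R + 2).

Let theta_ge0 : 0 <= theta.
Proof. by rewrite divr_ge0// addr_ge0. Qed.

Let theta_lt1 : `|theta| < 1.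
Proof.
have n2 : 0 < N%:R + 2 :> R by rewrite ltr_wpDl.
by rewrite ger0_norm// ltr_pdivrMr// mul1r ltrDl.
Qed.

(** For [j != i] the new value is a convex combination that gives [b i] the weight [2 / (N + 2)], so
    the interval is pulled towards [b i] by that weight and shrinks by [theta]. *)
Lemma harmonic_step_hull i b (lo hi : R) : (forall k, lo <= b k <= hi) ->
  exists lo' hi', [/\ lo <= lo', hi' <= hi, hi' - lo' = theta * (hi - lo) &
    forall k, lo' <= harmonic_step i b k <= hi'].
Proof.
move=> bE; have n_ge0 : 0 <= N%:R :> R by [].
have n2 : 0 < N%:R + 2 :> R by rewrite ltr_wpDl.
have /andP[b1 b2] := bE i.
have lE (c : R) : (2 * b i + N%:R * c) / (N%:R + 2) - c = 2 * (b i - c) / (N%:R + 2).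
  by field; rewrite gt_eqF.
exists ((2 * b i + N%:R * lo) / (N%:R + 2)), ((2 * b i + N%:R * hi) / (N%:R + 2)).
split.
- by rewrite -subr_ge0 lE divr_ge0 ?mulr_ge0 ?subr_ge0// ltW.
- by rewrite -subr_le0 lE pmulr_lle0 ?invr_gt0// pmulr_rle0// subr_le0.
- by rewrite /theta; field; rewrite gt_eqF.
move=> k; rewrite /harmonic_step; case: eqP => [_|/eqP ki].
  have h1 := ler_wpM2l n_ge0 b1; have h2 := ler_wpM2l n_ge0 b2.
  by rewrite ler_pdivrMr// ler_pdivlMr//; apply/andP; split; lra.
rewrite !ler_pM2r ?invr_gt0//.
have N1 : N%:R = 1 + 1 + (N - 2)%:R :> R.
  by rewrite natrB// -[2%:R]/(1 + 1); ring.
have sE : \sum_j b j = b i + (b k + \sum_(j | (j != i) && (j != k)) b j).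
  by rewrite (bigD1 i)//= (bigD1 k).
have cst c : \sum_(j | (j != i) && (j != k)) c = (N - 2)%:R * c :> R.
  rewrite sumr_const mulr_natl; congr (_ *+ _).
  rewrite (eq_card (B := ~: [set i; k]%SET)).
    by rewrite cardsCs finset.setCK card_ord cards2 eq_sym ki.
  by move=> j; rewrite !inE negb_or.
have /andP[k1 k2] := bE k.
have h1 : (N - 2)%:R * lo <= \sum_(j | (j != i) && (j != k)) b j.
  by rewrite -cst; apply: ler_sum => j _; case/andP: (bE j).
have h2 : \sum_(j | (j != i) && (j != k)) b j <= (N - 2)%:R * hi.
  by rewrite -cst; apply: ler_sum => j _; case/andP: (bE j).
by rewrite sE N1 !mulrDl !mul1r; lra.
Qed.

Lemma harmonic_approx_hull n b (lo hi : R) x : V x ->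
  (forall k, lo <= b k <= hi) ->
  exists lo' hi', [/\ lo <= lo', hi' <= hi, hi' - lo' = theta ^+ n * (hi - lo) &
    forall m, (n <= m)%N -> lo' <= harmonic_approx m b x <= hi'].
Proof.
elim: n b lo hi x => [|n IH] b lo hi x Vx bE.
  exists lo, hi; split; rewrite ?expr0 ?mul1r// => m _.
  elim: m b x bE Vx => [|m IH] b x bE Vx; first exact: bE.
  have [lo' [hi' [l1 h1 _ h2]]] := harmonic_step_hull (address x) bE.
  apply: IH; last by case: (V_address Vx).
  by move=> k; have /andP[? ?] := h2 k; apply/andP; split; lra.
have [lo' [hi' [l1 h1 e1 h2]]] := harmonic_step_hull (address x) bE.
have [lo2 [hi2 [l3 h3 e3 h4]]] := IH _ _ _ _ (V_address Vx).1 h2.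
exists lo2, hi2; split; [lra|lra|by rewrite e3 e1 exprSr mulrA|].
by case=> // m nm; exact: h4.
Qed.

Lemma boundary_bounds b : exists lo hi, forall k, lo <= b k <= hi.
Proof.
exists (- \sum_k `|b k|), (\sum_k `|b k|) => k; rewrite -ler_norml.
by rewrite (bigD1 k)//= lerDl sumr_ge0.
Qed.

Lemma theta_small (c e : R) : 0 < e -> exists n, theta ^+ n * c <= e.
Proof.
move=> e0; have /cvgrPdist_le/(_ e e0)[n _ /(_ n (leqnn n))] :
    theta ^+ n * c @[n --> \oo] --> 0.
  by rewrite -[X in _ --> X](mul0r c); apply: cvgMr_tmp; exact: cvg_expr.
by rewrite sub0r normrN => h; exists n; exact: le_trans (ler_norm _) h.
Qed.

Definition harmonic b (x : point) : R := limn (fun n => harmonic_approx n b x).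

Lemma harmonic_approx_cvg b x : V x ->
  harmonic_approx n b x @[n --> \oo] --> harmonic b x.
Proof.
move=> Vx; apply/cauchy_cvgP/cauchy_exP => e e0.
have [lo [hi bE]] := boundary_bounds b.
have e2 : 0 < e / 2 by rewrite divr_gt0.
have [n hn] := theta_small (hi - lo) e2.
have [lo' [hi' [_ _ e1 h]]] := harmonic_approx_hull n Vx bE.
exists lo', n => // m nm; have /andP[h1 h2] := h m nm.
rewrite /= -ball_normE /= ltr_norml; move: hn; rewrite -e1; lra.
Qed.

Lemma harmonic_vertex b i : harmonic b (p i) = b i.
Proof.
rewrite /harmonic (_ : (fun _ => _) = fun=> b i); first exact: lim_cst.
by apply/funext => n; exact: harmonic_approx_vertex.
Qed.

Lemma harmonic_map b i x : V x -> harmonic b (F i x) = harmonic (harmonic_step i b) x.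
Proof.
move=> Vx; apply/esym/cvg_lim; first exact: Rhausdorff.
have := @harmonic_approx_cvg b _ (V_map HV i Vx); rewrite -cvg_shiftS.
by under eq_fun do rewrite harmonic_approx_map//.
Qed.

Lemma harmonic_bounds b (lo hi : R) x : V x -> (forall k, lo <= b k <= hi) ->
  lo <= harmonic b x <= hi.
Proof.
move=> Vx bE; have [lo' [hi' [l1 h1 _ h]]] := harmonic_approx_hull 0 Vx bE.
have hc := @harmonic_approx_cvg b _ Vx.
apply/andP; split.
  apply: (cvgr_to_ge hc); apply: nearW => m.
  by have /andP[? _] := h m (leq0n m); lra.
apply: (cvgr_to_le hc); apply: nearW => m.
by have /andP[_ ?] := h m (leq0n m); lra.
Qed.

Lemma harmonic_oscillation b (lo hi : R) w x y : V x -> V y ->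
  (forall k, lo <= b k <= hi) ->
  `|harmonic b (cell_map p w x) - harmonic b (cell_map p w y)| <=
  theta ^+ size w * (hi - lo).
Proof.
move=> Vx Vy; elim: w b lo hi => [|i w IH] b lo hi bE.
  have /andP[? ?] := harmonic_bounds Vx bE; have /andP[? ?] := harmonic_bounds Vy bE.
  by rewrite expr0 mul1r ler_norml /=; lra.
rewrite !cell_map_cons !harmonic_map; try exact: (V_cell_map HV).
have [lo' [hi' [_ _ e1 h2]]] := harmonic_step_hull i bE.
by rewrite [size _]/= exprSr -mulrA -e1; exact: IH.
Qed.

Lemma harmonic_continuous b : {within V, continuous (harmonic b)}.
Proof.
apply: (continuous_of_oscillation HV) => e e0.
have [lo [hi bE]] := boundary_bounds b.
have [n hn] := theta_small (hi - lo) e0.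
exists n => w x y wn Vx Vy; apply: le_trans (harmonic_oscillation w Vx Vy bE) _.
by rewrite wn.
Qed.

End harmonic_extension.

(** Tychonoff's theorem in the topology of pointwise convergence. A cluster point, rather than a
    convergent subsequence, is enough because only finitely many points are used at a time. *)
Lemma pointwise_cluster (R : realType) (T : choiceType) (M : R) (U : nat -> T -> R) :
  (forall n x, `|U n x| <= M) ->
  exists u : T -> R, forall (I : finType) (y : I -> T) (e : R) n0, 0 < e ->
    exists2 n, (n0 <= n)%N & forall i, `|U n (y i) - u (y i)| <= e.
Proof.
move=> UM; pose A (x : T) : set R := [set` `[- M, M]].
have Ac : forall x, compact (A x) by move=> x; exact: segment_compact.
pose G : set_system (ArrowAsProduct.prod__canonical__topology_structure_Topological
  (fun _ : T => R)) := U @ \oo.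
have [|u [_ uG]] := tychonoff Ac (F := G) _.
  by exists 0%N => // n _ x; rewrite /A /= in_itv/= -ler_norml.
exists u => I y e n0 e0.
have nbh i : \forall f \near (u : ArrowAsProduct.prod__canonical__topology_structure_Topological
  (fun _ : T => R)), `|f (y i) - u (y i)| <= e.
  have := @proj_continuous T (fun=> R) (y i) u [set z | `|z - u (y i)| <= e].
  apply; apply/nbhs_ballP; exists e => // z; rewrite -ball_normE /= distrC.
  exact: ltW.
have Gn : G [set f | exists2 n, (n0 <= n)%N & f = U n].
  by exists n0 => // n nn0; exists n.
have [f [[n nn0 ->] h]] := uG _ _ Gn (@filter_forall _ _ _ (nbhs u) _ nbh).
by exists n.
Qed.

Section energy_space.
Variables (R : realType) (N : nat) (p : 'I_N -> 'rV[R]_N.-1).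
Hypothesis N_ge2 : (2 <= N)%N.
Hypothesis p_dist : forall i j : 'I_N, i != j -> euclid_dist (p i) (p j) = 1.
Variable V : set 'rV[R]_N.-1.
Hypothesis HV : is_gasket p V.

Local Notation F := (gasket_map p).
Local Notation Vm := (gasket_vertices p).
Local Notation point := 'rV[R]_N.-1.
Local Notation S := (cell_energy p).
Local Notation Q := (energy_pre p).
Local Notation rho := (renorm R N).
Implicit Types u v w : point -> R.

Let i0 : 'I_N := Ordinal (leq_trans (isT : (0 < 2)%N) N_ge2).
Let hb := harmonic p N_ge2 V.
Let hbV : forall b j, hb b (p j) = b j := harmonic_vertex N_ge2 p_dist HV.
Let hbM b i m x (mx : Vm m x) : hb b (F i x) = hb (harmonic_step i b) x :=
  harmonic_map N_ge2 p_dist HV b i (V_vertices HV mx).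
Let n_gt0 : 0 < N%:R :> R := natN_gt0 R N_ge2.
Let rho_gt0 : 0 < rho := renorm_gt0 R N_ge2.

Lemma finite_energyD u v c : finite_energy p u -> finite_energy p v ->
  finite_energy p (fun x => u x + c * v x).
Proof.
move=> [M uM] [M' vM]; exists (2 * M + 2 * (c ^+ 2 * M')) => m.
apply: (le_trans (bilinear_young (cell_energy_bilinear p N_ge2 m) u v c ltr01)).
by rewrite invr1 lerD// ler_pM2l// ler_wpM2l ?sqr_ge0.
Qed.

Lemma energy_cvg : exists2 kappa : R, 1 <= kappa & forall u,
  finite_energy p u ->
  [/\ energy p u = (kappa * cell_energy_lim p u)%:E,
      Q m u u @[m --> \oo] --> fine (energy p u) &
      forall m, kappa * S m u u <= fine (energy p u)].
Proof.
have [kappa k1 hk] := energy_pre_cvg N_ge2 p_dist hbV hbM.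
exists kappa => // u fu.
have E : energy p u = (kappa * cell_energy_lim p u)%:E.
  apply: cvg_lim; first exact: ereal_hausdorff.
  by apply: cvg_EFin; [exact: nearW|exact: hk].
split => //; rewrite E //=; first exact: hk.
move=> m; rewrite ler_pM2l; last exact: lt_le_trans k1.
exact: (cell_energy_le_lim N_ge2 hbV hbM).
Qed.

(** If the cell energies are unbounded, they increase to infinity and the energies of the statement
    dominate them, so the extended limit is [+oo]. *)
Lemma finite_energyP u : (energy p u < +oo)%E <-> finite_energy p u.
Proof.
have [kappa k1 hk] := energy_cvg; split; last first.
  by move=> /hk[-> _ _]; rewrite ltry.
move=> Eoo; apply: contrapT => nf; move: Eoo.
suff -> : energy p u = +oo%E by rewrite ltxx.
apply: cvg_lim; first exact: ereal_hausdorff.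
apply/cvgeryP/cvgryPge => A.
have [m mA] : exists m, A < S m u u.
  apply: contrapT => h; apply: nf; exists A => m.
  by rewrite leNgt; apply/negP => mA; apply: h; exists m.
exists m => // k /= mk; apply: (le_trans (ltW mA)).
apply: (le_trans (cell_energy_le N_ge2 hbV hbM u mk)).
exact: energy_pre_ge.
Qed.

Lemma energy_fine_ge0 u : finite_energy p u -> 0 <= fine (energy p u).
Proof.
move=> fu; have [k k1 hk] := energy_cvg; have [_ _ h] := hk _ fu.
apply: le_trans (h 0%N); rewrite mulr_ge0 ?cell_energy_ge0//.
exact: le_trans k1.
Qed.

(** [energy_form] is a bare limit. The expansion with [c = 1] expresses [Q m u v] through three
    convergent diagonal energies, so this limit exists, and the expansion for any [c] then passes to
    the limit. *)
Lemma energy_expand u v c : finite_energy p u -> finite_energy p v ->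
  fine (energy p (fun x => u x + c * v x)) =
  fine (energy p u) + 2 * c * energy_form p u v + c ^+ 2 * fine (energy p v).
Proof.
move=> fu fv; have [k _ hk] := energy_cvg.
have QE m (d : R) := bilinear_sqrD (energy_pre_bilinear N_ge2 p_dist m) u v d.
have [_ cu _] := hk _ fu; have [_ cv _] := hk _ fv.
have [_ cuv _] := hk _ (finite_energyD 1 fu fv).
have cB : Q m u v @[m --> \oo] --> energy_form p u v.
  have h : Q m u v @[m --> \oo] --> 2^-1 * (fine (energy p (fun x => u x + 1 * v x))
      - fine (energy p u) - fine (energy p v)).
    rewrite (_ : (fun m => Q m u v) = (fun m => 2^-1 *
        (Q m (fun x => u x + 1 * v x) (fun x => u x + 1 * v x) - Q m u u - Q m v v))).
      by apply: cvgMl_tmp; apply: cvgB => //; apply: cvgB.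
    by apply/funext => m; rewrite QE; field.
  by rewrite /energy_form (cvg_lim (@Rhausdorff R) h).
have [_ cc _] := hk _ (finite_energyD c fu fv).
apply: (cvg_unique (@Rhausdorff R) cc).
rewrite (_ : (fun m => _) = (fun m => Q m u u + 2 * c * Q m u v + c ^+ 2 * Q m v v)).
  by apply: cvgD; [apply: cvgD => //|]; apply: cvgMl_tmp.
by apply/funext => m; rewrite QE.
Qed.

Lemma energy_vertex_oscillation u x : {within V, continuous u} ->
  finite_energy p u -> V x -> forall i,
  `|u x - u (p i)| <= (N%:R + 2) * H01_norm p u.
Proof.
move=> uc fu Vx i; have [k k1 hk] := energy_cvg; have [_ _ h] := hk _ fu.
have K0 : 0 <= (N%:R + 2) * H01_norm p u.
  by rewrite mulr_ge0 ?sqrtr_ge0// addr_ge0.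
have vert m y : Vm m y -> `|u y - u (p i)| <= (N%:R + 2) * H01_norm p u.
  move=> my; rewrite -(ler_pXn2r (isT : (0 < 2)%N)) ?nnegrE// real_normK ?num_real//.
  apply: (le_trans (vertex_oscillation N_ge2 hbV hbM u i my)).
  rewrite exprMn sqr_sqrtr ?energy_fine_ge0// ler_wpM2l ?sqr_ge0//.
  apply: le_trans (h m); rewrite ler_peMl// cell_energy_ge0//.
rewrite ler_norml; apply/andP; split.
- have uNc : {within V, continuous (fun y => - u y)}.
    apply/within_continuousP => y Vy e e0; move/within_continuousP : uc.
    move=> /(_ y Vy e e0); apply: (@filterS _ (nbhs y)) => z hz Vz.
    by rewrite -opprD normrN; exact: hz.
  suff : - u x <= (N%:R + 2) * H01_norm p u - u (p i) by lra.
  apply: (V_le_of_vertices N_ge2 HV uNc _ Vx) => m y my.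
  by have := vert m y my; rewrite ler_norml; lra.
- rewrite lerBlDr.
  apply: (V_le_of_vertices N_ge2 HV uc _ Vx) => m y my.
  by have := vert m y my; rewrite ler_norml; lra.
Qed.

Lemma H01_finite u : H01 p V u -> finite_energy p u.
Proof. by move=> [_ _ /finite_energyP]. Qed.

(** The oscillation from [p i0], where [u] vanishes, gives the factor [N + 2], which is below
    [2 * N + 3]. *)
Lemma H01_sup u x : H01 p V u -> V x ->
  `|u x| <= (2 * N%:R + 3) * H01_norm p u.
Proof.
move=> Hu Vx; have [uc u0 _] := Hu.
have := energy_vertex_oscillation uc (H01_finite Hu) Vx i0; rewrite u0 subr0.
move=> /le_trans; apply; rewrite ler_wpM2r ?sqrtr_ge0//; move: n_gt0; lra.
Qed.

Lemma H01D u v c : H01 p V u -> H01 p V v -> H01 p V (fun x => u x + c * v x).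
Proof.
move=> Hu Hv; have [uc u0 _] := Hu; have [vc v0 _] := Hv; split.
- apply/within_continuousP => x Vx e e0.
  have d0 : 0 < e / (1 + `|c|) by rewrite divr_gt0// ltr_wpDr.
  move/within_continuousP : uc => /(_ x Vx _ d0) h1.
  move/within_continuousP : vc => /(_ x Vx _ d0) h2.
  apply: (@filterS2 _ (nbhs x) _ _ _ _ _ h1 h2) => y {}h1 {}h2 Vy.
  have -> : u x + c * v x - (u y + c * v y) = (u x - u y) + c * (v x - v y) by ring.
  apply: (le_trans (ler_normD _ _)); rewrite normrM.
  apply: (@le_trans _ _ (e / (1 + `|c|) + `|c| * (e / (1 + `|c|)))).
    by apply: lerD; [exact: h1|rewrite ler_wpM2l//; exact: h2].
  by rewrite -[X in X + _]mul1r -mulrDl mulrC divfK// gt_eqF// ltr_wpDr.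
- by move=> i; rewrite u0 v0 mulr0 addr0.
- by apply/finite_energyP; apply: finite_energyD; exact: H01_finite.
Qed.

Lemma cell_energy_sup m : exists2 K : R, 0 <= K & forall u (e : R), 0 <= e ->
  (forall x, Vm m x -> `|u x| <= e) -> S m u u <= K * e ^+ 2.
Proof.
elim: m => [|m [K K0 IH]].
  exists (4 * (N%:R * N%:R)) => [|u e e0 ue]; first by rewrite !mulr_ge0.
  rewrite /= /vertex_energy.
  rewrite (_ : 4 * _ * _ = \sum_(i < N) \sum_(j < N) 4 * e ^+ 2); last first.
    by rewrite !sumr_const !card_ord -mulrnA -[RHS]mulr_natr natrM; ring.
  apply: ler_sum => i _; apply: ler_sum => j _ /=; rewrite -expr2.
  have vi k : `|u (p k)| <= e by apply: ue; exists k.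
  have := vi i; have := vi j; rewrite !ler_norml => /andP[? ?] /andP[? ?].
  rewrite -subr_ge0 (_ : _ - _ =
    (2 * e - (u (p i) - u (p j))) * (2 * e + (u (p i) - u (p j)))); last by ring.
  by rewrite mulr_ge0//; lra.
exists (rho * N%:R * K) => [|u e e0 ue]; first by rewrite !mulr_ge0// ltW.
rewrite /= -2!mulrA ler_pM2l//.
rewrite (_ : N%:R * _ = \sum_(i < N) K * e ^+ 2); last first.
  by rewrite sumr_const card_ord mulr_natl.
apply: ler_sum => i _; apply: IH => // x mx; apply: ue; exact: vertices_map.
Qed.

(** Closedness of the space and lower semicontinuity of the energy at once. At a fixed level [m] the
    cell energy is a finite sum, continuous under uniform convergence; the level is sent to infinity
    afterwards. *)
Lemma H01_uniform_limit u (c : R) :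
  (forall e : R, 0 < e -> exists v, [/\ H01 p V v,
     forall x, V x -> `|v x - u x| <= e & fine (energy p v) <= c + e]) ->
  H01 p V u /\ fine (energy p u) <= c.
Proof.
move=> uv; have [k k1 hk] := energy_cvg.
have k0 : 0 < k by exact: lt_le_trans k1.
have c0 : 0 <= c.
  apply/ler_addgt0Pr => e /uv[v [Hv _]]; apply: le_trans.
  exact/energy_fine_ge0/H01_finite.
have uc : {within V, continuous u}.
  apply/within_continuousP => x Vx e e0.
  have e3 : 0 < e / 3 by rewrite divr_gt0.
  have [v [[vc _ _] vu _]] := uv _ e3.
  move/within_continuousP : vc => /(_ x Vx _ e3).
  apply: (@filterS _ (nbhs x)) => y h Vy; have := h Vy.
  have := vu x Vx; have := vu y Vy; rewrite !ler_norml.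
  by move=> /andP[? ?] /andP[? ?] /andP[? ?]; apply/andP; split; lra.
have u0 i : u (p i) = 0.
  apply/eqP; rewrite -normr_le0; apply/ler_addgt0Pr => e /uv[v [[_ v0 _] vu _]].
  by have := vu _ (V_p HV i); rewrite v0 sub0r normrN add0r.
have Su m : k * S m u u <= c.
  have [K K0 hK] := cell_energy_sup m.
  apply/ler_addgt0Pr => d d0.
  pose D := 2 + c + 2 * (k * K).
  have D0 : 0 < D by rewrite ltr_wpDr ?ltr_wpDr// !mulr_ge0// ltW.
  pose e := Num.min 1 (d / D).
  have e0 : 0 < e by rewrite lt_min ltr01 divr_gt0.
  have e1 : e <= 1 by rewrite ge_min lexx.
  have eD : e * D <= d by rewrite -ler_pdivlMr// ge_min lexx orbT.
  (* Uniform distance [e ^+ 2] makes the energy of the difference of order [e ^+ 4], which beats the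
     Young factor [1 + e^-1]. The constant [D] collects the resulting multiples of [e]. *)
  have [v [Hv vu vE]] := uv _ (exprn_gt0 2 e0).
  have [_ _ hv] := hk _ (H01_finite Hv).
  have y := bilinear_young (cell_energy_bilinear p N_ge2 m) v
    (fun x => v x - u x) (-1) e0.
  have {}y : S m u u <= (1 + e) * S m v v + (1 + e^-1) * (K * (e ^+ 2) ^+ 2).
    apply: le_trans (_ : S m _ _ <= _) (le_trans y _).
      rewrite le_eqVlt; apply/orP; left; apply/eqP.
      by apply: cell_energy_ext => x _; ring.
    have e10 : 0 <= 1 + e^-1 by rewrite addr_ge0 ?invr_ge0 ?ltW.
    rewrite lerD2l sqrrN expr1n mul1r ler_wpM2l//.
    apply: hK => [|x mx]; first exact: sqr_ge0.
    by apply: vu; exact: (V_vertices HV mx).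
  have {}y := ler_wpM2l (ltW k0) y; apply: (le_trans y).
  have h1 : k * S m v v <= c + e ^+ 2 by apply: le_trans (hv m) vE.
  have h2 : (1 + e) * (k * S m v v) <= (1 + e) * (c + e ^+ 2).
    by rewrite ler_pM2l// addr_gt0.
  rewrite mulrDr (mulrCA k (1 + e)).
  have -> : k * ((1 + e^-1) * (K * (e ^+ 2) ^+ 2)) = k * K * (e ^+ 4 + e ^+ 3).
    by field; rewrite gt_eqF.
  have e2 : e ^+ 2 <= e by rewrite expr2 ler_piMr// ltW.
  have e3 : e ^+ 3 <= e by rewrite exprS (le_trans _ e2)// expr2 ler_wpM2l// ltW.
  have e4 : e ^+ 4 <= e by rewrite exprS (le_trans _ e2)// expr2 ler_wpM2l// ltW.
  have kK0 : 0 <= k * K by rewrite mulr_ge0// ltW.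
  have h3 : k * K * (e ^+ 4 + e ^+ 3) <= k * K * (e + e) by rewrite ler_wpM2l// lerD.
  have h4 : e * e ^+ 2 <= e by rewrite -exprS.
  apply: (le_trans (lerD h2 h3)).
  move: eD; rewrite /D; lra.
have fu : finite_energy p u.
  by exists (k^-1 * c) => m; rewrite ler_pdivlMl.
have [_ _ hu] := hk _ fu; split; first by split => //; exact/finite_energyP.
have [-> cu _] := hk _ fu => /=.
rewrite -ler_pdivlMl//; apply: (cvgr_to_le (cell_energy_cvg N_ge2 hbV hbM fu)).
by apply: nearW => m; rewrite ler_pdivlMl.
Qed.

End energy_space.

(** * Compactness of energy balls and a bump function *)

Section energy_compactness.
Variables (R : realType) (N : nat) (p : 'I_N -> 'rV[R]_N.-1).
Hypothesis N_ge2 : (2 <= N)%N.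
Hypothesis p_dist : forall i j : 'I_N, i != j -> euclid_dist (p i) (p j) = 1.
Variable V : set 'rV[R]_N.-1.
Hypothesis HV : is_gasket p V.

Local Notation F := (gasket_map p).
Local Notation Vm := (gasket_vertices p).
Local Notation point := 'rV[R]_N.-1.
Local Notation S := (cell_energy p).
Local Notation rho := (renorm R N).
Implicit Types u v : point -> R.

Let i0 : 'I_N := Ordinal (leq_trans (isT : (0 < 2)%N) N_ge2).
Let i1 : 'I_N := Ordinal N_ge2.
Let hb := harmonic p N_ge2 V.
Let hbV : forall b j, hb b (p j) = b j := harmonic_vertex N_ge2 p_dist HV.
Let hbM b i m x (mx : Vm m x) : hb b (F i x) = hb (harmonic_step i b) x :=
  harmonic_map N_ge2 p_dist HV b i (V_vertices HV mx).
Let n_gt0 : 0 < N%:R :> R := natN_gt0 R N_ge2.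
Let rho_gt0 : 0 < rho := renorm_gt0 R N_ge2.

Lemma energy_comp_le u i : finite_energy p u ->
  fine (energy p (u \o F i)) <= rho^-1 * fine (energy p u).
Proof.
move=> fu; have [k k1 hk] := energy_cvg N_ge2 p_dist HV.
have fui := finite_energy_comp N_ge2 i fu.
have [-> _ _] := hk _ fui; have [-> _ _] := hk _ fu => /=.
rewrite mulrCA ler_pM2l ?(lt_le_trans _ k1)//.
apply: (cvgr_to_le (cell_energy_cvg N_ge2 hbV hbM fui)).
apply: nearW => m; rewrite ler_pdivlMl//.
apply: le_trans (cell_energyS_ge0_comp p N_ge2 m u i) _.
exact: (cell_energy_le_lim N_ge2 hbV hbM).
Qed.

Lemma finite_energy_cell u w : finite_energy p u -> finite_energy p (u \o cell_map p w).
Proof.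
elim: w u => [//|i w IH] u fu.
exact: (IH (u \o F i) (finite_energy_comp N_ge2 i fu)).
Qed.

Lemma energy_cell_le u w : finite_energy p u ->
  fine (energy p (u \o cell_map p w)) <= rho ^- size w * fine (energy p u).
Proof.
elim: w u => [|i w IH] u fu; first by rewrite expr0 invr1 mul1r.
apply: (le_trans (IH (u \o F i) (finite_energy_comp N_ge2 i fu))).
rewrite [leRHS](_ : _ = rho ^- size w * (rho^-1 * fine (energy p u))).
  by rewrite ler_wpM2l ?invr_ge0 ?exprn_ge0 ?(ltW rho_gt0)// energy_comp_le.
by rewrite [size _]/= exprS invfM; ring.
Qed.

Lemma within_continuous_cell u w : {within V, continuous u} ->
  {within V, continuous (u \o cell_map p w)}.
Proof.
move=> /within_continuousP uc; apply/within_continuousP => x Vx e e0.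
have h := uc _ (V_cell_map HV w Vx) e e0.
have := cell_map_continuous (x := x) h.
by apply: (@filterS _ (nbhs x)) => y /= hy Vy; apply: hy; exact: V_cell_map.
Qed.

Lemma cell_oscillation u w x y : {within V, continuous u} -> finite_energy p u ->
  V x -> V y -> `|u (cell_map p w x) - u (cell_map p w y)| <=
  2 * (N%:R + 2) * Num.sqrt (rho ^- size w * fine (energy p u)).
Proof.
move=> uc fu Vx Vy.
have h z (Vz : V z) := energy_vertex_oscillation N_ge2 p_dist HV
  (within_continuous_cell (w := w) uc) (finite_energy_cell w fu) Vz i0.
have nle : H01_norm p (u \o cell_map p w) <= Num.sqrt (rho ^- size w * fine (energy p u)).
  by rewrite ler_sqrt ?energy_cell_le// mulr_ge0 ?invr_ge0 ?exprn_ge0 ?(ltW rho_gt0)//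
    (energy_fine_ge0 N_ge2 p_dist HV).
have n2 : 0 <= N%:R + 2 :> R by rewrite addr_ge0.
have {}nle := ler_wpM2l n2 nle.
have := h x Vx; have := h y Vy; rewrite /= !ler_norml => /andP[? ?] /andP[? ?].
by apply/andP; split; lra.
Qed.

Lemma cell_oscillation_small (r e : R) : 0 < e -> exists n : nat,
  2 * (N%:R + 2) * Num.sqrt (rho ^- n * r) <= e.
Proof.
move=> e0; have n2 : 0 < 2 * (N%:R + 2) :> R by rewrite mulr_gt0// addr_gt0.
have d0 : 0 < e / (2 * (N%:R + 2)) by rewrite divr_gt0.
have c : rho ^- n * r @[n --> \oo] --> 0.
  rewrite -[X in _ --> X](mul0r r); apply: cvgMr_tmp.
  under eq_fun do rewrite -exprVn.
  apply: cvg_expr; rewrite ger0_norm ?invr_ge0 ?ltW// invf_lt1//.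
  by rewrite /renorm ltr_pdivlMr// mul1r ltrDl.
have /cvgrPdist_le/(_ _ (exprn_gt0 2 d0))[n _ /(_ n (leqnn n))] := c.
rewrite sub0r normrN => h; exists n.
rewrite mulrC -ler_pdivlMr//.
apply: (@le_trans _ _ (Num.sqrt ((e / (2 * (N%:R + 2))) ^+ 2))).
  by rewrite ler_sqrt ?sqr_ge0// (le_trans (ler_norm _) h).
by rewrite sqrtr_sqr ger0_norm// ltW.
Qed.

(** Arzela-Ascoli with cells in place of balls: bounded energy makes the oscillation on cells of
    level [m] uniformly small, so uniform closeness need only be tested at one point
    [cell_map p w (p i0)] per cell. *)
Lemma H01_compact (r : R) (U : nat -> point -> R) :
  (forall n, H01 p V (U n)) -> (forall n, fine (energy p (U n)) <= r) ->
  exists u, forall (e : R) n0, 0 < e -> exists2 n, (n0 <= n)%N &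
    forall x, V x -> `|U n x - u x| <= e.
Proof.
move=> UH Ur; have fU n := H01_finite N_ge2 p_dist HV (UH n).
(* The sup bound holds on V only, so the functions are cut off outside V to be bounded
   everywhere. *)
pose U' n (x : point) := if x \in V then U n x else 0.
have UE n x : V x -> U' n x = U n x by move=> Vx; rewrite /U' mem_set.
have r0 : 0 <= r by apply: le_trans (Ur 0%N); exact: (energy_fine_ge0 N_ge2 p_dist HV).
have n3 : 0 <= 2 * N%:R + 3 :> R by rewrite addr_ge0// mulr_ge0.
have UM n x : `|U' n x| <= (2 * N%:R + 3) * Num.sqrt r.
  rewrite /U'; case: ifPn => [/set_mem Vx|_]; last by rewrite normr0 mulr_ge0 ?sqrtr_ge0.
  apply: (le_trans (H01_sup N_ge2 p_dist HV (UH n) Vx)).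
  by rewrite ler_wpM2l// ler_sqrt.
have [u hu] := pointwise_cluster UM.
exists u => e n0 e0; have e3 : 0 < e / 3 by rewrite divr_gt0.
have [m hm] := cell_oscillation_small r e3.
have oscU n w x y : size w = m -> V x -> V y ->
    `|U n (cell_map p w x) - U n (cell_map p w y)| <= e / 3.
  move=> wm Vx Vy; have [Uc _ _] := UH n.
  apply: (le_trans (cell_oscillation w Uc (fU n) Vx Vy)); apply: le_trans hm.
  rewrite wm ler_wpM2l ?mulr_ge0 ?addr_ge0// ler_sqrt.
    by rewrite ler_wpM2l ?invr_ge0 ?exprn_ge0 ?(ltW rho_gt0).
  by rewrite mulr_ge0 ?invr_ge0 ?exprn_ge0 ?(ltW rho_gt0).
(* [u] inherits the oscillation bound by approximating it at just the two points in question. *)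
have oscu w x y : size w = m -> V x -> V y ->
    `|u (cell_map p w x) - u (cell_map p w y)| <= e / 3.
  move=> wm Vx Vy; apply/ler_addgt0Pr => d d0.
  have d2 : 0 < d / 2 by rewrite divr_gt0.
  have [n _ hn] := hu _ (fun b : bool => cell_map p w (if b then x else y)) _ 0%N d2.
  have := hn true; have := hn false; rewrite /= !UE; try exact: (V_cell_map HV).
  have := oscU n w x y wm Vx Vy; rewrite !ler_norml.
  by move=> /andP[? ?] /andP[? ?] /andP[? ?]; apply/andP; split; lra.
have [n nn0 hn] := hu _ (fun w : m.-tuple 'I_N => cell_map p w (p i0)) _ n0 e3.
exists n => // x Vx; have [w [y [wm Vy ->]]] := V_cellP HV m Vx.
have /eqP wm' := wm; have := hn (Tuple wm'); rewrite /= UE; last first.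
  by apply: (V_cell_map HV); exact: (V_p HV).
have := oscU n w y (p i0) wm Vy (V_p HV i0).
have := oscu w y (p i0) wm Vy (V_p HV i0); rewrite !ler_norml.
by move=> /andP[? ?] /andP[? ?] /andP[? ?]; apply/andP; split; lra.
Qed.

(** The product rule [a b - a' b' = a (b - b') + b' (a - a')] on each edge, so that products of
    bounded functions of finite energy have finite energy. *)
Lemma cell_energy_mul m u v :
  (forall x, Vm m x -> `|u x| <= 1) -> (forall x, Vm m x -> `|v x| <= 1) ->
  S m (fun x => u x * v x) (fun x => u x * v x) <= 2 * S m u u + 2 * S m v v.
Proof.
elim: m u v => [|m IH] u v u1 v1 /=.
  rewrite /vertex_energy !mulr_sumr -big_split/=; apply: ler_sum => i _.
  rewrite !mulr_sumr -big_split/=; apply: ler_sum => j _.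
  have := u1 (p i) (vertices_p p i 0); have := v1 (p j) (vertices_p p j 0).
  set a := u (p i); set a' := u (p j); set b := v (p i); set b' := v (p j).
  have sq (c : R) : `|c| <= 1 -> c ^+ 2 <= 1.
    by move=> c1; rewrite -real_normK ?num_real// exprn_ile1.
  move=> /sq hb' /sq ha.
  have -> : a * b - a' * b' = a * (b - b') + b' * (a - a') by ring.
  have h1 : (a * (b - b')) ^+ 2 <= (b - b') ^+ 2.
    by rewrite exprMn ler_piMl// sqr_ge0.
  have h2 : (b' * (a - a')) ^+ 2 <= (a - a') ^+ 2.
    by rewrite exprMn ler_piMl// sqr_ge0.
  rewrite -!expr2; set s := a * (b - b') in h1 *; set t := b' * (a - a') in h2 *.
  by have := sqr_ge0 (s - t); rewrite sqrrB sqrrD; lra.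
rewrite !(mulrCA 2) -mulrDr ler_pM2l// !mulr_sumr -big_split/=.
apply: ler_sum => i _; apply: (IH (u \o F i) (v \o F i)) => x mx.
  by apply: u1; exact: vertices_map.
by apply: v1; exact: vertices_map.
Qed.

(** The product of the harmonic functions that are 1 at [p i0], respectively at [p i1], and 0 at the
    other vertices. As [i0 != i1], it vanishes at every vertex, and it is positive at the junction
    [F i0 (p i1)], where both factors are. *)
Lemma H01_bump : exists w, [/\ H01 p V w, forall x, V x -> 0 <= w x &
  exists2 x, V x & 0 < w x].
Proof.
pose d (i j : 'I_N) : R := (j == i)%:R.
have dE i k : 0 <= d i k <= 1 by rewrite /d; case: eqP => _ /=; rewrite lexx ler01.
have hE i x : V x -> 0 <= hb (d i) x <= 1.
  by move=> Vx; exact: (harmonic_bounds N_ge2 HV Vx (dE i)).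
have h1 i x : V x -> `|hb (d i) x| <= 1.
  by move=> /(hE i)/andP[h0 h1]; rewrite ger0_norm.
have fin i m : S m (hb (d i)) (hb (d i)) <= vertex_energy (d i) (d i).
  rewrite (cell_energy_harmonic N_ge2 hbV hbM) le_eqVlt; apply/orP; left; apply/eqP.
  by apply: eq_bigr => k _; apply: eq_bigr => l _; rewrite /= !hbV.
exists (fun x => hb (d i0) x * hb (d i1) x); split.
- split.
  + apply/within_continuousP => x Vx e e0; have e2 : 0 < e / 2 by rewrite divr_gt0.
    have /within_continuousP/(_ x Vx _ e2) c0 := @harmonic_continuous _ _ p N_ge2 p_dist V HV (d i0).
    have /within_continuousP/(_ x Vx _ e2) c1 := @harmonic_continuous _ _ p N_ge2 p_dist V HV (d i1).
    apply: (@filterS2 _ (nbhs x) _ _ _ _ _ c0 c1) => y {}c0 {}c1 Vy.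
    rewrite -/hb in c0 c1; have {}c0 := c0 Vy; have {}c1 := c1 Vy.
    rewrite (_ : _ - _ = hb (d i0) x * (hb (d i1) x - hb (d i1) y) +
      hb (d i1) y * (hb (d i0) x - hb (d i0) y)); last by ring.
    rewrite (le_trans (ler_normD _ _))// !normrM (splitr e).
    apply: lerD.
      by rewrite (le_trans _ c1)// ler_piMl// h1.
    by rewrite (le_trans _ c0)// ler_piMl// h1.
  + move=> i; rewrite !hbV /d; have [->|] := eqVneq i i0; last by rewrite mul0r.
    by rewrite (_ : i0 == i1 = false)// mulr0.
  + apply/(finite_energyP N_ge2 p_dist HV).
    exists (2 * vertex_energy (d i0) (d i0) + 2 * vertex_energy (d i1) (d i1)) => m.
    apply: le_trans (cell_energy_mul _ _) _.
    * by move=> x mx; apply: h1; exact: (V_vertices HV mx).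
    * by move=> x mx; apply: h1; exact: (V_vertices HV mx).
    * by apply: lerD; rewrite ler_pM2l.
- move=> x Vx; have /andP[? _] := hE i0 x Vx; have /andP[? _] := hE i1 x Vx.
  by rewrite mulr_ge0.
- exists (F i0 (p i1)); first by apply: (V_map HV); exact: (V_p HV).
  have h i : 0 < harmonic_step i0 (d i) i1 -> 0 < hb (d i) (F i0 (p i1)).
    by rewrite (hbM _ _ (vertices_p p i1 0)) hbV.
  have n2 : 0 < N%:R + 2 :> R by rewrite addr_gt0.
  have sE i : \sum_k d i k = 1.
    by rewrite /d (bigD1 i)//= eqxx big1 ?addr0// => k /negPf ->.
  apply: mulr_gt0; apply: h; rewrite /harmonic_step /= sE /d;
    by rewrite divr_gt0// ltr_wpDl.
Qed.

End energy_compactness.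

(** * The Hausdorff measure on the gasket *)

Section metric_outer_measure.
Local Open Scope ereal_scope.
Variables (R : realType) (T : Type) (mu : {outer_measure set T -> \bar R}).
Variable phi : T -> R.
Hypothesis mu_fin : mu setT < +oo.
Hypothesis mu_sep : forall (A B : set T) (e : R), (0 < e)%R ->
  (forall x y, A x -> B y -> (phi x + e <= phi y)%R) ->
  mu A + mu B <= mu (A `|` B).

Let mu_lty A : mu A < +oo.
Proof. by apply: le_lt_trans mu_fin; exact: le_outer_measure. Qed.

Let c (k : nat) : R := k.+1%:R^-1.

Let c_gt0 k : (0 < c k)%R. Proof. by rewrite /c invr_gt0. Qed.

Let c_lt k l : (k < l)%N -> (c l < c k)%R.
Proof. by move=> kl; rewrite /c ltf_pV2 ?posrE// ltr_nat ltnS. Qed.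

Let c_le k l : (k <= l)%N -> (c l <= c k)%R.
Proof. by move=> kl; rewrite /c lef_pV2 ?posrE// ler_nat ltnS. Qed.

(* Caratheodory's rings around the sublevel set: rings of equal parity are
   separated, so the masses of all rings are summable. *)
Let ring (A : set T) k := A `&` [set x | (c k.+2 <= phi x < c k.+1)%R].

Let ring_sum_parity A (d : nat) n :
  \sum_(0 <= j < n) mu (ring A (j.*2 + d)%N) <= mu A.
Proof.
suff : \sum_(0 <= j < n) mu (ring A (j.*2 + d)%N) <=
    mu (A `&` [set x | (c (n.*2 + d)%N <= phi x)%R]).
  by move=> /le_trans; apply; apply: le_outer_measure => x [].
elim: n => [|n IH]; first by rewrite big_geq// outer_measure_ge0.
rewrite big_nat_recr//=; apply: (le_trans (leeD2r _ IH)).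
have gap : (0 < c (n.*2 + d)%N - c (n.*2 + d).+1)%R by rewrite subr_gt0 c_lt.
rewrite addeC; apply: le_trans (mu_sep gap _) _.
  by move=> x y [_ /andP[_ xlt]] [_ yge] /=; move: xlt yge => /=; lra.
apply: le_outer_measure => x; rewrite doubleS !addSn.
have ? : (c (n.*2 + d).+2 < c (n.*2 + d))%R by rewrite c_lt.
by move=> [[Ax /andP[xge _]]|[Ax /= xge]]; split => //=; lra.
Qed.

Let ring_sum_lty A : \sum_(0 <= k <oo) mu (ring A k) < +oo.
Proof.
apply: (@le_lt_trans _ _ (mu A + mu A)); last first.
  by rewrite lte_add_pinfty.
apply: lime_le; first by apply: is_cvg_nneseries => k _ _; exact: outer_measure_ge0.
apply: nearW => n.
apply: (@le_trans _ _ (\sum_(0 <= k < n.*2) mu (ring A k))).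
  apply: lee_sum_nneg_natr => [k _ _|]; first exact: outer_measure_ge0.
  by rewrite -addnn leq_addl.
suff -> : \sum_(0 <= k < n.*2) mu (ring A k) =
    \sum_(0 <= j < n) mu (ring A (j.*2 + 0)%N) + \sum_(0 <= j < n) mu (ring A (j.*2 + 1)%N).
  by apply: leeD; exact: ring_sum_parity.
elim: n => [|n IH]; first by rewrite !big_geq// adde0.
rewrite doubleS !big_nat_recr//= IH addn0 addn1.
by rewrite -!addeA; congr (_ + _); rewrite addeCA.
Qed.

(** [Xn] is separated from the sublevel set, so the masses of the two add up. What [Xn] misses of
    the complement lies in the rings of index at least [n], a tail of a convergent series. *)
Lemma caratheodory_sublevel : mu.-caratheodory [set x | (phi x <= 0)%R].
Proof.
apply: le_caratheodory_measurable => X.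
apply/lee_addgt0Pr => e e0.
have tail : \sum_(n <= k <oo) mu (ring X k) @[n --> \oo] --> 0.
  by apply: nneseries_tail_cvg => // k _; exact: outer_measure_ge0.
have [n nE] : exists n, \sum_(n <= k <oo) mu (ring X k) <= e%:E.
  have /fine_cvgP[_ /cvgrPdist_le/(_ e e0)] := tail.
  have /fine_cvgP[fin _] := tail; move=> h.
  have [n _ /(_ n (leqnn n))[fn hn]] := filterI fin h.
  exists n; rewrite -(fineK fn) lee_fin.
  by move: hn; rewrite sub0r normrN; apply: le_trans; exact: ler_norm.
pose Xn := X `&` [set x | (c n.+1 <= phi x)%R].
have h1 : mu (X `&` [set x | (phi x <= 0)%R]) + mu Xn <= mu X.
  apply: le_trans (mu_sep (c_gt0 n.+1) _) _.
    by move=> x y [_ /= x0] [_ /= yc]; lra.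
  by apply: le_outer_measure => x [[]|[]].
have h2 : mu (X `&` ~` [set x | (phi x <= 0)%R]) <=
    mu Xn + \sum_(n <= k <oo) mu (ring X k).
  apply: (@le_trans _ _ (mu (Xn `|` \bigcup_(k in ~` `I_n) ring X k))).
    apply: le_outer_measure => x [Xx /= /negP]; rewrite -ltNge => x0.
    have [xc|xc] := leP (c n.+1) (phi x); first by left.
    have [m mx] : exists m, (c m <= phi x)%R.
      have := archi_boundP (ltW (eq_ind_r (fun b : bool => b) x0 (invr_gt0 (phi x)))).
      set m := Num.bound _ => mb; exists m.
      rewrite /c invf_ple ?posrE//; apply: ltW; apply: (lt_trans mb).
      by rewrite ltr_nat.
    (* The least [k] with [c k <= phi x] locates the ring; it is at least 2 because
       [phi x < c n.+1 <= c 1]. *)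
    have [k kmin] := ex_minnP (ex_intro (fun m => (c m <= phi x)%R) m mx).
    move: k kmin => [|[|k]] kx kmin.
    - by have := c_le (leq0n n.+1); lra.
    - by have := c_le (ltn0Sn n); lra.
    - right; exists k.
        move=> /= kn; have : (c n.+1 <= c k.+2)%R; last by lra.
        by apply: c_le; lia.
      split => //=; rewrite kx /= ltNge; apply/negP => k1.
      by have := kmin _ k1; rewrite ltnn.
  apply: (le_trans (outer_measureU2 _ _ _)); apply: leeD2l.
  exact: outer_measure_sigma_subadditive_tail.
apply: (le_trans (leeD2l _ h2)); rewrite addeA; apply: leeD => //.
Qed.

End metric_outer_measure.

Section hausdorff_metric.
Local Open Scope ereal_scope.
Variables (R : realType) (n : nat) (s : R).
Implicit Types A B : set 'rV[R]_n.

Lemma euclid_dist_le_diam A x y : A x -> A y ->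
  (euclid_dist x y)%:E <= euclid_diam A.
Proof. by move=> Ax Ay; apply: ereal_sup_ubound; exists (x, y). Qed.

Lemma euclid_diam_le A (d : \bar R) : (forall x y, A x -> A y ->
  (euclid_dist x y)%:E <= d) -> euclid_diam A <= d.
Proof. by move=> h; apply: ge_ereal_sup => _ [[x y] [/= Ax Ay] <-]; exact: h. Qed.

Lemma hausdorff_gauge0 : hausdorff_gauge s (set0 : set 'rV[R]_n) = 0.
Proof. by rewrite /hausdorff_gauge eqxx. Qed.

Lemma hausdorff_pre_le_gauge (delta : R) A : euclid_diam A <= delta%:E ->
  hausdorff_pre s delta A <= hausdorff_gauge s A.
Proof.
move=> dA; apply: ereal_inf_lbound; exists (fun k => if k == 0%N then A else set0).
  split=> [[|k]|x Ax] //=; first by rewrite euclid_diam0 leNye.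
  by exists 0%N.
rewrite (nneseries_split _ 1); last by move=> k _; exact: hausdorff_gauge_ge0.
by rewrite big_nat1 eseries0 ?adde0// => -[|k] // _ _; rewrite hausdorff_gauge0.
Qed.

Lemma hausdorff_pre_anti (d d' : R) A : (d <= d')%R ->
  hausdorff_pre s d' A <= hausdorff_pre s d A.
Proof.
move=> dd; apply/ereal_inf_le_tmp => _ [U [dU UA] <-]; exists U => //; split => // k.
by apply: le_trans (dU k) _; rewrite lee_fin.
Qed.

Lemma hausdorff_pre_le (d : R) A : (0 < d)%R -> hausdorff_pre s d A <= hausdorff s A.
Proof. by move=> d0; apply: ereal_sup_ubound; exists d. Qed.

(** A set of diameter at most [d < e] cannot meet both [A] and [B], so a cover of the union splits
    into disjoint subfamilies covering [A] and [B]. *)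
Lemma hausdorff_pre_separated A B (e d : R) : (d < e)%R ->
  (forall x y, A x -> B y -> (e <= euclid_dist x y)%R) ->
  hausdorff_pre s d A + hausdorff_pre s d B <= hausdorff_pre s d (A `|` B).
Proof.
move=> de AB; apply: le_ereal_inf_tmp => _ [U [dU UAB] <-].
pose meets C k := `[< exists x, U k x /\ C x >].
pose UC C k := if meets C k then U k else set0.
have cover C : C `<=` A `|` B ->
    hausdorff_pre s d C <= \sum_(k <oo) hausdorff_gauge s (UC C k).
  move=> CAB; apply: ereal_inf_lbound; exists (UC C) => //; split => [k|x Cx].
    by rewrite /UC; case: ifP => // _; rewrite euclid_diam0 leNye.
  have [k _ Ukx] := UAB x (CAB x Cx); exists k => //; rewrite /UC.
  by rewrite ifT//; apply/asboolP; exists x.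
apply: (le_trans (leeD (cover A _) (cover B _))).
- by move=> x; left.
- by move=> x; right.
rewrite -nneseriesD; [|by move=> k _ _; exact: hausdorff_gauge_ge0..].
apply: lee_nneseries => [k _ _|k _]; first by rewrite adde_ge0// hausdorff_gauge_ge0.
rewrite /UC; case: ifP => [/asboolP[x [Ux Ax]]|_]; last first.
  by rewrite hausdorff_gauge0 add0e; case: ifP => // _; rewrite hausdorff_gauge0 hausdorff_gauge_ge0.
case: ifP => [/asboolP[y [Uy By]]|_]; last by rewrite hausdorff_gauge0 adde0.
have := le_trans (euclid_dist_le_diam Ux Uy) (dU k); rewrite lee_fin.
by move=> dxy; exfalso; have := AB x y Ax By; lra.
Qed.

(** Two independent suprema over the scale are taken one after the other; [ptw] compares both scales
    with a common one below [e], and the finiteness facts permit the subtractions. *)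
Lemma hausdorff_separated A B (e : R) : (0 < e)%R ->
  (forall x y, A x -> B y -> (e <= euclid_dist x y)%R) ->
  hausdorff s A + hausdorff s B <= hausdorff s (A `|` B).
Proof.
move=> e0 AB; have [->|ABoo] := eqVneq (hausdorff s (A `|` B)) +oo; first by rewrite leey.
have ABfin : hausdorff s (A `|` B) \is a fin_num.
  by rewrite ge0_fin_numE ?hausdorff_ge0// ltey.
have ptw (d d' : R) : (0 < d)%R -> (0 < d')%R ->
    hausdorff_pre s d A + hausdorff_pre s d' B <= hausdorff s (A `|` B).
  move=> d0 d0'; pose m := Num.min (Num.min d d') (e / 2)%R.
  have m0 : (0 < m)%R by rewrite !lt_min d0 d0' divr_gt0.
  have me : (m < e)%R by rewrite /m gt_min ltr_pdivrMr// mulr_natr mulr2n ltrDl e0 orbT.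
  apply: (@le_trans _ _ (hausdorff_pre s m A + hausdorff_pre s m B)).
    by apply: leeD; apply: hausdorff_pre_anti; rewrite /m !ge_min lexx ?orbT.
  apply: le_trans (hausdorff_pre_separated me AB) _; exact: hausdorff_pre_le.
have Bfin (d : R) : (0 < d)%R -> hausdorff_pre s d B \is a fin_num.
  move=> d0; rewrite ge0_fin_numE ?hausdorff_pre_ge0//.
  apply: (@le_lt_trans _ _ (hausdorff s (A `|` B))); last by rewrite ltey.
  by apply: le_trans (ptw d d d0 d0); rewrite leeDr// hausdorff_pre_ge0.
have hA (d : R) : (0 < d)%R -> hausdorff s A + hausdorff_pre s d B <= hausdorff s (A `|` B).
  move=> d0; rewrite -leeBrDr ?Bfin//; apply: ge_ereal_sup => _ [d' d0' <-].
  by rewrite leeBrDr ?Bfin//; exact: ptw.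
have Afin : hausdorff s A \is a fin_num.
  rewrite ge0_fin_numE ?hausdorff_ge0//.
  apply: (@le_lt_trans _ _ (hausdorff s (A `|` B))); last by rewrite ltey.
  by apply: le_trans (hA 1%R ltr01); rewrite leeDl// hausdorff_pre_ge0.
rewrite addeC -leeBrDr//; apply: ge_ereal_sup => _ [d d0 <-].
by rewrite leeBrDr// addeC; exact: hA.
Qed.

End hausdorff_metric.

Lemma norm_le_euclid_dist (R : realType) (n : nat) (x y : 'rV[R]_n) :
  `|x - y| <= euclid_dist x y.
Proof.
rewrite [leLHS]/Num.norm /= mx_normrE; apply/bigmax_leP; split => [|[i j] _ /=].
  exact: sqrtr_ge0.
rewrite ord1 !mxE -sqrtr_sqr ler_sqrt; last by apply: sumr_ge0 => k _; exact: sqr_ge0.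
by rewrite (bigD1 j)//= lerDl sumr_ge0// => k _; exact: sqr_ge0.
Qed.

(** This identity characterises the dimension: [N] copies at half the scale have the same total
    gauge. *)
Lemma powR_dim (R : realType) (N k : nat) : (2 <= N)%N ->
  powR (2 ^- k : R) (gasket_dim R N) = N%:R ^- k.
Proof.
move=> N2; have N0 : 0 < N%:R :> R by rewrite ltr0n (leq_trans _ N2).
have l2 : 0 < ln 2 :> R by rewrite ln_gt0// ltr1n.
rewrite /powR gt_eqF ?invr_gt0 ?exprn_gt0// /gasket_dim.
rewrite lnV ?posrE ?exprn_gt0// lnXn// mulrN -(mulr_natr (ln 2)) mulrA divfK ?gt_eqF//.
by rewrite expRN mulrC expRM_natl lnK ?posrE.
Qed.

Lemma gasket_dim_gt0 (R : realType) (N : nat) : (2 <= N)%N -> 0 < gasket_dim R N.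
Proof. by move=> N2; rewrite /gasket_dim divr_gt0// ln_gt0// ltr1n. Qed.

HB.instance Definition _ (R : realType) (n : nat) (s delta : R) :=
  isOuterMeasure.Build R 'rV[R]_n (hausdorff_pre s delta)
    (hausdorff_pre0 n s delta) (hausdorff_pre_ge0 s delta)
    (@le_hausdorff_pre R n s delta) (@hausdorff_pre_sigma_subadditive R n s delta).

Lemma outer_measure_finite_union (R : realType) (T : Type) (I : finType)
    (mu : {outer_measure set T -> \bar R}) (A : I -> set T) :
  (mu (\bigcup_i A i) <= \sum_i mu (A i))%E.
Proof.
suff : (mu [set x | exists2 i, i \in index_enum I & A i x] <= \sum_i mu (A i))%E.
  apply: le_trans; apply: le_outer_measure => x [i _ Aix].
  by exists i => //; exact: mem_index_enum.
elim: (index_enum I) => [|i r IH].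
  rewrite big_nil (_ : [set x | _] = set0) ?outer_measure0//.
  by rewrite -subset0 => x [].
rewrite big_cons; apply: le_trans (leeD2l _ IH).
apply: le_trans (outer_measureU2 _ _ _); apply: le_outer_measure.
move=> x [j]; rewrite inE => /orP[/eqP ->|jr] Ajx; first by left.
by right; exists j.
Qed.

(** * Counting words and cells *)

Section word_counting.
Variable N : nat.

Fixpoint words n : seq (seq 'I_N) :=
  if n is n'.+1 then [seq i :: w | i <- enum 'I_N, w <- words n'] else [:: [::]].

Lemma size_words n w : w \in words n -> size w = n.
Proof.
elim: n w => [|n IH] w /=; first by rewrite inE => /eqP ->.
by move=> /allpairsP[[i v]/= [_ /IH <- ->]].
Qed.

Lemma mem_words w : w \in words (size w).
Proof.
elim: w => [|i w IH] //=; apply/allpairsP; exists (i, w); split => //.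
by rewrite mem_enum.
Qed.

Lemma uniq_words n : uniq (words n).
Proof.
elim: n => //= n IH; apply: allpairs_uniq => //; first exact: enum_uniq.
by move=> [i w] [j v] _ _ /= [-> ->].
Qed.

Lemma count_wordsS (P : pred (seq 'I_N)) n :
  count P (words n.+1) = (\sum_(i < N) count (fun w => P (i :: w)) (words n))%N.
Proof.
have cE (Q : pred (seq 'I_N)) s : count Q s = (\sum_(w <- s) Q w)%N.
  by rewrite -sum1_count big_mkcond/=; apply: eq_bigr => w _; case: (Q w).
rewrite cE /= big_allpairs_dep/= big_enum/=.
by apply: eq_bigr => i _; rewrite cE.
Qed.

Lemma count_words_prefix (P : pred (seq 'I_N)) n l :
  count (fun w => P (take n w)) (words (n + l)) = (count P (words n) * N ^ l)%N.
Proof.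
elim: n P => [|n IH] P.
  rewrite (eq_count (a2 := fun=> P [::])); last by move=> w; rewrite take0.
  elim: l => [|l IHl]; first by rewrite /= muln1.
  rewrite add0n count_wordsS (eq_bigr (fun=> (count P (words 0) * N ^ l)%N)) => [|i _].
    by rewrite sum_nat_const card_ord expnS mulnCA.
  by rewrite -IHl add0n.
rewrite addSn !count_wordsS big_distrl/=; apply: eq_bigr => i _.
exact: (IH (fun w => P (i :: w))).
Qed.

End word_counting.

Section gasket_cells.
Variables (R : realType) (N : nat) (p : 'I_N -> 'rV[R]_N.-1).
Hypothesis N_ge2 : (2 <= N)%N.
Hypothesis p_dist : forall i j : 'I_N, i != j -> euclid_dist (p i) (p j) = 1.
Variable V : set 'rV[R]_N.-1.
Hypothesis HV : is_gasket p V.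

Local Notation F := (gasket_map p).
Local Notation bary := (bary p).
Local Notation point := 'rV[R]_N.-1.
Local Notation H := (hausdorff (gasket_dim R N)).
Local Notation cell w := (cell_map p w @` V).

Let n_gt0 : 0 < N%:R :> R := natN_gt0 R N_ge2.
Let dim_gt0 : 0 < gasket_dim R N := gasket_dim_gt0 R N_ge2.

Lemma euclid_dist_cell w x y :
  euclid_dist (cell_map p w x) (cell_map p w y) = 2 ^- size w * euclid_dist x y.
Proof.
have h2 : 0 <= 2 ^- size w :> R by rewrite invr_ge0 exprn_ge0.
rewrite !euclid_distE; have -> : sqdist (cell_map p w x) (cell_map p w y) =
    (2 ^- size w) ^+ 2 * sqdist x y.
  elim: w {h2} => [|i w IH]; first by rewrite expr0 invr1 expr1n mul1r.
  rewrite !cell_map_cons sqdist_gasket_map IH -!pow4V mulrA.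
  by rewrite -[in RHS]exprVn exprS exprVn.
by rewrite sqrtrM ?sqr_ge0// sqrtr_sqr ger0_norm.
Qed.

Lemma V_bary_le1 k x : V x -> bary k x <= 1.
Proof.
move=> Vx; rewrite -(bary_sum p N_ge2 x) (bigD1 k)//= lerDl sumr_ge0// => j _.
exact: (V_bary_ge0 N_ge2 p_dist HV).
Qed.

Lemma V_euclid_dist_le1 x y : V x -> V y -> euclid_dist x y <= 1.
Proof.
move=> Vx Vy; rewrite euclid_distE -[leRHS]sqrtr1 ler_sqrt//.
rewrite (@sqdist_bary _ _ p)//; try exact: (V_hull N_ge2 p_dist HV).
rewrite ler_pdivrMl// mulr1.
have -> : 2 = \sum_k bary k x + \sum_k bary k y by rewrite !bary_sum//; ring.
rewrite -big_split/=; apply: ler_sum => k _.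
have x0 := V_bary_ge0 N_ge2 p_dist HV k Vx; have y0 := V_bary_ge0 N_ge2 p_dist HV k Vy.
have x1 := V_bary_le1 k Vx; have y1 := V_bary_le1 k Vy.
by set a := bary k x in x0 x1 *; set b := bary k y in y0 y1 *; nra.
Qed.

Lemma hausdorff_gauge_cell w : (hausdorff_gauge (gasket_dim R N) (cell w)
  <= (N%:R ^- size w)%:E)%E.
Proof.
rewrite /hausdorff_gauge; case: ifP => [_|/negbT/set0P[_ [x Vx _]]].
  by rewrite lee_fin invr_ge0 exprn_ge0.
rewrite -(powR_dim R (size w) N_ge2) -poweR_EFin.
have h2 : 0 <= 2 ^- size w :> R by rewrite invr_ge0 exprn_ge0.
have d0 : (0 <= euclid_diam (cell w))%E.
  apply: (@le_trans _ _ (euclid_dist (cell_map p w x) (cell_map p w x))%:E).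
    by rewrite lee_fin sqrtr_ge0.
  by apply: euclid_dist_le_diam; exists x.
apply: gt0_ler_poweR; rewrite ?(ltW dim_gt0)//.
- by rewrite in_itv/= d0 leey.
- by rewrite in_itv/= lee_fin h2 leey.
apply: euclid_diam_le => _ _ [y Vy <-] [z Vz <-].
by rewrite lee_fin euclid_dist_cell ler_piMr// V_euclid_dist_le1.
Qed.

Lemma cell_split w : cell w = \bigcup_i cell (rcons w i).
Proof.
apply/seteqP; split => [_ [x Vx <-]|_ [i _ [x Vx <-]]].
  have [i [y [Vy ->]]] := V_mapP HV Vx; exists i => //; exists y => //.
  by rewrite -cats1 cell_map_cat.
by exists (F i x); [exact: (V_map HV)|rewrite -cats1 cell_map_cat].
Qed.

(** Subdividing a cell replaces [N^-n] by [N] terms [N^-(n+1)], so the bound survives until the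
    cells are smaller than the prescribed scale. *)
Lemma hausdorff_cell_le w : (H (cell w) <= (N%:R ^- size w)%:E)%E.
Proof.
apply: ge_ereal_sup => _ [d d0 <-].
have [n nd] := pow2V_small d0.
have main l v : (n <= size v + l)%N ->
    (hausdorff_pre (gasket_dim R N) d (cell v) <= (N%:R ^- size v)%:E)%E.
  elim: l v => [|l IH] v nv.
    apply: le_trans (hausdorff_gauge_cell v); apply: hausdorff_pre_le_gauge.
    apply: euclid_diam_le => _ _ [y Vy <-] [z Vz <-].
    rewrite lee_fin euclid_dist_cell.
    have h2 : 0 <= 2 ^- size v :> R by rewrite invr_ge0 exprn_ge0.
    apply: (@le_trans _ _ (2 ^- size v)); first by rewrite ler_piMr// V_euclid_dist_le1.
    apply: (le_trans _ (ltW nd)); rewrite lef_pV2 ?posrE ?exprn_gt0//.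
    by rewrite ler_eXn2l ?ltr1n// -(addn0 (size v)).
  rewrite cell_split; apply: (le_trans (outer_measure_finite_union _ _)).
  apply: (@le_trans _ _ (\sum_(i < N) (N%:R ^- (size v).+1)%:E)%E).
    by apply: lee_sum => i _; rewrite -(size_rcons v i) IH// size_rcons addSnnS.
  rewrite sumEFin lee_fin sumr_const card_ord -(mulr_natl (_^-1)) exprS invfM mulrA.
  by rewrite divff ?mul1r// gt_eqF.
exact: (main n w (leq_addl _ _)).
Qed.

(** The position of the cell in the grid of mesh [2 ^- size w]: the binary number whose digits mark
    the letters of [w] equal to [k]. Hence the indices for all [k] determine the word. *)
Fixpoint cell_index (w : seq 'I_N) (k : 'I_N) : nat :=
  if w is i :: w' then (cell_index w' k + 2 ^ size w' * (k == i))%N else 0%N.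

Lemma bary_cell_map w x k :
  2 ^+ size w * bary k (cell_map p w x) = (cell_index w k)%:R + bary k x.
Proof.
elim: w => [|i w IH]; first by rewrite expr0 mul1r add0r.
rewrite cell_map_cons bary_map// [cell_index _ _]/= natrD natrM natrX.
have : 2 ^+ size w * bary k (cell_map p w x) = (cell_index w k)%:R + bary k x by [].
rewrite [size (i :: w)]/= exprS; lra.
Qed.

Lemma cell_index_lt w k : (cell_index w k < 2 ^ size w)%N.
Proof.
elim: w => // i w IH; rewrite [cell_index _ _]/= [size _]/= expnS.
by move: IH; set M := (2 ^ size w)%N; case: (k == i) => /=; lia.
Qed.

Lemma cell_index_inj w w' : size w = size w' -> cell_index w =1 cell_index w' ->
  w = w'.
Proof.
elim: w w' => [|i w IH] [|j w']//= [ww] zE.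
have ij : i = j.
  apply/eqP; apply: contraT => ij; have := zE i; rewrite eqxx (negPf ij) muln1 muln0.
  by have := cell_index_lt w' i; rewrite ww; set M := (2 ^ _)%N; lia.
rewrite ij (IH w')// => k; have := zE k; rewrite ij ww; exact: addIn.
Qed.

(** In units of [2 ^- n] the coordinates of two points of [O] differ by less than 4, and within a
    cell they vary by at most 1. So every index lies within 4 of that of a reference cell: 9 values
    per coordinate, shifted by 4 to stay natural. *)
Lemma count_cells_meeting (O : set point) n :
  (forall x y k, O x -> O y -> `|bary k x - bary k y| < 4 * 2 ^- n) ->
  (count (fun w => `[< exists2 x, V x & O (cell_map p w x) >]) (words N n) <= 9 ^ N)%N.
Proof.
move=> Osmall; set P := fun w => _.
have [[w0 /andP[w0n Pw0]]|noP] := pselect (exists w, (w \in words N n) && P w); last first.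
  rewrite (_ : count _ _ = 0%N)//; apply/eqP; rewrite -leqn0 leqNgt -has_count.
  by apply/hasPn => w wn; apply/negP => Pw; apply: noP; exists w; rewrite wn.
pose f w : {ffun 'I_N -> 'I_9} :=
  [ffun k => inord (cell_index w k + 4 - cell_index w0 k)].
have close w k : w \in words N n -> P w ->
    (cell_index w k <= cell_index w0 k + 4)%N /\ (cell_index w0 k <= cell_index w k + 4)%N.
  move=> wn /asboolP[x Vx Ox]; have /asboolP[y Vy Oy] := Pw0.
  have := Osmall _ _ k Ox Oy.
  rewrite -(ltr_pM2l (exprn_gt0 n (ltr0n R 2))) -{1}(gtr0_norm (exprn_gt0 n (ltr0n R 2))).
  rewrite -normrM mulrBr -{1}(size_words wn) bary_cell_map.
  rewrite -(size_words w0n) bary_cell_map mulrCA divff ?expf_neq0// mulr1.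
  have := V_bary_ge0 N_ge2 p_dist HV k Vx; have := V_bary_ge0 N_ge2 p_dist HV k Vy.
  have := V_bary_le1 k Vx; have := V_bary_le1 k Vy.
  set a := (cell_index w k); set b := cell_index w0 k => x1 y1 y0 x0.
  rewrite ltr_norml => /andP[h1 h2].
  have h3 : a%:R < b%:R + 5 :> R by lra.
  have h4 : b%:R < a%:R + 5 :> R by lra.
  move: h3 h4; rewrite -!(natrD _ _ 5) !ltr_nat; lia.
rewrite -size_filter -(size_map f).
apply: leq_trans (_ : #|{ffun 'I_N -> 'I_9}| <= _)%N; last first.
  by rewrite card_ffun !card_ord.
have /card_uniqP <- : uniq [seq f w | w <- words N n & P w].
  rewrite map_inj_in_uniq ?filter_uniq ?uniq_words// => w w'.
  rewrite !mem_filter => /andP[Pw wn] /andP[Pw' wn'] ff.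
  apply: cell_index_inj; first by rewrite (size_words wn) (size_words wn').
  move=> k; have := congr1 (fun g : {ffun 'I_N -> 'I_9} => val (g k)) ff; rewrite !ffunE /=.
  have [a1 a2] := close w k wn Pw; have [b1 b2] := close w' k wn' Pw'.
  by rewrite !inordK; lia.
exact: max_card.
Qed.

End gasket_cells.

(** * Positive Hausdorff measure of cells *)

Section gasket_positivity.
Variables (R : realType) (N : nat) (p : 'I_N -> 'rV[R]_N.-1).
Hypothesis N_ge2 : (2 <= N)%N.
Hypothesis p_dist : forall i j : 'I_N, i != j -> euclid_dist (p i) (p j) = 1.
Variable V : set 'rV[R]_N.-1.
Hypothesis HV : is_gasket p V.

Local Notation bary := (bary p).
Local Notation point := 'rV[R]_N.-1.
Local Notation dim := (gasket_dim R N).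
Local Notation H := (hausdorff dim).
Local Notation cell w := (cell_map p w @` V).

Let n_gt0 : 0 < N%:R :> R := natN_gt0 R N_ge2.
Let i0 : 'I_N := Ordinal (leq_trans (isT : (0 < 2)%N) N_ge2).

(** [n] is the dyadic level with [2 ^- n.+1 < diam U <= 2 ^- n]; rounding up by one level costs the
    factor [N]. A set of diameter 0 has no such level and gauge 0, and there [e] absorbs the
    error. *)
Lemma gauge_level (U : set point) (e : R) : 0 < e -> (euclid_diam U <= 1%:E)%E ->
  exists n, (forall x y, U x -> U y -> euclid_dist x y <= 2 ^- n) /\
    ((N%:R ^- n)%:E <= N%:R%:E * hausdorff_gauge dim U + e%:E)%E.
Proof.
move=> e0 U1; have [U0|U0] := leP (euclid_diam U) 0%:E.
  have [n nE] := pow2V_small e0.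
  exists n; split=> [x y Ux Uy|].
    have := le_trans (euclid_dist_le_diam Ux Uy) U0; rewrite lee_fin => /le_trans; apply.
    by rewrite invr_ge0 exprn_ge0.
  apply: (@le_trans _ _ e%:E); last first.
    by rewrite leeDr// mule_ge0 ?lee_fin// hausdorff_gauge_ge0.
  rewrite lee_fin (le_trans _ (ltW nE))// lef_pV2 ?posrE ?exprn_gt0//.
  by apply: lerXn2r; rewrite ?nnegrE// ler_nat.
have Ufin : euclid_diam U \is a fin_num.
  by rewrite ge0_fin_numE ?(ltW U0)// (le_lt_trans U1)// ltry.
move: U0 U1; rewrite -(fineK Ufin); set d := fine _; rewrite lte_fin lee_fin => d0 d1.
have [m md] := pow2V_small d0.
have [n nd nmin] := ex_minnP (ex_intro (fun n => 2 ^- n < d) m md).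
case: n nd nmin => [|n] nd nmin; first by move: nd; rewrite expr0 invr1; lra.
have dn : d <= 2 ^- n by rewrite leNgt; apply/negP => /nmin; rewrite ltnn.
exists n; split=> [x y Ux Uy|].
  by rewrite -lee_fin (le_trans (euclid_dist_le_diam Ux Uy))// -(fineK Ufin) lee_fin.
apply: (@le_trans _ _ (N%:R%:E * hausdorff_gauge dim U)%E); last by rewrite leeDl// lee_fin ltW.
have -> : N%:R ^- n = N%:R * N%:R ^- n.+1 :> R.
  by rewrite exprS invfM mulrA divff ?mul1r// gt_eqF.
rewrite EFinM lee_wpmul2l ?lee_fin// /hausdorff_gauge ifF; last first.
  by apply/eqP => U0; move: Ufin; rewrite U0 euclid_diam0.
rewrite -(powR_dim R n.+1 N_ge2) -poweR_EFin -(fineK Ufin) -/d.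
have h2 : 0 <= 2 ^- n.+1 :> R by rewrite invr_ge0 exprn_ge0.
apply: gt0_ler_poweR; rewrite ?(ltW (gasket_dim_gt0 R N_ge2))//.
- by rewrite in_itv/= lee_fin h2 leey.
- by rewrite in_itv/= lee_fin (ltW d0) leey.
- by rewrite lee_fin ltW.
Qed.

(* An open neighbourhood of [U] in V, so that a countable cover of V by sets of
   small diameter yields a finite one by compactness. *)
Let halo n (U : set point) : set point := [set y | exists2 x, U x /\ V x &
  forall k, `|bary k x - bary k y| < 2 ^- n].

Let halo_open n U : open (halo n U).
Proof.
rewrite openE => y [x [Ux Vx] xy].
suff h k : \forall z \near y, `|bary k x - bary k z| < 2 ^- n.
  apply: (@filterS _ (nbhs y)) (@filter_forall _ _ _ (nbhs y) _ h) => z hz.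
  by exists x.
have d0 : 0 < 2 ^- n - `|bary k x - bary k y| by rewrite subr_gt0.
have /cvgrPdist_lt/(_ _ d0) := @bary_continuous _ _ p k y.
apply: (@filterS _ (nbhs y)) => z; rewrite ltrBrDl; apply: le_lt_trans.
rewrite (_ : bary k x - bary k z = (bary k x - bary k y) + (bary k y - bary k z)).
  exact: ler_normD.
by ring.
Qed.

(** The 4 is 2 + 1 + 1: by [sqdist_bary] coordinates in [U] differ by at most sqrt 2 times [2 ^- n],
    and each halo point adds less than [2 ^- n]. *)
Let halo_small n U : (forall x y, U x -> U y -> euclid_dist x y <= 2 ^- n) ->
  forall y z k, halo n U y -> halo n U z -> `|bary k y - bary k z| < 4 * 2 ^- n.
Proof.
move=> Un y z k [x [Ux Vx] xy] [x' [Ux' Vx'] xz].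
have m0 : 0 < 2 ^- n :> R by rewrite invr_gt0 exprn_gt0.
have hx := V_hull N_ge2 p_dist HV Vx; have hx' := V_hull N_ge2 p_dist HV Vx'.
have xx : `|bary k x - bary k x'| <= 2 * 2 ^- n.
  rewrite -(ler_pXn2r (isT : (0 < 2)%N)) ?nnegrE ?mulr_ge0 ?(ltW m0)//.
  rewrite real_normK ?num_real//.
  have h : sqdist x x' <= (2 ^- n) ^+ 2.
    rewrite -(sqr_sqrtr (sqdist_ge0 x x')) ler_pXn2r ?nnegrE ?sqrtr_ge0 ?(ltW m0)//.
    exact: Un.
  move: h; rewrite (sqdist_bary N_ge2 hx hx') (bigD1 k)//=.
  set a := _ ^+ 2; set b := \sum_(_ | _) _; set c := 2 ^- n.
  have b0 : 0 <= b by apply: sumr_ge0 => j _; exact: sqr_ge0.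
  by rewrite exprMn; have := sqr_ge0 c; lra.
have := xy k; have := xz k; move: xx; rewrite !ltr_norml ler_norml.
by move=> /andP[? ?] /andP[? ?] /andP[? ?]; apply/andP; split; lra.
Qed.

Let cell_compact w : compact (cell w).
Proof.
apply: continuous_compact; last by case: HV.
exact/continuous_subspaceT/cell_map_continuous.
Qed.

(** A counting form of the mass distribution principle. Every long word extending [w0] runs through
    a cell met by some halo; a halo of level [n k] meets at most [9 ^ N] cells of that level.
    Dividing the word count by [N ^ m] bounds the sum of the [N ^- n k], hence the gauges, from
    below. *)
Lemma hausdorff_cell_gt0 w0 : (0 < H (cell w0))%E.
Proof.
pose K : R := (9 ^ N)%:R; have K0 : 0 < K by rewrite ltr0n expn_gt0.
pose a : R := N%:R ^- size w0; have a0 : 0 < a by rewrite invr_gt0 exprn_gt0.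
pose c : R := a / (2 * K * N%:R).
have c0 : 0 < c by rewrite divr_gt0// !mulr_gt0.
suff : (c%:E <= hausdorff_pre dim 1 (cell w0))%E.
  move=> h; apply: lt_le_trans (hausdorff_pre_le _ _ ltr01).
  by apply: lt_le_trans h; rewrite lte_fin.
apply: le_ereal_inf_tmp => _ [U [dU wU] <-].
(* The errors [ek] sum to at most [e], which uses up half of [a]; the other half yields [c]. *)
pose e : R := a / (2 * K).
have e0 : 0 < e by rewrite divr_gt0// mulr_gt0.
pose ek k : R := e * 2 ^- k.+1.
have ek0 k : 0 < ek k by rewrite mulr_gt0// invr_gt0 exprn_gt0.
have [n hn] : {n : nat -> nat & forall k,
    (forall x y, U k x -> U k y -> euclid_dist x y <= 2 ^- n k) /\
    ((N%:R ^- n k)%:E <= N%:R%:E * hausdorff_gauge dim (U k) + (ek k)%:E)%E}.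
  by apply: (@choice _ _ (fun k m =>
    (forall x y, U k x -> U k y -> euclid_dist x y <= 2 ^- m) /\
    ((N%:R ^- m)%:E <= N%:R%:E * hausdorff_gauge dim (U k) + (ek k)%:E)%E)) => k;
    exact: gauge_level.
have [B wB] : exists B : nat, forall x, cell w0 x -> exists2 k, (k < B)%N & halo (n k) (U k) x.
  have : cover_compact (cell w0) by rewrite -compact_cover; exact: cell_compact.
  move=> /(_ nat setT (fun k => halo (n k) (U k))).
  move=> [|x wx|D _ wD].
  - by move=> k _; exact: halo_open.
  - have [k _ Ukx] := wU x wx; exists k => //; exists x.
      by split => //; case: wx => y Vy <-; exact: (V_cell_map HV).
    by move=> j; rewrite subrr normr0 invr_gt0 exprn_gt0.
  exists (\max_(k <- finmap.enum_fset D) k).+1 => x /wD[k /= kD hx]; exists k => //.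
  by rewrite ltnS; exact: leq_bigmax_seq.
(* Any length at least every [n k] serves; the sum is a convenient upper bound. *)
pose l := (\sum_(k < B) n k)%N; pose m := (size w0 + l)%N.
have nm k : (k < B)%N -> (n k <= m)%N.
  by move=> kB; rewrite /m /l (bigD1 (Ordinal kB))//=; lia.
have main : (N ^ l <= \sum_(k < B) 9 ^ N * N ^ (m - n k))%N.
  have -> : (N ^ l = count (fun w => take (size w0) w == w0) (words N m))%N.
    rewrite (count_words_prefix (pred1 w0)) count_uniq_mem ?uniq_words//.
    by rewrite mem_words mul1n.
  pose P k w := `[< exists2 x, V x & halo (n k) (U k) (cell_map p w x) >].
  apply: (@leq_trans (\sum_(k < B) count (fun w => P k (take (n k) w)) (words N m))).
    rewrite -(big_mkord xpredT (fun k => count (fun w => P k (take (n k) w)) (words N m))).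
    have sub : subpred (fun w => take (size w0) w == w0)
        (fun w => has (fun k => P k (take (n k) w)) (iota 0 B)).
      move=> w /eqP ww; have wx : cell w0 (cell_map p w (p i0)).
        exists (cell_map p (drop (size w0) w) (p i0)).
          by apply: (V_cell_map HV); exact: (V_p HV).
        by rewrite -cell_map_cat -[in X in X ++ _]ww cat_take_drop.
      have [k kB hk] := wB _ wx; apply/hasP; exists k; first by rewrite mem_iota.
      apply/asboolP; exists (cell_map p (drop (n k) w) (p i0)).
        by apply: (V_cell_map HV); exact: (V_p HV).
      by rewrite -cell_map_cat cat_take_drop.
    apply: leq_trans (sub_count sub _) _; rewrite /index_iota subn0.
    elim: (iota 0 B) => [|k s IH]; first by rewrite /= count_pred0 big_nil.
    rewrite big_cons /=; apply: leq_trans (leq_add (leqnn _) IH).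
    rewrite -count_predUI; exact: leq_addr.
  apply: leq_sum => k _; rewrite -{1}(subnKC (nm k (ltn_ord k))).
  rewrite (count_words_prefix (P k)) leq_mul2r; apply/orP; right.
  apply: (count_cells_meeting N_ge2 p_dist HV); exact: halo_small (hn k).1.
have aE : a <= K * \sum_(k < B) N%:R ^- n k.
  rewrite -(ler_pM2l (exprn_gt0 m n_gt0)).
  have -> : N%:R ^+ m * a = (N ^ l)%:R.
    by rewrite /a /m exprD mulrAC divff ?mul1r ?natrX// expf_neq0// gt_eqF.
  rewrite mulrCA !mulr_sumr; apply: le_trans (_ : (\sum_(k < B) 9 ^ N * N ^ (m - n k))%:R <= _).
    by rewrite ler_nat.
  rewrite natr_sum; apply: ler_sum => k _.
  rewrite natrM -/K natrX ler_pM2l//.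
  have -> : N%:R ^+ m = N%:R ^+ (m - n k) * N%:R ^+ n k :> R by rewrite -exprD subnK ?nm.
  by rewrite -mulrA divff ?mulr1// expf_neq0// gt_eqF.
have sumE : (\sum_(k < B) (N%:R ^- n k)%:E <=
    N%:R%:E * \sum_(k <oo) hausdorff_gauge dim (U k) + e%:E)%E.
  apply: (@le_trans _ _ (\sum_(k < B) (N%:R%:E * hausdorff_gauge dim (U k) + (ek k)%:E))%E).
    by apply: lee_sum => k _; exact: (hn k).2.
  rewrite big_split/=; apply: leeD.
    rewrite -ge0_sume_distrr; last by move=> k _; exact: hausdorff_gauge_ge0.
    rewrite lee_wpmul2l ?lee_fin//.
    rewrite -(big_mkord xpredT (fun k => hausdorff_gauge dim (U k))).
    by apply: nneseries_lim_ge => k _ _; exact: hausdorff_gauge_ge0.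
  rewrite sumEFin lee_fin /ek -mulr_sumr ler_piMr ?(ltW e0)//.
  have -> : \sum_(k < B) 2 ^- k.+1 = 1 - 2 ^- B :> R.
    elim: B {wB l m nm main aE} => [|B IH]; first by rewrite big_ord0 expr0 invr1 subrr.
    by rewrite big_ord_recr/= IH exprS invfM; field; rewrite expf_neq0.
  by rewrite gerBl invr_ge0 exprn_ge0.
have [->|Soo] := eqVneq (\sum_(k <oo) hausdorff_gauge dim (U k))%E +oo%E; first by rewrite leey.
have S0 : (0 <= \sum_(k <oo) hausdorff_gauge dim (U k))%E.
  by apply: nneseries_ge0 => k _ _; exact: hausdorff_gauge_ge0.
have Sfin : (\sum_(k <oo) hausdorff_gauge dim (U k))%E \is a fin_num.
  by rewrite ge0_fin_numE// ltey.
move: sumE; rewrite -(fineK Sfin) sumEFin -EFinM -EFinD !lee_fin.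
set S := fine _ => sumE.
have := le_trans aE (ler_wpM2l (ltW K0) sumE).
rewrite mulrDr (_ : K * e = a / 2); last by rewrite /e; field; rewrite gt_eqF.
move=> h; rewrite /c ler_pdivrMr ?mulr_gt0//; lra.
Qed.

End gasket_positivity.

(** * Integration on the gasket *)

Section gasket_integration.
Variables (R : realType) (N : nat) (p : 'I_N -> 'rV[R]_N.-1).
Hypothesis N_ge2 : (2 <= N)%N.
Hypothesis p_dist : forall i j : 'I_N, i != j -> euclid_dist (p i) (p j) = 1.
Variable V : set 'rV[R]_N.-1.
Hypothesis HV : is_gasket p V.

Local Notation point := 'rV[R]_N.-1.
Local Notation H := (hausdorff (gasket_dim R N)).
Local Notation cell w := (cell_map p w @` V).
Local Notation mu := (gasket_measure V).
Local Notation T := (caratheodory_type (gasket_outer V)).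

Let HVE : V = cell [::]. Proof. by rewrite /cell_map/= image_id. Qed.

Let hausdorff_V : (0 < H V)%E /\ (H V < +oo)%E.
Proof.
split; first by rewrite HVE; exact: hausdorff_cell_gt0.
by rewrite [V in H V]HVE (le_lt_trans (hausdorff_cell_le N_ge2 p_dist HV _))// ltey.
Qed.

Let c_gt0 : 0 < (fine (H V))^-1.
Proof. by rewrite invr_gt0 fine_gt0//; case: hausdorff_V => -> ->. Qed.

Lemma gasket_outer_cell_gt0 w : (0 < gasket_outer V (cell w))%E.
Proof.
rewrite /gasket_outer setIidl; first by rewrite mule_gt0// ?lte_fin// hausdorff_cell_gt0.
by move=> _ [x Vx <-]; exact: (V_cell_map HV).
Qed.

Lemma gasket_outer_lty A : (gasket_outer V A < +oo)%E.
Proof.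
have [_ Voo] := hausdorff_V.
apply: (@le_lt_trans _ _ ((fine (H V))^-1%:E * H V)%E).
  by rewrite lee_wpmul2l ?gasket_const_ge0// le_hausdorff//; exact: subIsetr.
by rewrite lte_mul_pinfty// ?lee_fin ?(ltW c_gt0).
Qed.

(** A closed set is where the distance [phi] to it is at most 0. This distance is 1-Lipschitz for
    the sup norm, which the Euclidean distance dominates, so a gap in [phi] is a Euclidean gap. *)
Lemma measurable_closed (C : set point) : closed C ->
  measurable (C : set T).
Proof.
move=> Cc; have [->|/set0P[c0 Cc0]] := eqVneq C set0; first exact: measurable0.
pose D (x : point) : set R := [set `|x - c| | c in C].
have D0 x : has_inf (D x).
  split; first by exists `|x - c0|, c0.
  by exists 0 => _ [c Cc' <-].
have D_le x c : C c -> inf (D x) <= `|x - c|.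
  by move=> Ccc; apply: ge_inf; [by case: (D0 x)|exists c].
pose phi x := inf (D x).
have phiE : C = [set x | phi x <= 0].
  apply/seteqP; split => [x Cx /=|x /= x0].
    by have := D_le x x Cx; rewrite subrr normr0.
  apply: Cc => U /nbhs_ballP[e /= e0 he].
  have [_ [c Ccc <-] ce] : exists2 z, D x z & z < e.
    have [z Dz ze] := inf_adherent e0 (D0 x).
    by exists z => //; move: x0; rewrite /phi; lra.
  by exists c; split => //; apply: he; rewrite -ball_normE.
rewrite phiE; apply: (caratheodory_sublevel (mu := gasket_outer V)).
  exact: gasket_outer_lty.
move=> A B e e0 AB; rewrite /= /gasket_outer -muleDr ?ge0_adde_def ?inE ?hausdorff_ge0//.
rewrite lee_wpmul2l ?gasket_const_ge0// setIUl; apply: (@hausdorff_separated R N.-1 (gasket_dim R N) _ _ e e0).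
move=> x y [Ax _] [By _]; apply: le_trans (norm_le_euclid_dist _ _).
have := AB x y Ax By; suff : phi y - `|x - y| <= phi x by lra.
apply: lb_le_inf => [|_ [c Ccc <-]]; first by case: (D0 x).
have := D_le y c Ccc; have := ler_normD (y - x) (x - c).
by rewrite addrA subrK (distrC y x) /phi; lra.
Qed.

Let mV : measurable (V : set T). Proof. exact/measurable_closed/(V_closed HV). Qed.

Lemma measurable_cell w : measurable (cell w : set T).
Proof.
apply: measurable_closed; apply: compact_closed; first exact: norm_hausdorff.
apply: continuous_compact; last by case: HV.
exact/continuous_subspaceT/cell_map_continuous.
Qed.

Lemma continuous_measurable_fun (u : point -> R) : {within V, continuous u} ->
  measurable_fun (V : set T) u.
Proof.
move=> uc _; apply: (measurability _ (RGenOpens.measurableE R)).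
move=> _ [_ [x [y ->]] <-].
have oxy := @interval_open R (BRight x) (BLeft y) isT isT.
have /continuousP/(_ _ oxy)/open_subspaceP[U oU UE] := uc.
rewrite setIC [X in _.-measurable X](_ : _ = U `&` V); last by rewrite UE.
apply: measurableI => //; rewrite -[U]setCK; apply: measurableC.
  exact/measurable_closed/open_closedC.
exact: mV.
Qed.

Lemma V_continuous_bounded (u : point -> R) : {within V, continuous u} ->
  exists2 M, 0 < M & forall x, V x -> `|u x| <= M.
Proof.
move=> uc; have [_ Vc _] := HV.
have [M [_ hM]] := compact_bounded (continuous_compact uc Vc).
exists (`|M| + 1) => [|x Vx]; first by rewrite ltr_wpDl.
by apply: hM; [rewrite (le_lt_trans (ler_norm M))// ltrDl|exists x].
Qed.

Lemma integrable_weight (b phi : point -> R) : mu.-integrable V (EFin \o b) ->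
  {within V, continuous phi} -> mu.-integrable V (EFin \o (fun x => b x * phi x)).
Proof.
move=> bi pc; have [M M0 hM] := V_continuous_bounded pc.
have pb : [bounded phi x | x in (V : set T)].
  exists M; split; first exact: num_real.
  by move=> k Mk x Vx /=; rewrite (le_trans (hM x Vx))// ltW.
exact: (integrableMl mV bi (continuous_measurable_fun pc) pb).
Qed.

Lemma continuous_integrable (u : point -> R) : {within V, continuous u} ->
  mu.-integrable V (EFin \o u).
Proof.
move=> uc; have [M M0 hM] := V_continuous_bounded uc.
apply: measurable_bounded_integrable => //.
- exact: gasket_outer_lty.
- exact: continuous_measurable_fun.
exists M; split; first exact: num_real.
by move=> k Mk x Vx /=; rewrite (le_trans (hM x Vx))// ltW.
Qed.

Section weighted_integral.
Variable b : point -> R.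
Hypothesis b_int : mu.-integrable V (EFin \o b).
Hypothesis b_le0 : {ae mu, forall x, V x -> b x <= 0}.

Definition weighted (phi : point -> R) : R := \int[mu]_(x in V) (b x * phi x).

Lemma weightedD (phi psi : point -> R) c : {within V, continuous phi} ->
  {within V, continuous psi} ->
  weighted (fun x => phi x + c * psi x) = weighted phi + c * weighted psi.
Proof.
move=> pc qc; rewrite /weighted -RintegralZl//; last exact: integrable_weight.
rewrite -RintegralD//; last 2 first.
- exact: integrable_weight.
- exact: (integrableZl mV c (integrable_weight b_int qc)).
by apply: eq_Rintegral => x _; ring.
Qed.

Lemma weightedZ (phi : point -> R) c : {within V, continuous phi} ->
  weighted (fun x => c * phi x) = c * weighted phi.
Proof.
move=> pc; rewrite /weighted -RintegralZl//; last exact: integrable_weight.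
by apply: eq_Rintegral => x _; ring.
Qed.

Lemma weighted_bounded : exists2 A, 0 < A & forall (phi : point -> R) k,
  {within V, continuous phi} -> (forall x, V x -> `|phi x| <= k) ->
  `|weighted phi| <= A * k.
Proof.
pose A := \int[mu]_(x in V) `|b x|; have A0 : 0 <= A by exact: Rintegral_ge0.
have bi : mu.-integrable V (EFin \o (fun x => `|b x|)) by exact: integrable_norm.
have [[x0 Vx0] _ _] := HV.
exists (A + 1) => [|phi k pc pk]; first by rewrite ltr_wpDl.
have k0 : 0 <= k by apply: le_trans (pk x0 Vx0).
apply: le_trans (le_normr_Rintegral mV (integrable_weight b_int pc)) _.
apply: (@le_trans _ _ (A * k)); last by rewrite ler_wpM2r// lerDl.
rewrite /A -RintegralZr//; apply: le_Rintegral => //.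
- exact/integrable_norm/integrable_weight.
- under [X in _.-integrable _ (EFin \o X)]eq_fun do rewrite mulrC.
  exact: (integrableZl mV k bi).
- by move=> x Vx; rewrite normrM ler_wpM2l// pk.
Qed.

(** The comparison of integrals is pointwise, whereas [b <= 0] holds almost everywhere; truncating
    the integrand at 0 changes it only on a null set. *)
Lemma weighted_le0 (phi : point -> R) : {within V, continuous phi} ->
  (forall x, V x -> 0 <= phi x) -> weighted phi <= 0.
Proof.
move=> pc p0; pose h x := Num.min (b x * phi x) 0.
have ip := integrable_weight b_int pc.
have mh : measurable_fun (V : set T) (fun x => b x * phi x).
  by have /integrableP[/measurable_EFinP] := ip.
suff -> : weighted phi = \int[mu]_(x in V) h x.
  apply: (@le_trans _ _ (\int[mu]_(x in V) (0 : R))); last first.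
    by rewrite Rintegral_cst// mul0r.
  apply: le_Rintegral => //; last by move=> x Vx; rewrite ge_min lexx orbT.
    apply: (le_integrable mV _ _ ip) => [|x Vx /=].
      by apply/measurable_EFinP/measurable_minr => //; exact: measurable_cst.
    by rewrite lee_fin /h minEle; case: ifP => // _; rewrite normr0.
  exact: integrable0.
have mh' : measurable_fun (V : set T) (EFin \o h).
  by apply/measurable_EFinP/measurable_minr => //; exact: measurable_cst.
have mf' := measurable_int mu ip.
rewrite /weighted /Rintegral; apply: (congr1 fine).
have ae : ae_eq mu V (EFin \o (fun x => b x * phi x)) (EFin \o h).
  apply: negligibleS b_le0 => x; apply: contra_not => bx Vx; congr EFin.
  by rewrite /h; apply/esym/min_idPl; rewrite mulr_le0_ge0 ?bx ?p0.
exact: (@ae_eq_integral _ _ _ mu V (EFin \o h) _ mV mf' mh' ae).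
Qed.

End weighted_integral.

Lemma cell_near x (U : set point) : V x -> nbhs x U ->
  exists w, forall y, V y -> U (cell_map p w y).
Proof.
move=> Vx /nbhs_ballP[e /= e0 he]; have [n nE] := cell_small HV e0.
have [w [z [wn Vz xE]]] := V_cellP HV n Vx; exists w => y Vy.
by apply: he; rewrite -ball_normE /= xE; apply: nE; rewrite ?wn.
Qed.

(** Near [x0], [phi] is at least [c]; there some [z] has [g z < 0], and a small cell near [z] has
    [g <= g z / 2]. Its positive mass gives [d]. Both constants are fixed before [psi], as is needed
    when [psi] depends on a parameter. *)
Lemma weighted_coercive (g phi : point -> R) x0 : {within V, continuous g} ->
  (forall x, V x -> g x <= 0) ->
  (forall U : set point, open U -> U `&` V !=set0 -> exists x, (U `&` V) x /\ g x <> 0) ->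
  {within V, continuous phi} -> V x0 -> 0 < phi x0 ->
  exists c d, [/\ 0 < c, 0 < d & forall (psi : point -> R) (k : R),
    {within V, continuous psi} -> (forall x, V x -> 0 <= psi x) -> 0 <= k ->
    (forall x, V x -> c <= phi x -> k <= psi x) -> weighted g psi <= - (d * k)].
Proof.
move=> gc g0 gn pc Vx0 px0; pose c := phi x0 / 2.
have c0 : 0 < c by rewrite divr_gt0.
have /within_continuousP pc' := pc; have /within_continuousP gc' := gc.
pose S : set point := [set y | V y -> `|phi x0 - phi y| <= c].
pose U := S^°; have oU : open U by exact: open_interior.
have Ux0 : U x0 by exact: pc' x0 Vx0 c c0.
have hU : U `<=` S by exact: interior_subset.
have [z [[Uz Vz] gz]] := gn U oU (ex_intro _ x0 (conj Ux0 Vx0)).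
have gz0 : 0 < - g z / 2.
  by rewrite divr_gt0// oppr_gt0 lt_neqAle g0// andbT; exact/eqP.
have Unz : nbhs z U by apply: open_nbhs_nbhs.
have [w hw] := cell_near Vz (@filterI _ (nbhs z) _ _ _ Unz (gc' z Vz _ gz0)).
pose m := fine (mu (cell w)); have m0 : 0 < m.
  by apply: fine_gt0; rewrite gasket_outer_cell_gt0 gasket_outer_lty.
exists c, (- g z / 2 * m); split => //; first exact: mulr_gt0.
move=> psi k psic psi0 k0 hk.
have E x : cell w x -> g x * psi x <= - (- g z / 2 * k).
  move=> [y Vy <-]; have Vwy := V_cell_map HV w Vy.
  have [Uy /(_ Vwy)] := hw y Vy; rewrite ler_norml => /andP[gl _].
  have : k <= psi (cell_map p w y).
    apply: hk => //; have /(_ Vwy) := hU _ Uy; rewrite ler_norml /c => /andP[_]; lra.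
  move=> kpsi; set t := psi _ in kpsi *.
  have : g (cell_map p w y) <= g z / 2 by lra.
  by set s := g (cell_map p w y); move=> sg; nra.
have mE := measurable_cell w.
have iE : mu.-integrable V (EFin \o (fun x => \1_(cell w) x : R)).
  have mVoo : (mu V < +oo)%E by exact: gasket_outer_lty.
  apply: (@measurable_bounded_integrable _ _ _ mu _ V mV mVoo).
    exact: (@measurable_indic _ T R V (cell w) mE).
  exists 1; split; first exact: num_real.
  move=> r r1 x Vx /=; rewrite indicE.
  by case: (x \in _); rewrite ?normr1 ?normr0 ?(ltW r1)//; lra.
have -> : - (- g z / 2 * m * k) =
    \int[mu]_(x in V) (- (- g z / 2 * k) * \1_(cell w) x).
  rewrite RintegralZl// /Rintegral integral_indic// setIidl; last first.
    by move=> _ [x Vx <-]; exact: (V_cell_map HV).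
  by rewrite -/m; ring.
apply: le_Rintegral => //.
- exact: (integrable_weight (continuous_integrable gc) psic).
- exact: (integrableZl mV _ iE).
move=> x Vx; rewrite indicE; have [/set_mem Ex|_] := boolP (x \in cell w).
  by rewrite mulr1; exact: E.
by rewrite mulr0 mulr_le0_ge0 ?g0 ?psi0.
Qed.

End gasket_integration.

(** * Primitive of the nonlinearity *)

Section continuous_real_function.
Variables (R : realType) (f : R -> R).
Hypothesis f_cont : continuous f.

Lemma continuous_itv_bounded (M : R) : exists2 L, 0 < L &
  forall s, `|s| <= M -> `|f s| <= L.
Proof.
have c : compact (f @` `[- M, M]).
  by apply: continuous_compact; [exact: continuous_subspaceT|exact: segment_compact].
have [L [_ hL]] := compact_bounded c.
exists (`|L| + 1) => [|s sM]; first by rewrite ltr_wpDl.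
apply: hL; first by rewrite (le_lt_trans (ler_norm L))// ltrDl.
by exists s => //=; rewrite in_itv/= -ler_norml.
Qed.

(** Slightly more than Heine's theorem on [[-M, M]]: the point [s + h] may leave the interval. *)
Lemma continuous_itv_uniform (M e : R) : 0 < e -> exists2 d, 0 < d &
  forall s h, `|s| <= M -> `|h| <= d -> `|f (s + h) - f s| <= e.
Proof.
move=> e0; have /compact_near_coveringP : compact `[- M, M]%classic by exact: segment_compact.
move=> /(_ R (0^'+) (fun d s => forall h, `|h| <= d -> `|f (s + h) - f s| <= e)).
move=> near_cover.
have /filter_ex[d [hd d0]] : \forall d \near 0^'+,
    (`[- M, M] `<=` (fun s => forall h, `|h| <= d -> `|f (s + h) - f s| <= e)) /\ 0 < d.
  apply: filterI; last exact: nbhs_right_gt; apply: near_cover.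
  move=> x _; have e2 : 0 < e / 2 by rewrite divr_gt0.
  have /cvgrPdist_le/(_ _ e2)/nbhs_ballP[n /= n0 hn] := @f_cont x.
  have n2 : 0 < n / 2 by rewrite divr_gt0.
  exists (ball x (n / 2), [set d | 0 < d < n / 2]).
    split; first exact: nbhsx_ballx.
    near=> d; apply/andP; split; first by near: d; exact: nbhs_right_gt.
    by near: d; exact: nbhs_right_lt.
  move=> [y d] /= [xy /andP[d0 dn]] h hd.
  have h1 : `|f x - f (y + h)| <= e / 2.
    apply: hn; move: xy; rewrite -!ball_normE /= opprD addrA => xy.
    by rewrite (le_lt_trans (ler_normB _ _))//; lra.
  have h2 : `|f x - f y| <= e / 2.
    by apply: hn; move: xy; rewrite -!ball_normE /=; lra.
  by move: h1 h2; rewrite !ler_norml => /andP[? ?] /andP[? ?]; apply/andP; split; lra.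
by exists d => // s h sM; apply: hd; rewrite /= in_itv/= -ler_norml.
Unshelve. all: by end_near.
Qed.

Lemma primitive_le0 (x : R) : x <= 0 -> primitive f x = 0.
Proof.
rewrite /primitive le_eqVlt => /orP[/eqP ->|x0]; first by rewrite set_itv1 Rintegral_set1.
by rewrite set_itv_ge ?Rintegral_set0// bnd_simp -ltNge.
Qed.

Lemma primitive_increment (s t m M : R) : 0 <= s -> s <= t ->
  (forall x, s <= x <= t -> m <= f x <= M) ->
  m * (t - s) <= primitive f t - primitive f s <= M * (t - s).
Proof.
move=> s0 st hf.
have ci a b : lebesgue_measure.-integrable `[a, b] (EFin \o f).
  by apply: continuous_compact_integrable; [exact: segment_compact|exact: continuous_subspaceT].
have -> : primitive f t - primitive f s = \int[lebesgue_measure]_(x in `]s, t]) f x.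
  by rewrite /primitive Rintegral_itvB// bnd_simp.
have mI : measurable (`]s, t] : set R) by exact: measurable_itv.
have fi : lebesgue_measure.-integrable `]s, t] (EFin \o f).
  by apply: integrableS (ci s t) => //; apply: subset_itvr; rewrite bnd_simp.
have cstE c : \int[lebesgue_measure]_(x in `]s, t]) (c : R) = c * (t - s).
  rewrite Rintegral_cst//; congr (_ * _).
  apply: (etrans (congr1 fine (@lebesgue_measure_itv R `]s, t]))); rewrite /= lte_fin.
  by case: ltP => //= ts; rewrite (le_anti (introT andP (conj st ts))) subrr.
have ic c : lebesgue_measure.-integrable `]s, t] (EFin \o (fun _ : R => c : R)).
  have i1 : lebesgue_measure.-integrable `[s, t] (EFin \o (fun _ : R => c : R)).
    apply: continuous_compact_integrable; first exact: segment_compact.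
    by apply: continuous_subspaceT => x; exact: cvg_cst.
  by apply: integrableS i1 => //; apply: subset_itvr; rewrite bnd_simp.
rewrite -!cstE; apply/andP; split; apply: le_Rintegral => // x /=; rewrite in_itv/= => /andP[sx xt].
- by have /andP[] := hf x (introT andP (conj (ltW sx) xt)).
- by have /andP[] := hf x (introT andP (conj (ltW sx) xt)).
Qed.

End continuous_real_function.

Section signed_primitive.
Variables (R : realType) (f : R -> R).
Hypothesis f_cont : continuous f.

(** [primitive f] is 0 on the negative axis, where its interval is empty. Reflecting [f] restores an
    antiderivative on the whole line, needed because functions in the ball may change sign. *)
Definition signed_primitive (x : R) : R :=
  primitive f x - primitive (f \o -%R) (- x).

Local Notation F := signed_primitive.

Lemma signed_primitiveE (x : R) : 0 <= x -> F x = primitive f x.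
Proof. by move=> x0; rewrite /F (@primitive_le0 _ _ (- x)) ?subr0// oppr_le0. Qed.

Lemma signed_primitive0 : F 0 = 0.
Proof. by rewrite signed_primitiveE// primitive_le0. Qed.

Lemma signed_primitive_increment (s t m M : R) : s <= t ->
  (forall x, s <= x <= t -> m <= f x <= M) ->
  m * (t - s) <= F t - F s <= M * (t - s).
Proof.
have pos a b : 0 <= a -> a <= b -> (forall x, a <= x <= b -> m <= f x <= M) ->
    m * (b - a) <= F b - F a <= M * (b - a).
  move=> a0 ab h; rewrite !signed_primitiveE//; last exact: le_trans ab.
  exact: primitive_increment.
have neg a b : b <= 0 -> a <= b -> (forall x, a <= x <= b -> m <= f x <= M) ->
    m * (b - a) <= F b - F a <= M * (b - a).
  move=> b0 ab h; rewrite /F !(@primitive_le0 _ f)//; last exact: le_trans b0.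
  have fNc : continuous (f \o -%R).
    by move=> x; apply: continuous_comp; [exact: opp_continuous|exact: f_cont].
  have := @primitive_increment _ _ fNc (- b) (- a) m M.
  rewrite oppr_ge0 lerN2 => /(_ b0 ab)/=.
  rewrite !sub0r !opprK (addrC (- a)) [X in _ <= X <= _]addrC; apply => x /andP[bx xa].
  by apply: h; rewrite lerNr xa lerNl bx.
move=> st h; have [s0|s0] := leP 0 s; first exact: pos.
have [t0|t0] := leP t 0; first exact: neg.
have /andP[h1 h2] : m * (t - 0) <= F t - F 0 <= M * (t - 0).
  apply: pos => //; first exact: ltW.
  by move=> x /andP[x0 xt]; apply: h; rewrite xt (le_trans (ltW s0)).
have /andP[h3 h4] : m * (0 - s) <= F 0 - F s <= M * (0 - s).
  apply: neg => //; first exact: ltW.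
  by move=> x /andP[x0 xt]; apply: h; rewrite x0 (le_trans xt)// ltW.
by apply/andP; split; lra.
Qed.

(** Uniform in [s], so the expansion can be integrated over V along a bounded function. *)
Lemma signed_primitive_taylor (M e : R) : 0 < e -> exists2 d, 0 < d &
  forall s h, `|s| <= M -> `|h| <= d -> `|F (s + h) - F s - h * f s| <= e * `|h|.
Proof.
move=> e0; have [d d0 hd] := continuous_itv_uniform f_cont M e0.
exists d => // s h sM hh.
have near_s x : `|x - s| <= `|h| -> f s - e <= f x <= f s + e.
  move=> xs; have := hd s (x - s) sM (le_trans xs hh).
  by rewrite subrKC ler_norml => /andP[? ?]; apply/andP; split; lra.
have [h0|h0] := leP 0 h.
  have := @signed_primitive_increment s (s + h) (f s - e) (f s + e).
  rewrite lerDl addrAC subrr add0r => /(_ h0) H.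
  rewrite ler_norml (ger0_norm h0); have /andP[h1 h2] : (f s - e) * h <= F (s + h) - F s <= (f s + e) * h.
    apply: H => x /andP[xs xh]; apply: near_s; rewrite ler_norml (ger0_norm h0).
    by apply/andP; split; lra.
  by apply/andP; split; lra.
have := @signed_primitive_increment (s + h) s (f s - e) (f s + e).
rewrite gerDl opprD addrA subrr add0r => /(_ (ltW h0)) H.
rewrite ler_norml (ltr0_norm h0); have /andP[h1 h2] : (f s - e) * - h <= F s - F (s + h) <= (f s + e) * - h.
  apply: H => x /andP[xs xh]; apply: near_s; rewrite ler_norml (ltr0_norm h0).
  by apply/andP; split; lra.
by apply/andP; split; lra.
Qed.

Lemma signed_primitive_lipschitz (M : R) : exists2 L, 0 < L &
  forall s t, `|s| <= M -> `|t| <= M -> `|F s - F t| <= L * `|s - t|.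
Proof.
have [L L0 hL] := continuous_itv_bounded f_cont M; exists L => // s t.
wlog st : s t / s <= t.
  move=> W sM tM; have [|/ltW] := leP s t => st; first exact: W.
  by rewrite distrC (distrC s); exact: W.
move=> sM tM; have := @signed_primitive_increment s t (- L) L st.
rewrite distrC (distrC s) (@ger0_norm _ (t - s)) ?subr_ge0// ler_norml -mulNr; apply.
move=> x /andP[sx xt]; rewrite -ler_norml; apply: hL.
by move: sM tM; rewrite !ler_norml => /andP[? ?] /andP[? ?]; apply/andP; split; lra.
Qed.

Hypothesis f_ge0 : forall t, 0 <= f t.

Lemma signed_primitive_nondecreasing (s t : R) : s <= t -> F s <= F t.
Proof.
move=> st; have [L _ hL] := continuous_itv_bounded f_cont (`|s| + `|t|).
suff /andP[] : 0 * (t - s) <= F t - F s <= L * (t - s).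
  by rewrite mul0r subr_ge0.
apply: signed_primitive_increment => // x /andP[sx xt].
rewrite f_ge0 (le_trans (ler_norm _))// hL// ler_norml.
have := ler_norm t; have := ler_norm (- s); rewrite normrN.
have := normr_ge0 s; have := normr_ge0 t => ? ? ? ?.
by apply/andP; split; lra.
Qed.

End signed_primitive.

(** * The variational argument *)

Section within_continuity.
Variables (R : realType) (n : nat) (V : set 'rV[R]_n).
Implicit Types u v : 'rV[R]_n -> R.

Lemma within_continuous_comp_fun (h : R -> R) u : continuous h ->
  {within V, continuous u} -> {within V, continuous (fun x => h (u x))}.
Proof. by move=> hc uc x; exact: (continuous_comp (uc x) (hc _)). Qed.

Lemma within_continuous_mul u v : {within V, continuous u} ->
  {within V, continuous v} -> {within V, continuous (fun x => u x * v x)}.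
Proof. by move=> uc vc x; exact: (continuousM (uc x) (vc x)). Qed.

Lemma within_continuous_add u v : {within V, continuous u} ->
  {within V, continuous v} -> {within V, continuous (fun x => u x + v x)}.
Proof. by move=> uc vc x; exact: (continuousD (uc x) (vc x)). Qed.

Lemma within_continuous_cst (c : R) : {within V, continuous (fun=> c)}.
Proof. by move=> x; exact: cvg_cst. Qed.

End within_continuity.

(** Take [e = |D| / 4] and [t] of sign opposite to [D], so small that the quadratic term is at most
    [|t| * |D| / 4]; the expression is then at most [- |t| * |D| / 2]. *)
Lemma vanishing_first_order (R : realFieldType) (D Q : R) :
  (forall e, 0 < e -> exists2 t0, 0 < t0 & forall t, `|t| <= t0 ->
     0 <= t * D + t ^+ 2 * Q + e * `|t|) -> D = 0.
Proof.
move=> h; apply/eqP; apply/negPn/negP => D0.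
have aD : 0 < `|D| by rewrite normr_gt0.
have e0 : 0 < `|D| / 4 by rewrite divr_gt0.
have [t0 t00 ht] := h _ e0.
have Q1 : 0 < `|Q| + 1 by rewrite ltr_wpDl.
pose s := Num.min t0 (`|D| / (4 * (`|Q| + 1))).
have s0 : 0 < s by rewrite lt_min t00 divr_gt0// mulr_gt0.
have s1 : s <= t0 by rewrite ge_min lexx.
have s2 : s * (4 * (`|Q| + 1)) <= `|D|.
  by rewrite -ler_pdivlMr ?mulr_gt0// ge_min lexx orbT.
have := ler_norm Q => Qn.
have [Dp|Dn] := ltP 0 D.
  have := ht (- s); rewrite normrN (gtr0_norm s0) => /(_ s1).
  rewrite (gtr0_norm Dp) in s2 *; move: s2 Qn => s2 Qn.
  have : s * Q <= D / 4 by nra.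
  by nra.
have {}Dn : D < 0 by rewrite lt_neqAle D0.
have := ht s; rewrite (gtr0_norm s0) => /(_ s1).
rewrite (ltr0_norm Dn) in s2 *.
have : s * Q <= - D / 4 by nra.
by nra.
Qed.

Section variational.
Variables (R : realType) (N : nat) (p : 'I_N -> 'rV[R]_N.-1).
Variables (V : set 'rV[R]_N.-1) (a g : 'rV[R]_N.-1 -> R) (f : R -> R).
Hypothesis N_ge2 : (2 <= N)%N.
Hypothesis p_dist : forall i j : 'I_N, i != j -> euclid_dist (p i) (p j) = 1.
Hypothesis HV : is_gasket p V.
Hypothesis a_L1 : (gasket_measure V).-integrable V (EFin \o a).
Hypothesis a_le0 : {ae gasket_measure V, forall x, V x -> a x <= 0}.
Hypothesis g_cont : {within V, continuous g}.
Hypothesis g_le0 : forall x, V x -> g x <= 0.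
Hypothesis g_neq0 : forall U : set 'rV[R]_N.-1, open U -> U `&` V !=set0 ->
  exists x, (U `&` V) x /\ g x <> 0.
Hypothesis f_cont : continuous f.
Hypothesis f_ge0 : forall t, 0 <= f t.

Local Notation point := 'rV[R]_N.-1.
Implicit Types (b u v phi psi : point -> R).
Local Notation Ia := (weighted V a).
Local Notation Ig := (weighted V g).
Local Notation F := (signed_primitive f).
Local Notation E u := (fine (energy p u)).
Local Notation K := (2 * N%:R + 3).

Let g_L1 := continuous_integrable N_ge2 p_dist HV g_cont.
Let g_ae : {ae gasket_measure V, forall x, V x -> g x <= 0}.
Proof. by apply: aeW => x; exact: g_le0. Qed.

Let F_cont : continuous F.
Proof.
move=> x; apply/cvgrPdist_le => e e0.
have [L L0 hL] := signed_primitive_lipschitz f_cont (`|x| + 1).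
have eL : 0 < e / L by rewrite divr_gt0.
have /cvgrPdist_le near_x : id @ x --> x by exact: cvg_id.
near=> y; apply: le_trans (hL x y _ _) _.
- by rewrite lerDl.
- have xy : `|x - y| <= 1 by near: y; exact: near_x.
  by have := ler_normD (y - x) x; rewrite subrK distrC; lra.
rewrite -ler_pdivlMl// mulrC; near: y; exact: near_x.
Unshelve. all: by end_near.
Qed.

Definition potential (lambda : R) (u : point -> R) : R :=
  lambda * Ig (fun x => F (u x)) - 2^-1 * Ia (fun x => u x ^+ 2).

Let sqr_cont u : {within V, continuous u} -> {within V, continuous (fun x => u x ^+ 2)}.
Proof.
move=> uc; apply: (@within_continuous_comp_fun _ _ _ (fun t => t ^+ 2) u) => //.
exact: exprn_continuous.
Qed.

Let FU_cont u : {within V, continuous u} -> {within V, continuous (fun x => F (u x))}.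
Proof. exact: (@within_continuous_comp_fun _ _ _ F u F_cont). Qed.

Let weighted_diff b phi psi : (gasket_measure V).-integrable V (EFin \o b) ->
  {within V, continuous phi} -> {within V, continuous psi} ->
  weighted V b phi - weighted V b psi = weighted V b (fun x => phi x - psi x).
Proof.
move=> bi pc qc; rewrite -mulN1r -(weightedD N_ge2 p_dist HV bi)//.
by congr weighted; apply/funext => x; rewrite mulN1r.
Qed.

(** Bounds the functional below on the ball, carries the potential through uniform limits, and, with
    [gamma = 0], evaluates it on functions that vanish on V but perhaps not elsewhere. *)
Lemma potential_lipschitz lambda gamma : 0 <= gamma -> exists2 C, 0 < C &
  forall u v k, {within V, continuous u} -> {within V, continuous v} ->
  (forall x, V x -> `|u x| <= gamma) -> (forall x, V x -> `|v x| <= gamma) ->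
  (forall x, V x -> `|u x - v x| <= k) ->
  `|potential lambda u - potential lambda v| <= C * k.
Proof.
move=> gamma0; have [A A0 hA] := weighted_bounded N_ge2 p_dist HV a_L1.
have [G G0 hG] := weighted_bounded N_ge2 p_dist HV g_L1.
have [L L0 hL] := signed_primitive_lipschitz f_cont gamma.
exists (`|lambda| * (G * L) + A * gamma + 1).
  by rewrite ltr_wpDl// addr_ge0// ?mulr_ge0// ltW.
move=> u v k uc vc ug vg uv.
have [[x0 Vx0] _ _] := HV; have k0 : 0 <= k by apply: le_trans (uv x0 Vx0).
have h1 : `|Ig (fun x => F (u x)) - Ig (fun x => F (v x))| <= G * (L * k).
  rewrite weighted_diff//; [|exact: FU_cont..]; apply: hG.
    exact: (within_continuousB (FU_cont uc) (FU_cont vc)).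
  move=> x Vx; apply: le_trans (hL _ _ (ug x Vx) (vg x Vx)) _.
  by rewrite ler_pM2l// uv.
have h2 : `|Ia (fun x => u x ^+ 2) - Ia (fun x => v x ^+ 2)| <= A * (2 * gamma * k).
  rewrite weighted_diff//; [|exact: sqr_cont..]; apply: hA.
    exact: (within_continuousB (sqr_cont uc) (sqr_cont vc)).
  move=> x Vx; rewrite subr_sqr normrM mulrC; apply: ler_pM => //; last exact: uv.
  by rewrite (le_trans (ler_normD _ _))// mulr_natl mulr2n lerD ?ug ?vg.
have -> : potential lambda u - potential lambda v =
    lambda * (Ig (fun x => F (u x)) - Ig (fun x => F (v x)))
    - 2^-1 * (Ia (fun x => u x ^+ 2) - Ia (fun x => v x ^+ 2)).
  rewrite /potential; move: (Ig _) (Ig _) (Ia _) (Ia _) => *; ring.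
apply: le_trans (ler_normB _ _) _; rewrite !normrM (@ger0_norm _ 2^-1)//.
have : `|lambda| * `|Ig (fun x => F (u x)) - Ig (fun x => F (v x))| <= `|lambda| * (G * (L * k)).
  by rewrite ler_wpM2l.
by lra.
Qed.

Let energy_pre0 m v : energy_pre p m (fun=> 0) v = 0.
Proof. by rewrite /energy_pre fsbig1 ?mulr0// => z _; rewrite subrr mul0r. Qed.

Let E0 : energy p (fun=> 0 : R) = 0%E.
Proof.
rewrite /energy; under eq_fun do rewrite energy_pre0.
by apply: cvg_lim => //; exact: cvg_cst.
Qed.

Let form0 v : energy_form p (fun=> 0) v = 0.
Proof.
rewrite /energy_form; under eq_fun do rewrite energy_pre0.
by apply: cvg_lim; [exact: Rhausdorff|exact: cvg_cst].
Qed.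

Let H01_0 : H01 p V (fun=> 0).
Proof. by split=> //; [exact: within_continuous_cst|rewrite E0]. Qed.

Let potential0 lambda : potential lambda (fun=> 0) = 0.
Proof.
have cE b : (gasket_measure V).-integrable V (EFin \o b) -> weighted V b (fun=> 0) = 0.
  move=> bi; have := weightedZ N_ge2 p_dist HV bi 0 (@within_continuous_cst _ _ V 0).
  by under eq_fun do rewrite mul0r; rewrite mul0r.
rewrite /potential; under eq_fun do rewrite signed_primitive0.
by rewrite expr0n/= !cE// !mulr0 subrr.
Qed.

Let K_gt0 : 0 < K :> R. Proof. by rewrite ltr_wpDl// mulr_ge0. Qed.

Let E_sup u gamma x : H01 p V u -> 0 <= gamma -> E u <= gamma ^+ 2 / K ^+ 2 ->
  V x -> `|u x| <= gamma.
Proof.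
move=> Hu g0 Eu Vx; apply: le_trans (H01_sup N_ge2 p_dist HV Hu Vx) _.
rewrite -ler_pdivlMl// /H01_norm -[leRHS]ger0_norm ?mulr_ge0 ?invr_ge0 ?(ltW K_gt0)//.
by rewrite -sqrtr_sqr ler_sqrt ?sqr_ge0// exprMn exprVn mulrC.
Qed.

Definition functional (lambda : R) (u : point -> R) : R :=
  2^-1 * E u + potential lambda u.

Lemma functional_minimizer lambda gamma : 0 < gamma ->
  exists u, [/\ H01 p V u, E u <= gamma ^+ 2 / K ^+ 2 &
    forall v, H01 p V v -> E v <= gamma ^+ 2 / K ^+ 2 ->
      functional lambda u <= functional lambda v].
Proof.
move=> gamma0; set r := _ / _; have r0 : 0 <= r by rewrite divr_ge0 ?sqr_ge0.
have [C C0 hC] := potential_lipschitz lambda (ltW gamma0).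
have uc u : H01 p V u -> {within V, continuous u} by case.
pose S := [set functional lambda v | v in [set v | H01 p V v /\ E v <= r]].
have S_inf : has_inf S.
  split; first by exists (functional lambda (fun=> 0)), (fun=> 0) => //; rewrite /= E0.
  exists (- (C * gamma)) => _ [v [Hv Ev] <-].
  have vg x : V x -> `|v x| <= gamma by exact: (E_sup Hv (ltW gamma0) Ev).
  have h : `|potential lambda v| <= C * gamma.
    rewrite -[potential _ _]subr0 -(potential0 lambda).
    apply: hC => //; [exact: uc|exact: within_continuous_cst|..] => x Vx.
      by rewrite normr0 ltW.
    by rewrite subr0 vg.
  have := energy_fine_ge0 N_ge2 p_dist HV (H01_finite N_ge2 p_dist HV Hv).
  by move: h; rewrite ler_norml /functional => /andP[]; lra.
pose i0 := inf S.
have ex_min n : exists v, [/\ H01 p V v, E v <= r & functional lambda v < i0 + n.+1%:R^-1].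
  have n0 : 0 < n.+1%:R^-1 :> R by rewrite invr_gt0.
  by have [_ [v [Hv Ev] <-] lv] := inf_adherent n0 S_inf; exists v.
have [U hU] := @choice _ _ _ ex_min.
have HU n : H01 p V (U n) by case: (hU n).
have EU n : E (U n) <= r by case: (hU n).
have [u hu] := H01_compact N_ge2 p_dist HV HU EU.
have [Hu Eu] : H01 p V u /\ E u <= r.
  apply: (H01_uniform_limit N_ge2 p_dist HV) => e e0.
  have [n _ hn] := hu e 0%N e0; exists (U n); split=> //.
  by rewrite (le_trans (EU n))// lerDl ltW.
have ug x : V x -> `|u x| <= gamma by exact: (E_sup Hu (ltW gamma0) Eu).
(* The first use of [H01_uniform_limit] puts [u] in the ball; this second one, with the bound that
   minimality imposes on the energies of [U n], is lower semicontinuity of the functional. *)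
have [_ Eu2] : H01 p V u /\ E u <= 2 * (i0 - potential lambda u).
  apply: (H01_uniform_limit N_ge2 p_dist HV) => e e0.
  have e1 : 0 < Num.min e (e / (4 * C)) by rewrite lt_min e0 divr_gt0// mulr_gt0.
  have [n0 n0E] : exists n0 : nat, n0.+1%:R^-1 <= e / 4 :> R.
    have e4 : 0 < e / 4 by rewrite divr_gt0.
    exists (Num.bound (e / 4)^-1); rewrite -[leRHS]invrK lef_pV2 ?posrE ?invr_gt0//.
    rewrite (le_trans (ltW (archi_boundP _)))// ?invr_ge0 ?(ltW e4)//.
    by rewrite ler_nat.
  have [n n0n hn] := hu _ n0 e1; exists (U n); split=> //.
    by move=> x Vx; rewrite (le_trans (hn x Vx))// ge_min lexx.
  have Ug x : V x -> `|U n x| <= gamma by exact: (E_sup (HU n) (ltW gamma0) (EU n)).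
  have /ler_normlP[h1 h2] := hC _ _ _ (uc _ (HU n)) (uc _ Hu) Ug ug hn.
  have h3 : C * Num.min e (e / (4 * C)) <= e / 4.
    have -> : e / 4 = C * (e / (4 * C)) by field; rewrite gt_eqF.
    by rewrite ler_pM2l// ge_min lexx orbT.
  have [_ _] := hU n; rewrite /functional.
  have : n.+1%:R^-1 <= e / 4.
    by rewrite (le_trans _ n0E)// lef_pV2 ?posrE// ler_nat.
  move: h1 h3; move: (C * _) (potential _ _) (potential _ _) (E _) (n.+1%:R^-1).
  by move=> *; lra.
exists u; split=> // v Hv Ev; apply: (@le_trans _ _ i0).
  by rewrite /functional; lra.
by apply: ge_inf; [case: S_inf|exists v].
Qed.

Let cst1 : {within V, continuous (fun=> 1 : R)}.
Proof. exact: within_continuous_cst. Qed.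

Lemma weighted1_lt0 : Ig (fun=> 1) < 0.
Proof.
have [[x0 Vx0] _ _] := HV.
have [c [d [_ d0 h]]] := weighted_coercive N_ge2 p_dist HV g_cont g_le0 g_neq0 cst1 Vx0 ltr01.
have := h (fun=> 1) 1 cst1 (fun _ _ => ler01) ler01 (fun _ _ _ => lexx _).
by move=> /le_lt_trans; apply; rewrite mulr1 oppr_lt0.
Qed.

Lemma weighted_primitive_ge gamma u : {within V, continuous u} ->
  (forall x, V x -> `|u x| <= gamma) -> F gamma * Ig (fun=> 1) <= Ig (fun x => F (u x)).
Proof.
move=> uc ug; rewrite -(weightedZ N_ge2 p_dist HV g_L1)// -subr_le0.
have gc : {within V, continuous (fun=> F gamma * 1)} by exact: within_continuous_cst.
rewrite weighted_diff//; last exact: FU_cont.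
apply: (weighted_le0 N_ge2 p_dist HV g_L1 g_ae).
  exact: (within_continuousB gc (FU_cont uc)).
move=> x Vx; rewrite mulr1 subr_ge0; apply: signed_primitive_nondecreasing => //.
by rewrite (le_trans (ler_norm _))// ug.
Qed.

Lemma functional_le0_energy lambda gamma u : 0 <= lambda -> 0 <= gamma ->
  H01 p V u -> E u <= gamma ^+ 2 / K ^+ 2 -> functional lambda u <= 0 ->
  E u <= 2 * lambda * F gamma * - Ig (fun=> 1).
Proof.
move=> l0 g0 Hu Eu; have uc : {within V, continuous u} by case: Hu.
have ug x : V x -> `|u x| <= gamma by exact: (E_sup Hu g0 Eu).
have h1 := ler_wpM2l l0 (weighted_primitive_ge uc ug).
have h2 : Ia (fun x => u x ^+ 2) <= 0.
  by apply: (weighted_le0 N_ge2 p_dist HV a_L1 a_le0); [exact: sqr_cont|move=> x _; exact: sqr_ge0].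
rewrite /functional /potential; move: h1 h2.
move: (Ig (fun=> 1)) (Ig _) (Ia _) (E u) (F gamma) => *; lra.
Qed.

Lemma euler_lagrange lambda r u v : H01 p V u -> E u < r ->
  (forall v, H01 p V v -> E v <= r -> functional lambda u <= functional lambda v) ->
  H01 p V v ->
  energy_form p u v - Ia (fun x => u x * v x) + lambda * Ig (fun x => f (u x) * v x) = 0.
Proof.
move=> Hu Eu umin Hv; have uc : {within V, continuous u} by case: Hu.
have vc : {within V, continuous v} by case: Hv.
have [M M0 uM] := V_continuous_bounded HV uc.
have [B B0 vB] := V_continuous_bounded HV vc.
have [G G0 hG] := weighted_bounded N_ge2 p_dist HV g_L1.
have fuc : {within V, continuous (fun x => f (u x))} by exact: within_continuous_comp_fun.
have fuvc := within_continuous_mul fuc vc.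
(* The Euler-Lagrange expression is the coefficient of [t] in the functional at [u + t v]; the
   quadratic terms form [Q], and the Taylor error of [F] is at most [e * |t|]. *)
apply: (@vanishing_first_order _ _ (2^-1 * E v - 2^-1 * Ia (fun x => v x ^+ 2))) => e e0.
have l1 : 0 < `|lambda| + 1 by rewrite ltr_wpDl.
have e1 : 0 < e / ((`|lambda| + 1) * G * B) by rewrite divr_gt0// !mulr_gt0.
have [d d0 hd] := signed_primitive_taylor f_cont M e1.
pose b := `|energy_form p u v|; have b0 : 0 <= b by exact: normr_ge0.
have Ev0 := energy_fine_ge0 N_ge2 p_dist HV (H01_finite N_ge2 p_dist HV Hv).
have den : 0 < 2 * b + E v + 1 by rewrite ltr_wpDl// addr_ge0// mulr_ge0.
(* The three bounds give [t ^+ 2 <= |t|], keep [t * v x] in the Taylor range, and keep [u + t v] in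
   the ball, using [E u < r]. *)
pose t0 := Num.min (Num.min 1 (d / B)) ((r - E u) / (2 * b + E v + 1)).
have t00 : 0 < t0 by rewrite !lt_min ltr01 !divr_gt0// subr_gt0.
exists t0 => // t; rewrite !le_min => /andP[/andP[t1 td] tr].
have Ht := H01D N_ge2 p_dist HV t Hu Hv.
have EE := energy_expand N_ge2 p_dist HV t (H01_finite N_ge2 p_dist HV Hu) (H01_finite N_ge2 p_dist HV Hv).
have {}tr : `|t| * (2 * b + E v + 1) <= r - E u by rewrite -ler_pdivlMr.
have Et : E (fun x => u x + t * v x) <= r.
  rewrite EE; have h1 : t * energy_form p u v <= `|t| * b.
    by rewrite -normrM ler_norm.
  have h2 : t ^+ 2 * E v <= `|t| * E v.
    by rewrite ler_wpM2r// -(ger0_norm (sqr_ge0 t)) normrX expr2 ler_piMl.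
  have h3 : 0 <= `|t| by [].
  move: h1 h2 h3 tr; move: (energy_form _ _ _) (E v) (E u) (`|t|) => *; lra.
have := umin _ Ht Et; rewrite /functional EE /potential.
have tc : {within V, continuous (fun x => u x + t * v x)} by case: Ht.
have aE : Ia (fun x => (u x + t * v x) ^+ 2) =
    Ia (fun x => u x ^+ 2) + 2 * t * Ia (fun x => u x * v x) + t ^+ 2 * Ia (fun x => v x ^+ 2).
  have uvc := within_continuous_mul uc vc.
  rewrite -(weightedD N_ge2 p_dist HV a_L1 _ (sqr_cont uc) uvc).
  rewrite -(weightedD N_ge2 p_dist HV a_L1 _ _ (sqr_cont vc)).
    by congr weighted; apply/funext => x; ring.
  apply: within_continuous_add (sqr_cont uc) _.
  exact: (within_continuous_mul (@within_continuous_cst _ _ V (2 * t)) uvc).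
have gE : `|Ig (fun x => F (u x + t * v x)) - Ig (fun x => F (u x)) -
    t * Ig (fun x => f (u x) * v x)| <= G * (e / ((`|lambda| + 1) * G * B) * (`|t| * B)).
  have tfc := within_continuous_mul (@within_continuous_cst _ _ V t) fuvc.
  rewrite -(weightedZ N_ge2 p_dist HV g_L1)//.
  rewrite weighted_diff//; [|exact: FU_cont..].
  have FFc := within_continuousB (FU_cont tc) (FU_cont uc).
  rewrite weighted_diff//; apply: hG; first exact: (within_continuousB FFc tfc).
  move=> x Vx /=.
  have tv : `|t * v x| <= `|t| * B by rewrite normrM ler_wpM2l// vB.
  have tvd : `|t * v x| <= d by rewrite (le_trans tv)// -ler_pdivlMr.
  rewrite (_ : t * (f (u x) * v x) = t * v x * f (u x)); last by ring.
  apply: le_trans (hd _ _ (uM x Vx) tvd) _.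
  by rewrite ler_wpM2l// ltW.
rewrite aE.
have lE : `|lambda| * (G * (e / ((`|lambda| + 1) * G * B) * (`|t| * B))) <= e * `|t|.
  have -> : G * (e / ((`|lambda| + 1) * G * B) * (`|t| * B)) = e * `|t| / (`|lambda| + 1).
    by field; rewrite !gt_eqF.
  by rewrite mulrCA ler_piMr ?mulr_ge0 ?(ltW e0)// ler_pdivrMr// mul1r lerDl.
have := ler_wpM2l (normr_ge0 lambda) gE; rewrite -normrM => /le_trans/(_ lE)/ler_normlP[_].
move: (Ig (fun x => F (u x + t * v x))) (Ig (fun x => F (u x))) (Ig (fun x => f (u x) * v x)).
move: (Ia (fun x => u x ^+ 2)) (Ia (fun x => u x * v x)) (Ia (fun x => v x ^+ 2)).
move: (energy_form p u v) (E u) (E v) (e * `|t|) => *; lra.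
Qed.

Hypothesis f_lim : primitive f xi / xi ^+ 2 @[xi --> 0^'+] --> +oo.

Let F_quadratic c : exists2 d, 0 < d & forall x, 0 < x -> x < d -> c * x ^+ 2 <= F x.
Proof.
have /cvgryPge/(_ c)/nbhs_ballP[d /= d0 hd] := f_lim.
exists d => // x x0 xd; rewrite signed_primitiveE ?(ltW x0)//.
rewrite -ler_pdivlMr ?exprn_gt0//; apply: hd => //.
by rewrite -ball_normE /= sub0r normrN gtr0_norm.
Qed.

Lemma signed_primitive_gt0 x : 0 < x -> 0 < F x.
Proof.
move=> x0; have [d d0 hd] := F_quadratic 1.
pose y := Num.min (d / 2) x.
have y0 : 0 < y by rewrite lt_min x0 divr_gt0.
have yd : y < d by rewrite gt_min ltr_pdivrMr// mulr_natr mulr2n ltrDl d0.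
apply: (@lt_le_trans _ _ (F y)).
  by apply: lt_le_trans (hd y y0 yd); rewrite mul1r exprn_gt0.
by apply: signed_primitive_nondecreasing => //; rewrite ge_min lexx orbT.
Qed.

Lemma functional_negative lambda r : 0 < lambda -> 0 < r ->
  exists v, [/\ H01 p V v, E v <= r & functional lambda v < 0].
Proof.
move=> l0 r0; have [w [Hw w0 [x0 Vx0 wx0]]] := H01_bump N_ge2 p_dist HV.
have wc : {within V, continuous w} by case: Hw.
have [c [d [c0 d0 hcd]]] := weighted_coercive N_ge2 p_dist HV g_cont g_le0 g_neq0 wc Vx0 wx0.
have Ew0 := energy_fine_ge0 N_ge2 p_dist HV (H01_finite N_ge2 p_dist HV Hw).
pose Q := 2^-1 * E w - 2^-1 * Ia (fun x => w x ^+ 2).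
have ldc : 0 < lambda * d * c ^+ 2 by rewrite !mulr_gt0// exprn_gt0.
(* This slope turns the [g] term into at most [- (Q + 1) * t ^+ 2], against the remaining terms
   [Q * t ^+ 2], so the functional is at most [- t ^+ 2]. *)
have [e e0 he] := F_quadratic ((Q + 1) / (lambda * d * c ^+ 2)).
pose t := Num.min (Num.min 1 (r / (E w + 1))) (e / (2 * c)).
have Ew1 : 0 < E w + 1 by rewrite ltr_wpDl.
have t0 : 0 < t by rewrite !lt_min ltr01 !divr_gt0// mulr_gt0.
have t1 : t <= 1 by rewrite !ge_min lexx.
have tr : t * (E w + 1) <= r by rewrite -ler_pdivlMr// !ge_min lexx !orbT.
have te : t * c < e.
  have : t * (2 * c) <= e by rewrite -ler_pdivlMr ?mulr_gt0// ge_min lexx orbT.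
  have : 0 < t * c by rewrite mulr_gt0.
  by lra.
pose v x := 0 + t * w x.
have Hv : H01 p V v by exact: (H01D N_ge2 p_dist HV t H01_0 Hw).
have Ev : E v = t ^+ 2 * E w.
  rewrite /v (energy_expand N_ge2 p_dist HV t (H01_finite N_ge2 p_dist HV H01_0) (H01_finite N_ge2 p_dist HV Hw)).
  by rewrite E0 form0 /= mulr0 !add0r.
have vE : v = (fun x => t * w x) by apply/funext => x; rewrite /v add0r.
have vc : {within V, continuous v} by case: Hv.
exists v; split=> //.
  rewrite Ev; apply: le_trans tr; rewrite expr2 -mulrA ler_pM2l//.
  by rewrite (@le_trans _ _ (E w)) ?ler_piMl ?lerDl.
have aE : Ia (fun x => v x ^+ 2) = t ^+ 2 * Ia (fun x => w x ^+ 2).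
  rewrite -(weightedZ N_ge2 p_dist HV a_L1 _ (sqr_cont wc)) vE.
  by congr weighted; apply/funext => x; rewrite exprMn.
have Ftc0 := signed_primitive_gt0 (mulr_gt0 t0 c0).
have gE : Ig (fun x => F (v x)) <= - (d * F (t * c)).
  apply: hcd; [exact: FU_cont| |exact: ltW|].
    move=> x Vx; rewrite -(signed_primitive0 f).
    by apply: signed_primitive_nondecreasing => //; rewrite vE mulr_ge0 ?w0// ltW.
  move=> x Vx cx; apply: signed_primitive_nondecreasing => //.
  by rewrite vE ler_pM2l.
have := he _ (mulr_gt0 t0 c0) te.
have -> : (Q + 1) / (lambda * d * c ^+ 2) * (t * c) ^+ 2 = (Q + 1) * t ^+ 2 / (lambda * d).
  by field; rewrite !gt_eqF.
rewrite ler_pdivrMr ?mulr_gt0// => Fge.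
have h1 := ler_wpM2l (ltW l0) gE.
have t2 : 0 < t ^+ 2 by rewrite exprn_gt0.
rewrite /functional /potential Ev aE; move: h1 t2 Fge; rewrite /Q.
move: (E w) (Ia _) (Ig _) (F (t * c)) (t ^+ 2) => y1 y2 y3 y4 y5 *; lra.
Qed.

Lemma weak_solution_exists lambda gamma : 0 < lambda -> 0 < gamma ->
  2 * lambda * F gamma * - Ig (fun=> 1) < gamma ^+ 2 / K ^+ 2 ->
  exists u, [/\ is_weak_solution p V a g f lambda u, exists x, V x /\ u x <> 0 &
    E u <= 2 * lambda * F gamma * - Ig (fun=> 1)].
Proof.
move=> l0 g0; set r := _ / _ => lr.
have r0 : 0 < r by rewrite divr_gt0// exprn_gt0.
have [u [Hu Eu umin]] := functional_minimizer lambda g0.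
have [v [Hv Ev v0]] := functional_negative l0 r0.
have u0 : functional lambda u < 0 by apply: le_lt_trans v0; exact: umin.
have Eu' := functional_le0_energy (ltW l0) (ltW g0) Hu Eu (ltW u0).
exists u; split=> //.
  split=> // h Hh; rewrite -[RHS](euler_lagrange Hu (le_lt_trans Eu' lr) umin Hh) /weighted.
  by congr (_ - _ + _ * _); apply: eq_Rintegral => x _; rewrite mulrA.
apply: contrapT => nu.
have uz x : V x -> u x = 0.
  by move=> Vx; apply: contrapT => ux; apply: nu; exists x.
have uc : {within V, continuous u} by case: Hu.
(* If [u] vanishes on V its potential is 0, and the functional is half the energy, hence
   non-negative: a contradiction. *)
have [C C0 hC] := potential_lipschitz lambda (lexx 0).
have : `|potential lambda u - potential lambda (fun=> 0)| <= C * 0.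
  by apply: hC => // [|x Vx|x Vx|x Vx]; rewrite ?uz ?subrr ?normr0//; exact: within_continuous_cst.
rewrite potential0 subr0 mulr0 normr_le0 => /eqP p0.
have := energy_fine_ge0 N_ge2 p_dist HV (H01_finite N_ge2 p_dist HV Hu).
by move: u0; rewrite /functional p0; lra.
Qed.

End variational.

Theorem theorem1p2 (R : realType) (N : nat) (p : 'I_N -> 'rV[R]_N.-1)
  (V : set 'rV[R]_N.-1) (a g : 'rV[R]_N.-1 -> R) (f : R -> R)
  (N_ge2 : (2 <= N)%N)
  (p_dist : forall i j : 'I_N, i != j -> euclid_dist (p i) (p j) = 1)
  (V_gasket : is_gasket p V)
  (a_L1 : (gasket_measure V).-integrable V (EFin \o a))
  (a_le0 : {ae gasket_measure V, forall x, V x -> a x <= 0})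
  (g_cont : {within V, continuous g})
  (g_le0 : forall x, V x -> g x <= 0)
  (g_neq0 : forall U : set 'rV[R]_N.-1, open U -> U `&` V !=set0 ->
     exists x, (U `&` V) x /\ g x <> 0)
  (f_cont : continuous f)
  (f_ge0 : forall t, 0 <= f t)
  (f_lim : primitive f xi / xi ^+ 2 @[xi --> 0^'+] --> +oo) :
  (0 < lambda_star V g f)%E /\
  exists u : R -> 'rV[R]_N.-1 -> R,
    (forall lambda : R, 0 < lambda -> (lambda%:E < lambda_star V g f)%E ->
       is_weak_solution p V a g f lambda (u lambda) /\
       exists x, V x /\ u lambda x <> 0) /\
    H01_norm p (u lambda) @[lambda --> 0^'+] --> 0.
Proof.
set K : R := 2 * N%:R + 3; set F := primitive f.
have K0 : 0 < K by rewrite ltr_wpDl// mulr_ge0.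
pose G := - weighted V g (fun=> 1).
have G0 : 0 < G by rewrite oppr_gt0; exact: (weighted1_lt0 N_ge2 p_dist V_gasket).
have GE : \int[gasket_measure V]_(x in V) g x = - G.
  by rewrite opprK /weighted; apply: eq_Rintegral => x _; rewrite mulr1.
have F0 x : 0 < x -> 0 < F x.
  move=> x0; rewrite /F -signed_primitiveE ?(ltW x0)//.
  exact: (signed_primitive_gt0 f_cont f_ge0 f_lim).
pose c := 1 / (2 * K ^+ 2 * G).
have c0 : 0 < c by rewrite divr_gt0// !mulr_gt0// exprn_gt0.
have starE : lambda_star V g f = (c%:E * ereal_sup [set (gamma ^+ 2 / F gamma)%:E |
    gamma in [set gamma : R | (0 < gamma)%R]])%E.
  by rewrite /lambda_star GE mulrN invrN mulrN opprK.
have star_ge gamma : 0 < gamma -> ((c * (gamma ^+ 2 / F gamma))%:E <= lambda_star V g f)%E.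
  move=> g0; rewrite starE EFinM lee_pmul2l// ?lte_fin//.
  by apply: ereal_sup_ubound; exists gamma.
have smallE lambda gamma : 0 < gamma -> lambda < c * (gamma ^+ 2 / F gamma) ->
    2 * lambda * F gamma * G < gamma ^+ 2 / K ^+ 2.
  move=> g0; have Fg := F0 _ g0.
  have -> : c * (gamma ^+ 2 / F gamma) = gamma ^+ 2 / K ^+ 2 / (2 * F gamma * G).
    by rewrite /c; field; rewrite !gt_eqF.
  rewrite ltr_pdivlMr ?mulr_gt0//; congr (_ < _); ring.
have solve lambda gamma : 0 < lambda -> 0 < gamma -> lambda < c * (gamma ^+ 2 / F gamma) ->
    exists u, [/\ is_weak_solution p V a g f lambda u, exists x, V x /\ u x <> 0 &
      fine (energy p u) <= 2 * lambda * F gamma * G].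
  move=> l0 g0 lg; have := weak_solution_exists N_ge2 p_dist V_gasket a_L1 a_le0
    g_cont g_le0 g_neq0 f_cont f_ge0 f_lim l0 g0.
  by rewrite signed_primitiveE ?(ltW g0)//; apply; exact: smallE.
pose l1 := c * (1 ^+ 2 / F 1).
have l10 : 0 < l1 by rewrite mulr_gt0// divr_gt0 ?F0// exprn_gt0.
split; first by apply: lt_le_trans (star_ge 1 ltr01); rewrite lte_fin.
(* Below [l1] the radius is always the one for [gamma = 1], so the chosen family also carries an
   energy bound linear in [lambda]; from [l1] on, [gamma] depends on [lambda]. *)
have ex lambda : exists v : 'rV[R]_N.-1 -> R, 0 < lambda ->
    (lambda%:E < lambda_star V g f)%E -> [/\ is_weak_solution p V a g f lambda v,
      exists x, V x /\ v x <> 0 &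
      lambda < l1 -> fine (energy p v) <= 2 * lambda * F 1 * G].
  have [l0|] := ltP 0 lambda; last by exists (fun=> 0).
  have [ll1|l1l] := ltP lambda l1.
    have [v [v1 v2 v3]] := solve _ _ l0 ltr01 ll1.
    by exists v.
  have [|] := boolP (lambda%:E < lambda_star V g f)%E; last by exists (fun=> 0).
  rewrite starE -lte_pdivrMl// -EFinM => /ereal_sup_gt[_ [gamma g0 <-]].
  rewrite lte_fin ltr_pdivrMl// => lg.
  have [v [v1 v2 v3]] := solve _ _ l0 g0 lg.
  by exists v.
have [u hu] := @choice _ _ _ ex.
exists u; split=> [lambda l0 /(hu _ l0)[]//|].
apply/cvgrPdist_le => e e0.
have b0 : 0 < e ^+ 2 / (2 * F 1 * G).
  by rewrite divr_gt0 ?exprn_gt0// !mulr_gt0// F0.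
near=> lambda.
have l0 : 0 < lambda by near: lambda; exact: nbhs_right_gt.
have ll1 : lambda < l1 by near: lambda; exact: nbhs_right_lt.
have lb : lambda < e ^+ 2 / (2 * F 1 * G) by near: lambda; exact: nbhs_right_lt.
have [|_ _ /(_ ll1) Eu] := hu lambda l0.
  by apply: lt_le_trans (star_ge 1 ltr01); rewrite lte_fin.
rewrite sub0r normrN ger0_norm ?sqrtr_ge0// -[leRHS]ger0_norm ?(ltW e0)// -sqrtr_sqr.
rewrite ler_sqrt ?sqr_ge0//; apply: le_trans Eu _.
move: lb; rewrite ltr_pdivlMr ?mulr_gt0 ?F0// => /ltW; apply: le_trans.
by rewrite le_eqVlt; apply/orP; left; apply/eqP; ring.
Unshelve. all: by end_near.
Qed.
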